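(* Let $g>0$. For every $k_0>0$ there exist $M_\infty>0$ and a function $v_\infty$ with $v_\infty\in W^{2,p}_{\mathrm{per}}$ for all $p\in[1,\infty)$ and $\partial_x^3v_\infty\in L^2_{\mathrm{loc}}(\{h_\infty>0\})$, where $h_\infty=1+v_\infty$. The function $v_\infty$ belongs to $\mathcal{X}\cap\mathcal{K}$; in particular, $v_\infty$ is even, periodic, and non-decreasing on $[-\tfrac{\pi}{k_0},0)$. Furthermore, $v_\infty\ge-1$ with $v_\infty(x)=-1$ precisely at $x=\pm\tfrac{\pi}{k_0}+2j\tfrac{\pi}{k_0}$, $j\in\mathbb{Z}$. Let $\{(v(s),M(s)):s\in\mathbb{R}\}$ be the global bifurcation branch of solutions of $F(v,M)=0$ emanating from $(0,M^*(k_0))$, $M^*(k_0)=4g+4k_0^2$, and $h(s)=1+v(s)$. Then, along a sequence $s\to\infty$, the following convergence results hold: (1) $v(s)\rightharpoonup v_\infty$ weakly in $W^{2,p}_{\mathrm{per}}$ (for $p\in[1,\infty)$), in particular $v(s)\to v_\infty$ strongly in $C^1(\mathbb{R})$; (2) $\partial_x^3v(s)\rightharpoonup\partial_x^3v_\infty$ weakly in $L^2_{\mathrm{loc}}(\{h_\infty>0\})$; (3) $h(s)^3\partial_x^3h(s)\to h_\infty^3\partial_x^3h_\infty=g\,h_\infty^3\partial_xh_\infty-M_\infty\frac{h_\infty^2}{(1+h_\infty)^2}\partial_xh_\infty$ strongly in $C^0(\mathbb{R})$, where $h_\infty^3\partial_x^3h_\infty$ is extended continuously by zero to the points where $h_\infty=0$.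 In particular, $h_\infty$ is a weak stationary solution (in the sense defined in the context) to $$\partial_x\Bigl(h_\infty^3\bigl(\partial_x^3h_\infty-g\,\partial_xh_\infty\bigr)+M_\infty\frac{h_\infty^2}{(1+h_\infty)^2}\partial_xh_\infty\Bigr)=0 .$$
   Context: Let $H^2_{\mathrm{per}}$, $L^2_{\mathrm{per}}$, $W^{2,p}_{\mathrm{per}}$ be the spaces of $\tfrac{2\pi}{k_0}$-periodic functions in $H^2_{\mathrm{loc}}(\mathbb R)$, $L^2_{\mathrm{loc}}(\mathbb R)$, $W^{2,p}_{\mathrm{loc}}(\mathbb R)$, with norms on $(-\tfrac{\pi}{k_0},\tfrac{\pi}{k_0})$. Let $\mathcal{X}=\{v\in H^2_{\mathrm{per}}: v\text{ even},\ \int_{-\pi/k_0}^{\pi/k_0}v\,\mathrm{d}x=0\}$, $\mathcal{Y}=\{v\in L^2_{\mathrm{per}}: v\text{ even},\ \int_{-\pi/k_0}^{\pi/k_0}v\,\mathrm{d}x=0\}$, $\mathcal{U}=\{v\in\mathcal{X}:v>-1\}$, $\mathcal{K}=\{v\in\mathcal{X}:v\text{ non-decreasing on }(-\tfrac{\pi}{k_0},0)\}$, and define $F:\mathcal{U}\times\mathbb{R}\to\mathcal{Y}$ by $$F(v,M)=\partial_x^2v-gv+M\Bigl(\frac{1}{2+v}+\log\frac{1+v}{2+v}\Bigr)-MK(v),\quad K(v)=\frac{k_0}{2\pi}\int_{-\pi/k_0}^{\pi/k_0}\Bigl(\frac{1}{2+v}+\log\frac{1+v}{2+v}\Bigr)\mathrm{d}x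 .$$ Local branch: the curve of solutions of $F(v,M)=0$, $s\in(-\varepsilon,\varepsilon)$, given by the Crandall–Rabinowitz theorem at $(0,M^*(k_0))$; it satisfies $v(s)=s\cos(k_0x)+O(s^2)$ in $\mathcal{X}$ and $M(s)=M^*(k_0)-\frac{(g+k_0^2)(8g+41k_0^2)}{12k_0^2}s^2+O(|s|^3)$. Global bifurcation branch: the continuous curve $\mathbb{R}\ni s\mapsto(v(s),M(s))\in\mathcal{U}\times\mathbb{R}$ of (smooth) solutions of $F(v,M)=0$ that coincides with the local branch for small $|s|$ and whose halves $s\ge0$ and $s\le0$ are the curves furnished by the analytic global bifurcation theorem (Buffoni–Toland, *Analytic Theory of Global Bifurcation*, Theorem 9.1.1). In particular: the set of $s$ at which $\ker\partial_vF(v(s),M(s))\neq\{0\}$ has no accumulation points; near every $s^*\neq 0$ the curve has a local real-analytic reparametrisation (there is a continuous injective $\rho:(-1,1)\to\mathbb{R}$, $\rho(0)=s^*$, with $t\mapsto(v(\rho(t)),M(\rho(t)))$ real analytic); on each half, if the curve takes the same value at two different parameters at which $\ker\partial_vF=\{0\}$, then the curve is a closed loop; and at least one of the following holds: $\|(v(s),M(s))\|_{\mathcal X\times\mathbb R}\to\infty$ as $s\to\pm\infty$, or the curve approaches the boundary of $\mathcal U$ (where $\min v=-1$), or the curve is a closed loop (there is $T>0$ with $(v(s+T),M(s+T))=(v(s),M(s))$ for all $s$). Weak stationary solution: for $M\in\mathbb{R}$, a function $h\in H^1_{\mathrm{loc}}(\mathbb{R})$ with $\partial_x^3h\in L^2_{\mathrm{loc}}(\{h>0\})$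 and $h^3(\partial_x^3h-g\,\partial_xh)+M\frac{h^2}{(1+h)^2}\partial_xh\in L^2_{\mathrm{loc}}(\mathbb{R})$ is a weak stationary solution if $$\int_{\{h>0\}}\Bigl(h^3(\partial_x^3h-g\,\partial_xh)+M\frac{h^2}{(1+h)^2}\partial_xh\Bigr)\partial_x\varphi\,\mathrm{d}x=0$$ for all $\varphi\in H^1(\mathbb{R})$ with compact support. Here $\{h>0\}=\{x\in\mathbb{R}:h(x)>0\}$. *)

(* Defs.v *)
From HB Require Import structures.
From mathcomp Require Export all_boot all_order all_algebra.
From mathcomp Require Export all_classical all_reals all_analysis.

Set Implicit Arguments.
Unset Strict Implicit.
Unset Printing Implicit Defensive.

Import Order.TTheory GRing.Theory Num.Theory.
Import numFieldNormedType.Exports.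

Local Open Scope ring_scope.
Local Open Scope classical_set_scope.

Section function_spaces.
Context {R : realType}.
Notation mu := (@lebesgue_measure R).

Definition smooth (u : R -> R) : Prop :=
  forall (n : nat) (x : R), derivable (u^`(n)) x 1.

Definition test_fun (D : set R) (phi : R -> R) : Prop :=
  smooth phi /\
  exists K : set R, [/\ compact K, K `<=` D & forall x, ~ K x -> phi x = 0].

(* [w] is the [n]-th distributional derivative of [u] on the open set [D];
   openness of [D] is part of [locally_integrable]. *)
Definition is_wderiv (D : set R) (n : nat) (u w : R -> R) : Prop :=
  [/\ locally_integrable D u, locally_integrable D w &
      forall phi, test_fun D phi ->
        \int[mu]_(x in D) (u x * derive1n n phi x) =
        (-1) ^+ n * \int[mu]_(x in D) (w x * phi x)].

(* A chosen representative of the weak derivative, which is unique up to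
   null sets; 0 if there is none. *)
Definition wderiv (D : set R) (n : nat) (u : R -> R) : R -> R :=
  xget (fun=> 0) [set w | is_wderiv D n u w].

Definition Lp_norm (A : set R) (p : R) (u : R -> R) : \bar R :=
  Lnorm mu p%:E (EFin \o (u \_ A)).

Definition Lp (A : set R) (p : R) : set (R -> R) :=
  [set u | measurable_fun A u /\ (Lp_norm A p u < +oo)%E].

Definition Lp_loc (D : set R) (p : R) : set (R -> R) :=
  [set u | forall K, compact K -> K `<=` D -> Lp K p u].

Definition W_loc (D : set R) (k : nat) (p : R) : set (R -> R) :=
  [set u | forall j : nat, (j <= k)%N ->
    exists2 w, is_wderiv D j u w & Lp_loc D p w].

Definition cell (k0 : R) : set R := [set` `]-(pi / k0), pi / k0[].

Definition W_per (k0 : R) (k : nat) (p : R) : set (R -> R) :=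
  [set u | periodic u (2 * pi / k0) /\ W_loc setT k p u].

Definition W_norm (k0 : R) (k : nat) (p : R) (u : R -> R) : \bar R :=
  (\sum_(j < k.+1) Lp_norm (cell k0) p (wderiv setT j u))%E.

Definition bounded_functional (V : set (R -> R)) (N : (R -> R) -> \bar R)
    (l : (R -> R) -> R) : Prop :=
  (forall (a : R) u1 u2, V u1 -> V u2 ->
     l (fun x => a * u1 x + u2 x) = a * l u1 + l u2) /\
  (exists C : R, forall u, V u -> (`|l u|%:E <= C%:E * N u)%E).

Definition weak_cvg (V : set (R -> R)) (N : (R -> R) -> \bar R)
    (u_ : nat -> R -> R) (u : R -> R) : Prop :=
  [/\ forall n, V (u_ n), V u &
      forall l, bounded_functional V N l -> l (u_ n) @[n --> \oo] --> l u].

Definition weak_cvg_Lp_loc (D : set R) (p : R)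
    (u_ : nat -> R -> R) (u : R -> R) : Prop :=
  forall K, compact K -> K `<=` D -> weak_cvg (Lp K p) (Lp_norm K p) u_ u.

Definition C1 (u : R -> R) : Prop :=
  (forall x, derivable u x 1) /\ continuous u^`().

Definition cvg_C1 (u_ : nat -> R -> R) (u : R -> R) : Prop :=
  [/\ forall n, C1 (u_ n), C1 u,
      {uniform setT, u_ @ \oo --> u} &
      {uniform setT, (fun n => (u_ n)^`()) @ \oo --> u^`()}].

End function_spaces.

Section bifurcation.
Context {R : realType}.
Notation mu := (@lebesgue_measure R).

Definition even_fun (v : R -> R) : Prop := forall x, v (- x) = v x.

Definition mean_zero (k0 : R) (v : R -> R) : Prop :=
  \int[mu]_(x in cell k0) v x = 0.

(* Elements of H^2_per are represented by their continuous representative, so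
   that pointwise conditions such as [v > -1] make sense. *)
Definition X (k0 : R) : set (R -> R) :=
  [set v | [/\ W_per k0 2 2 v, continuous v, even_fun v & mean_zero k0 v]].

(* Elements of L^2_per are functions considered up to null sets; evenness is
   therefore required almost everywhere. *)
Definition Y (k0 : R) : set (R -> R) :=
  [set v | [/\ W_per k0 0 2 v, {ae mu, forall x, v (- x) = v x} &
               mean_zero k0 v]].

Definition X_norm (k0 : R) (v : R -> R) : \bar R := W_norm k0 2 2 v.
Definition Y_norm (k0 : R) (v : R -> R) : \bar R := Lp_norm (cell k0) 2 v.
Definition XR_norm (k0 : R) (v : R -> R) (m : R) : \bar R :=
  (X_norm k0 v + `|m|%:E)%E.

Definition U (k0 : R) : set (R -> R) := [set v | X k0 v /\ forall x, -1 < v x].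

Definition Kcone (k0 : R) : set (R -> R) :=
  [set v | X k0 v /\
    {in `]-(pi / k0), 0[ &, {homo v : x y / x <= y}}].

Definition nonlin (y : R) : R := (2 + y)^-1 + ln ((1 + y) / (2 + y)).

Definition Kmean (k0 : R) (v : R -> R) : R :=
  k0 / (2 * pi) * \int[mu]_(x in cell k0) nonlin (v x).

Definition F (g k0 : R) (v : R -> R) (M : R) : R -> R := fun x =>
  wderiv setT 2 v x - g * v x + M * nonlin (v x) - M * Kmean k0 v.

Definition solution (g k0 : R) (v : R -> R) (M : R) : Prop :=
  U k0 v /\ {ae mu, forall x, F g k0 v M x = 0}.

(* [L] is the Frechet derivative at [v] of [F(., M)] as a map from the open
   subset [U] of [X] to [Y]. *)
Definition is_dvF (g k0 : R) (v : R -> R) (M : R)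
    (L : (R -> R) -> (R -> R)) : Prop :=
  [/\ forall w, X k0 w -> Y k0 (L w),
      forall (a : R) w1 w2, X k0 w1 -> X k0 w2 ->
        {ae mu, forall x,
          L (fun y => a * w1 y + w2 y) x = a * L w1 x + L w2 x},
      exists C : R, forall w, X k0 w ->
        (Y_norm k0 (L w) <= C%:E * X_norm k0 w)%E &
      forall e : R, 0 < e -> exists2 d : R, 0 < d &
        forall w, U k0 (fun x => v x + w x) -> X k0 w ->
          (X_norm k0 w < d%:E)%E ->
          (Y_norm k0 (fun x => F g k0 (fun y => v y + w y)%R M x
                               - F g k0 v M x - L w x)%R
             <= e%:E * X_norm k0 w)%E].

Definition ker_trivial (g k0 : R) (v : R -> R) (M : R) : Prop :=
  exists L, is_dvF g k0 v M L /\
    forall w, X k0 w -> {ae mu, forall x, L w x = 0} -> forall x, w x = 0.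

Definition Mstar (g k0 : R) : R := 4 * g + 4 * k0 ^+ 2.

Definition continuous_curve (k0 : R) (v : R -> R -> R) (M : R -> R) : Prop :=
  forall s0,
    XR_norm k0 (fun x => v s x - v s0 x) (M s - M s0) @[s --> s0] --> 0%E.

(* The curve [t |-> (v t, M t)] is the sum of a convergent power series with
   coefficients in [X * R] around [t0]. *)
Definition analytic_at (k0 : R) (v : R -> R -> R) (M : R -> R)
    (t0 : R) : Prop :=
  exists (a : nat -> R -> R) (m : nat -> R) (r : R),
    [/\ 0 < r, forall i, X k0 (a i) &
        forall t, `|t - t0| < r ->
          XR_norm k0
            (fun x => v t x - \sum_(i < n) (t - t0) ^+ i * a i x)
            (M t - \sum_(i < n) (t - t0) ^+ i * m i) @[n --> \oo] --> 0%E].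

(* Conclusion of the Crandall-Rabinowitz theorem at [(0, Mstar g k0)] for the
   analytic map [F], together with the second-order expansions. *)
Record local_branch (g k0 eps : R) (v : R -> R -> R)
    (M : R -> R) : Prop := {
  local_eps : 0 < eps;
  local_solution : forall s, `|s| < eps -> solution g k0 (v s) (M s);
  local_analytic : forall s, `|s| < eps -> analytic_at k0 v M s;
  local_v : exists C : R, \forall s \near (0 : R),
    (X_norm k0 (fun x => v s x - s * cos (k0 * x))%R <= (C * s ^+ 2)%:E)%E;
  local_M : exists C : R, \forall s \near (0 : R),
    `|M s - (Mstar g k0
        - (g + k0 ^+ 2) * (8 * g + 41 * k0 ^+ 2) / (12 * k0 ^+ 2) * s ^+ 2)|
      <= C * `|s| ^+ 3;
  (* every nontrivial solution near the bifurcation point lies on the curve *)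
  local_unique : exists2 d : R, 0 < d &
    forall w m, solution g k0 w m -> (exists x, w x != 0) ->
      (XR_norm k0 w (m - Mstar g k0) < d%:E)%E ->
      exists s, [/\ 0 < `|s|, `|s| < eps, w = v s & m = M s] }.

Definition blow_up (k0 : R) (v : R -> R -> R) (M : R -> R) : Prop :=
  XR_norm k0 (v s) (M s) @[s --> +oo] --> +oo%E.

(* liminf as s -> +oo of (min v(s)) is -1, i.e. the boundary is approached at
   least along a sequence *)
Definition approaches_boundary (v : R -> R -> R) : Prop :=
  forall e S : R, 0 < e -> exists s, S <= s /\ exists x, v s x < -1 + e.

Definition half_period (v : R -> R -> R) (M : R -> R) (T : R) : Prop :=
  0 < T /\ forall s, 0 <= s -> v (s + T) = v s /\ M (s + T) = M s.

(* [T] is the smallest period of the half-curve [s >= 0]. *)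
Definition closed_loop (v : R -> R -> R) (M : R -> R) (T : R) : Prop :=
  half_period v M T /\ forall T', half_period v M T' -> T <= T'.

(* Global alternatives and non-self-intersection in Buffoni-Toland,
   Theorem 9.1.1 (e) and (f), for the half-curve [s >= 0]. As in (f) there,
   values with trivial kernel only recur after a whole number of turns: this
   forbids a curve that runs back over itself. *)
Record global_half (g k0 : R) (v : R -> R -> R) (M : R -> R) : Prop := {
  half_alternatives :
    [\/ blow_up k0 v M, approaches_boundary v | exists T, closed_loop v M T];
  half_intersection : forall s1 s2, 0 <= s1 -> 0 <= s2 -> s1 != s2 ->
    v s1 = v s2 -> M s1 = M s2 -> ker_trivial g k0 (v s1) (M s1) ->
    exists T, closed_loop v M T /\ exists n : nat, `|s1 - s2| = n%:R * T }.

Record global_branch (g k0 : R) (v : R -> R -> R) (M : R -> R) : Prop := {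
  global_solution : forall s, solution g k0 (v s) (M s);
  global_smooth : forall s, smooth (v s);
  global_continuous : continuous_curve k0 v M;
  global_local : exists eps vl Ml, local_branch g k0 eps vl Ml /\
    \forall s \near (0 : R), v s = vl s /\ M s = Ml s;
  global_kernel :
    limit_point [set s | ~ ker_trivial g k0 (v s) (M s)] = set0;
  global_analytic : forall s0, s0 != 0 -> exists rho : R -> R,
    [/\ {in `]-1, 1[, continuous rho},
        {in `]-1, 1[ &, injective rho},
        rho 0 = s0 &
        {in `]-1, 1[, forall t, analytic_at k0 (v \o rho) (M \o rho) t}];
  global_right : global_half g k0 v M;
  global_left : global_half g k0 (fun s => v (- s)) (fun s => M (- s)) }.

(* The flux [h^3 (h''' - g h') + M h^2 / (1 + h)^2 h'], with [h'''] taken on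
   the open set [{h > 0}] and the flux extended by zero outside of it. *)
Definition flux (g M : R) (h : R -> R) : R -> R :=
  let D := [set x | 0 < h x] in
  let h1 := wderiv setT 1 h in
  (fun x => h x ^+ 3 * (wderiv D 3 h x - g * h1 x)
            + M * (h x ^+ 2 / (1 + h x) ^+ 2) * h1 x) \_ D.

Definition weak_stationary (g M : R) (h : R -> R) : Prop :=
  let D := [set x | 0 < h x] in
  [/\ continuous h /\ W_loc setT 1 2 h,
      exists2 w, is_wderiv D 3 h w & Lp_loc D 2 w,
      Lp_loc setT 2 (flux g M h) &
      forall phi, W_loc setT 1 2 phi ->
        (exists B : R, forall x, B < `|x| -> phi x = 0) ->
        \int[mu]_(x in D) (flux g M h x * wderiv setT 1 phi x) = 0].

End bifurcation.

(* Main.v *)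
Require Import Defs.
From HB Require Import structures.
From mathcomp Require Import all_boot all_order all_algebra.
From mathcomp Require Import all_classical all_reals all_analysis.
From mathcomp Require Import measurable_realfun ring lra.

(* On s > 0 the profile v(s) is strictly decreasing on (0, L), L = pi / k0. The
   set A of such s contains all small s, is open because v'' does not vanish at 0
   and L, and is closed except where v(s) = 0, by uniqueness for the equation.
   If s0 were the first parameter outside A, then v(s0) = 0 and Sturm's theorem
   for v' forces M(s0) = Mstar; near (0, Mstar) a solution is determined by its value
   at 0, so that the curve just before s0 takes values it had near s = 0. As it
   may only recur after whole turns and v(s) <> 0 before s0, this is impossible.
   A closed loop is excluded as well: it would return to v(0) = 0.

   For one-bump profiles, Sturm comparison for v' bounds M, and the conserved
   energy bounds v, so that blow-up is impossible while min v stays away from -1.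
   Hence min v(s) -> -1 along a sequence. There M >= g / 8, and the energy gives
   1 + v >= kap (L - x)^2 and v'^2 <= C ((1 + v) + sqrt (1 + v)). By Gronwall's
   inequality on [0, L - eta] and smallness of 1 + v and v' near L, v and v'
   converge uniformly as soon as M, the Lagrange multiplier and v(0) do. The
   right-hand side of the equation for v'' is at most logarithmically singular in
   L - x, so dominated convergence gives strong, hence weak, convergence in
   W^{2,p}. The third derivative follows by differentiating the equation. *)

Set Implicit Arguments.
Unset Strict Implicit.
Unset Printing Implicit Defensive.

Import Order.TTheory GRing.Theory Num.Theory.
Import numFieldNormedType.Exports.

Local Open Scope ring_scope.
Local Open Scope classical_set_scope.

(** * Calculus of one variable *)

Section calculus.
Context {R : realType}.
Implicit Types (f g u : R -> R) (a b x y z : R).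

(** The equation is nonlocal through [Kmean]. With [c = M K(v)] treated as an unknown constant it
    becomes an autonomous second-order equation, and the zero mean gives [c] back by Rolle's
    theorem. Closeness of [v] in sup norm and of M therefore controls [c], hence [v''], and no
    stronger norm is needed in the perturbation arguments. Write f for [nonlin]. For a one-bump
    profile [u = - v'] is positive on (0, L), vanishes at both ends and solves
    [u'' + (M f'(v) - g) u = 0]. Comparison with the sine of half period L yields a point where
    [M f'(v) = g + k0^2]; since [f'(0) = 1/4], small profiles must have M close to [Mstar]. The
    difficulty at rupture is that f and f' are unbounded at -1, so that Gronwall's inequality cannot
    reach L. An antiderivative of f stays bounded there, so the energy identity remains informative
    and makes the slope small where [1 + v] is. Moreover [- M f(v)] then outweighs all other terms
    of [v''], so the profile is strictly convex near L, uniformly along the sequence; this is the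
    source of the quadratic lower bound. *)

Lemma der_continuous f (f' : R -> R) :
  (forall x, is_derive x 1 f (f' x)) -> continuous f.
Proof.
move=> df x; apply/differentiable_continuous/derivable1_diffP.
exact: (@ex_derive _ _ _ _ _ _ _ (df x)).
Qed.

Lemma der_continuous_within f (f' : R -> R) a b :
  (forall x, a <= x <= b -> is_derive x 1 f (f' x)) ->
  {within `[a, b], continuous f}.
Proof.
move=> df; apply: derivable_within_continuous => x; rewrite in_itv/= => xab.
exact: (@ex_derive _ _ _ _ _ _ _ (df x xab)).
Qed.

Lemma der_mvt f (f' : R -> R) a b : a < b ->
  (forall x, a <= x <= b -> is_derive x 1 f (f' x)) ->
  exists c, [/\ a < c, c < b & f b - f a = f' c * (b - a)].
Proof.
move=> ab df; have [x xab|c|c] := @MVT R f f' a b ab.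
- by apply: df; rewrite in_itv/= in xab; case/andP: xab => /ltW -> /ltW ->.
- exact: (@der_continuous_within f f' a b df c).
- by rewrite in_itv/= => /andP[ac cb] E; exists c.
Qed.

Lemma der_lip f (f' : R -> R) a b (B : R) : a <= b ->
  (forall x, a <= x <= b -> is_derive x 1 f (f' x)) ->
  (forall x, a <= x <= b -> `|f' x| <= B) ->
  `|f b - f a| <= B * (b - a).
Proof.
move=> ab df fB; have [ab'|ba] := ltP a b; last first.
  have -> : a = b by apply/eqP; rewrite eq_le ab.
  by rewrite !subrr normr0 mulr0.
have [c [ac cb ->]] := der_mvt ab' df.
rewrite normrM [`|b - a|]ger0_norm ?subr_ge0//.
by rewrite ler_wpM2r ?subr_ge0// fB// !ltW.
Qed.

Lemma der_le f (f' : R -> R) a b : a <= b ->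
  (forall x, a <= x <= b -> is_derive x 1 f (f' x)) ->
  (forall x, a < x < b -> 0 <= f' x) -> f a <= f b.
Proof.
move=> ab df fB; have [ab'|ba] := ltP a b; last first.
  by have -> : a = b by apply/eqP; rewrite eq_le ab.
have [c [ac cb E]] := der_mvt ab' df.
by rewrite -subr_ge0 E mulr_ge0 ?subr_ge0// fB// ac.
Qed.

Lemma der_lt f (f' : R -> R) a b : a < b ->
  (forall x, a <= x <= b -> is_derive x 1 f (f' x)) ->
  (forall x, a < x < b -> 0 < f' x) -> f a < f b.
Proof.
move=> ab df fB.
have [c [ac cb E]] := der_mvt ab df.
by rewrite -subr_gt0 E mulr_gt0 ?subr_gt0// fB// ac.
Qed.

Lemma der_ge_bound f (f' : R -> R) a b (B : R) : a <= b ->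
  (forall x, a <= x <= b -> is_derive x 1 f (f' x)) ->
  (forall x, a < x < b -> B <= f' x) -> B * (b - a) <= f b - f a.
Proof.
move=> ab df fB; have [ab'|ba] := ltP a b; last first.
  have -> : a = b by apply/eqP; rewrite eq_le ab.
  by rewrite !subrr mulr0.
have [c [ac cb ->]] := der_mvt ab' df.
by rewrite ler_wpM2r ?subr_ge0// fB// ac.
Qed.

Lemma der_cst f (f' : R -> R) a b : a <= b ->
  (forall x, a <= x <= b -> is_derive x 1 f (f' x)) ->
  (forall x, a <= x <= b -> f' x = 0) -> f b = f a.
Proof.
move=> ab df f0; apply/eqP; rewrite -subr_eq0 -normr_le0.
rewrite (le_trans (der_lip (B:=0) ab df _)) ?mul0r// => x /f0 ->.
by rewrite normr0.
Qed.

Lemma ivt f a b c : a <= b -> continuous f -> f a <= c <= f b ->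
  exists2 x, a <= x <= b & f x = c.
Proof.
move=> ab cf /andP[h1 h2].
have [| |x] := @IVT R f a b c ab.
- exact: continuous_subspaceT.
- by rewrite ge_min h1/= le_max h2 orbT.
- by rewrite in_itv/= => ? ?; exists x.
Qed.

Lemma ivtN f a b c : a <= b -> continuous f -> f b <= c <= f a ->
  exists2 x, a <= x <= b & f x = c.
Proof.
move=> ab cf /andP[h1 h2].
have [| |x] := @IVT R f a b c ab.
- exact: continuous_subspaceT.
- by rewrite ge_min h1 orbT/= le_max h2.
- by rewrite in_itv/= => ? ?; exists x.
Qed.

Lemma cont_bound f a b : a <= b -> continuous f ->
  exists B : R, forall x, a <= x <= b -> `|f x| <= B.
Proof.
move=> ab cf.
have cnf : continuous (fun x => `|f x|).
  by move=> x; apply: continuous_comp; [exact: cf|exact: norm_continuous].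
have [c cab H] := @EVT_max R _ a b ab (continuous_subspaceT cnf).
by exists `|f c| => x xab; apply: H; rewrite in_itv.
Qed.

Lemma cont_min f a b : a <= b -> continuous f ->
  exists2 c, a <= c <= b & forall x, a <= x <= b -> f c <= f x.
Proof.
move=> ab cf.
have [c cab H] := @EVT_min R _ a b ab (continuous_subspaceT cf).
by exists c => // x xab; apply: H; rewrite in_itv.
Qed.

(** Adding [e ^+ 2] to the energy absorbs the inhomogeneity: Young's inequality bounds the
    derivative of y^2 + y'^2 + e^2 by 2 + B times itself, so its product with exp (-(2 + B) x) does
    not increase. *)
Lemma gronwall2 (y y' y'' : R -> R) (A B e x0 x1 : R) : x0 <= x1 -> 0 <= A -> 0 <= B -> 0 <= e ->
  (forall x, x0 <= x <= x1 -> is_derive x 1 y (y' x)) ->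
  (forall x, x0 <= x <= x1 -> is_derive x 1 y' (y'' x)) ->
  (forall x, x0 <= x <= x1 -> `|y'' x| <= B * `|y x| + e) ->
  y x0 ^+ 2 + y' x0 ^+ 2 <= A ->
  forall x, x0 <= x <= x1 ->
    y x ^+ 2 + y' x ^+ 2 <= (A + e ^+ 2) * expR ((2 + B) * (x1 - x0)).
Proof.
move=> x01 A0 B0 e0 dy dy' hy'' h0 x /andP[x0x xx1].
pose k := 2 + B.
pose E z := (y z ^+ 2 + y' z ^+ 2 + e ^+ 2) * expR (- k * z).
pose E' z := ((2 * y z * y' z + 2 * y' z * y'' z)
   - k * (y z ^+ 2 + y' z ^+ 2 + e ^+ 2)) * expR (- k * z).
have dE z : x0 <= z <= x -> is_derive z 1 (fun z => - E z) (- E' z).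
  move=> /andP[z0 z1]; have z01 : x0 <= z <= x1 by rewrite z0 (le_trans z1).
  have dyz := dy z z01; have dyz' := dy' z z01.
  apply: is_derive_eq; rewrite /E' /k /GRing.scale/=.
  rewrite !(scaler0, mulr0, addr0, expr1, mulr1, add0r)/=.
  by set ee := expR _; rewrite /GRing.scale/=; ring.
have HE : E x <= E x0.
  rewrite -lerN2; apply: (der_le x0x dE) => z.
  move=> /andP[/ltW z0 /ltW z1]; rewrite -mulNr mulr_ge0 ?expR_ge0//.
  rewrite oppr_ge0 subr_le0.
  have := hy'' z; rewrite z0 (le_trans z1)// => /(_ isT) H.
  have h1 : 2 * y z * y' z <= y z ^+ 2 + y' z ^+ 2.
    by rewrite -subr_ge0 (_ : _ - _ = (y z - y' z) ^+ 2) ?sqr_ge0//; ring.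
  have h2 : 2 * y' z * y'' z <= 2 * `|y' z| * (B * `|y z| + e).
    rewrite (le_trans (ler_norm _))// !normrM (ger0_norm (ler0n _ 2)).
    by rewrite ler_wpM2l// mulr_ge0.
  have h3 : 2 * `|y' z| * (B * `|y z| + e) <=
      B * (y z ^+ 2 + y' z ^+ 2) + y' z ^+ 2 + e ^+ 2.
    rewrite -(real_normK (num_real (y z))) -(real_normK (num_real (y' z))).
    rewrite -subr_ge0.
    set p := `|y z|; set q := `|y' z|.
    rewrite (_ : _ - _ = B * (p - q) ^+ 2 + (q - e) ^+ 2); last by ring.
    by apply: addr_ge0; [apply: mulr_ge0 => //|]; exact: sqr_ge0.
  rewrite /k; have := sqr_ge0 (y z); have := sqr_ge0 (y' z); have := sqr_ge0 e.
  nra.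
have h : y x ^+ 2 + y' x ^+ 2 + e ^+ 2 <= (A + e ^+ 2) * expR (k * (x - x0)).
  have := ler_wpM2r (expR_ge0 (k * x)) HE.
  rewrite /E -!mulrA -!expRD mulNr addNr expR0 mulr1 => /le_trans; apply.
  have -> : - k * x0 + k * x = k * (x - x0) by ring.
  by rewrite ler_wpM2r ?expR_ge0// lerD2r.
apply: (@le_trans _ _ ((A + e ^+ 2) * expR (k * (x - x0)))).
  by apply: le_trans h; rewrite lerDl sqr_ge0.
rewrite ler_wpM2l ?addr_ge0 ?sqr_ge0// ler_expR ler_wpM2l//.
  by rewrite addr_ge0.
by rewrite lerD2r.
Qed.

Lemma der_primitive f (B : R) : continuous f ->
  exists F : R -> R, (forall x, `|x| <= B -> is_derive x 1 F (f x)) /\ F 0 = 0.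
Proof.
move=> cf; have [B0|B0] := ltP B 0.
  exists (cst 0); split=> // x xB; exfalso.
  by have := le_lt_trans xB B0; rewrite normr_lt0.
(* The base point lies strictly left of -B, so every x with |x| <= B is interior to [-B - 1, B + 1],
   where the fundamental theorem applies. *)
pose G x := (\int[lebesgue_measure]_(t in `[- B - 1, x]) f t)%R.
exists (fun x => G x - G 0); split; last by rewrite subrr.
move=> x xB.
have [dG G'] : derivable G x 1 /\ G^`() x = f x.
  apply: (@continuous_FTC1_closed _ f (- B - 1) x (B + 1)).
  - by move: xB; rewrite ler_norml => /andP[h1 h2]; lra.
  - apply: continuous_compact_integrable; first exact: segment_compact.
    exact: continuous_subspaceT.
  - by move: xB; rewrite ler_norml => /andP[h1 h2]; lra.
  - exact: cf.
have HG : is_derive x 1 G (f x) by rewrite -G' derive1E; exact: derivableP.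
by apply: is_derive_eq; rewrite subr0.
Qed.

Lemma min3 x y z : 0 < x -> 0 < y -> 0 < z ->
  exists e : R, [/\ 0 < e, e <= x, e <= y & e <= z].
Proof.
move=> x0 y0 z0; exists (Num.min x (Num.min y z)).
by rewrite !lt_min x0 y0 z0 !ge_min !lexx !orbT.
Qed.

Lemma cont_eps f x (e : R) : {for x, continuous f} -> 0 < e ->
  exists2 d : R, 0 < d & forall y, `|x - y| < d -> `|f x - f y| < e.
Proof.
move=> cf e0; have /cvgrPdist_lt/(_ e e0) := cf.
by move=> [d /= d0 H]; exists d => // y xy; exact: H.
Qed.

(** P and Q are coordinates in the rotating frame of y'' + k^2 y = 0: P' = S cos (k x), Q' = S sin
    (k x) and k y = P sin (k x) - Q cos (k x). Each is at most B x, hence the factor 2. *)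
Lemma variation_of_constants (y y' S : R -> R) (k B b : R) : 0 < k ->
  (forall x, 0 <= x <= b -> is_derive x 1 y (y' x)) ->
  (forall x, 0 <= x <= b -> is_derive x 1 y' (S x - k ^+ 2 * y x)) ->
  y 0 = 0 -> y' 0 = 0 ->
  (forall x, 0 <= x <= b -> `|S x| <= B) ->
  forall x, 0 <= x <= b -> k * `|y x| <= 2 * B * x.
Proof.
move=> k0 dy dy' y0 y'0 SB x /andP[x0 xb].
have sub z : 0 <= z <= x -> 0 <= z <= b.
  by move=> /andP[-> /le_trans]; exact.
pose P z := y' z * cos (k * z) + k * (y z * sin (k * z)).
pose Q z := y' z * sin (k * z) - k * (y z * cos (k * z)).
have dP z : 0 <= z <= x -> is_derive z 1 P (S z * cos (k * z)).
  move=> /sub zb; have dyz := dy z zb; have dyz' := dy' z zb.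
  by apply: is_derive_eq; rewrite /GRing.scale/=; ring.
have dQ z : 0 <= z <= x -> is_derive z 1 Q (S z * sin (k * z)).
  move=> /sub zb; have dyz := dy z zb; have dyz' := dy' z zb.
  by apply: is_derive_eq; rewrite /GRing.scale/=; ring.
have P0 : P 0 = 0 by rewrite /P y0 y'0; ring.
have Q0 : Q 0 = 0 by rewrite /Q y0 y'0; ring.
have hP : `|P x| <= B * x.
  have := der_lip (B := B) x0 dP; rewrite P0 !subr0; apply => z /sub /SB h.
  rewrite normrM; apply: le_trans h.
  by rewrite -[leRHS]mulr1 ler_wpM2l// cos_max.
have hQ : `|Q x| <= B * x.
  have := der_lip (B := B) x0 dQ; rewrite Q0 !subr0; apply => z /sub /SB h.
  rewrite normrM; apply: le_trans h.
  by rewrite -[leRHS]mulr1 ler_wpM2l// sin_max.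
have E : k * y x = P x * sin (k * x) - Q x * cos (k * x).
  rewrite /P /Q -[LHS]mulr1 -(cos2Dsin2 (k * x)); ring.
rewrite -[k in leLHS]gtr0_norm// -normrM E (le_trans (ler_normB _ _))//.
rewrite !normrM -mulrA mulrDl mul1r lerD//.
  by apply: le_trans hP; rewrite -[leRHS]mulr1 ler_wpM2l// sin_max.
by apply: le_trans hQ; rewrite -[leRHS]mulr1 ler_wpM2l// cos_max.
Qed.

(** * Sturm comparison with the sine *)

Section sturm.
Variables (u u' q : R -> R) (a b k : R).
Hypotheses (ab : a < b) (k0 : 0 < k) (kab : k * (b - a) = pi).
Hypothesis du : forall x, a <= x <= b -> is_derive x 1 u (u' x).
Hypothesis du' : forall x, a <= x <= b -> is_derive x 1 u' (- (q x * u x)).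
Hypothesis u0 : forall x, a < x < b -> 0 < u x.

(** The Wronskian of u with the sine vanishing at a and b. Inside, its derivative has the sign of
    k^2 - q, while W a = - k u a and W b = k u b. A strict one-sided inequality for q would make W
    monotone in a direction that these end values forbid. *)
Let W z := u' z * sin (k * (z - a)) - k * (u z * cos (k * (z - a))).

Let dW z : a <= z <= b ->
  is_derive z 1 W ((k ^+ 2 - q z) * (u z * sin (k * (z - a)))).
Proof.
move=> zb; have dyz := du zb; have dyz' := du' zb.
by apply: is_derive_eq; rewrite /GRing.scale/=; ring.
Qed.

Let sin_pos z : a < z < b -> 0 < sin (k * (z - a)).
Proof.
move=> /andP[az zb]; apply: sin_gt0_pi; rewrite mulr_gt0 ?subr_gt0//=.
by rewrite -kab ltr_pM2l// ltrD2r.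
Qed.

Let Wa : W a = - (k * u a).
Proof. by rewrite /W subrr mulr0 sin0 cos0; ring. Qed.

Let Wb : W b = k * u b.
Proof. by rewrite /W kab sinpi cospi; ring. Qed.

Lemma sturm_le : 0 <= u a -> 0 <= u b -> exists2 x, a < x < b & q x <= k ^+ 2.
Proof.
move=> ua ub; apply: contrapT => H.
have h x : a < x < b -> k ^+ 2 < q x.
  by move=> xab; rewrite ltNge; apply/negP => qx; apply: H; exists x.
suff : W b < W a.
  by apply/negP; rewrite -leNgt Wa Wb (@le_trans _ _ 0)// ?oppr_le0 ?mulr_ge0// ltW.
rewrite -ltrN2.
apply: (@der_lt (fun z => - W z) _ a b ab) => [x xab|x xab].
  by have ? := dW xab; exact: is_deriveN.
rewrite oppr_gt0 pmulr_llt0 ?mulr_gt0 ?u0 ?sin_pos//.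
by rewrite subr_lt0 h.
Qed.

Lemma sturm_ge : u a = 0 -> u b = 0 -> exists2 x, a < x < b & k ^+ 2 <= q x.
Proof.
move=> ua ub; apply: contrapT => H.
have h x : a < x < b -> q x < k ^+ 2.
  by move=> xab; rewrite ltNge; apply/negP => qx; apply: H; exists x.
suff : W a < W b by rewrite Wa Wb ua ub mulr0 oppr0 ltxx.
apply: (der_lt ab dW) => x xab.
by rewrite mulr_gt0 ?mulr_gt0 ?u0 ?sin_pos ?subr_gt0 ?h.
Qed.

Lemma sturm_eq : continuous q -> u a = 0 -> u b = 0 ->
  exists2 x, a < x < b & q x = k ^+ 2.
Proof.
move=> cq ua ub.
have [||x /andP[ax xb] qx] := sturm_le; rewrite ?ua ?ub//.
have [//|//|y /andP[ay yb] qy] := sturm_ge.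
have [xy|/ltW yx] := leP x y.
  have [|z /andP[xz zy] qz] := ivt (c := k ^+ 2) xy cq; first by rewrite qx.
  by exists z => //; rewrite (lt_le_trans ax xz) (le_lt_trans zy yb).
have [|z /andP[xz zy] qz] := ivtN (c := k ^+ 2) yx cq; first by rewrite qx.
by exists z => //; rewrite (lt_le_trans ay xz) (le_lt_trans zy xb).
Qed.

End sturm.

Let pos_near (a b c e : R) : 0 < e -> e <= c / 2 / 2 -> `|a - b| <= e ->
  `|c - b| < c / 2 -> 0 < a.
Proof. by rewrite ler_norml ltr_norml => ? ? /andP[? ?] /andP[? ?]; lra. Qed.

Let neg_near (a b c e : R) : 0 < e -> e <= - c / 2 / 2 -> `|a - b| <= e ->
  `|c - b| < - c / 2 -> 0 < - a.
Proof. by rewrite ler_norml ltr_norml => ? ? /andP[? ?] /andP[? ?]; lra. Qed.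

(** Only derivatives have to be close, since b and p vanish at 0 and the values follow by
    integration. Near 0 and L the strict signs of q persist and integrate from the ends; in between
    -p has a positive minimum, and the accumulated error is at most half of it. *)
Lemma decr_stable (p q : R -> R) (L : R) : 0 < L ->
  (forall x, is_derive x 1 p (q x)) -> continuous q -> p 0 = 0 -> p L = 0 ->
  (forall x, 0 < x < L -> p x < 0) -> q 0 < 0 -> 0 < q L ->
  exists2 e : R, 0 < e & forall b b' : R -> R,
    (forall x, is_derive x 1 b (b' x)) -> b 0 = 0 -> b L = 0 ->
    (forall x, 0 <= x <= L -> `|b' x - q x| <= e) ->
    forall x, 0 < x < L -> b x < 0.
Proof.
move=> L0 dp cq p0 pL pneg q0 qL.
have half (a : R) : 0 < a -> 0 < a / 2 by move=> a0; rewrite divr_gt0.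
have [q02 qL2] : 0 < - q 0 / 2 /\ 0 < q L / 2 by split; apply: half => //; rewrite oppr_gt0.
have [d1 d10 h1] := cont_eps (cq 0) q02.
have [d2 d20 h2] := cont_eps (cq L) qL2.
have [d [d0 dd1 dd2 dL]] := min3 (half _ d10) (half _ d20) (half _ L0).
have {}dd1 : d < d1 by apply: (le_lt_trans dd1); rewrite ltr_pdivrMr// ltr_pMr// ltr1n.
have {}dd2 : d < d2 by apply: (le_lt_trans dd2); rewrite ltr_pdivrMr// ltr_pMr// ltr1n.
have [dLd dLL] : d <= L - d /\ d < L by split; lra.
have cp : continuous (fun x => - p x).
  by move=> x; apply: continuousN; exact: (der_continuous dp).
have [c /andP[c1 c2] pc] := @cont_min (fun x => - p x) d (L - d) dLd cp.
have pc0 : p c < 0.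
  by apply: pneg; rewrite (lt_le_trans d0 c1) (le_lt_trans c2)// gtrBl.
have pcL : 0 < - p c / (2 * L) by rewrite divr_gt0 ?oppr_gt0// mulr_gt0.
have [e [e0 e1 e2 e3]] := min3 (half _ q02) (half _ qL2) pcL.
exists e => // b b' db b0 bL hb x /andP[x0 xL].
have [xd|dx] := leP x d.
  rewrite -ltrN2 oppr0 -oppr0 -b0.
  apply: (@der_lt (fun z => - b z) (fun z => - b' z) 0 x) => // z /andP[z0 zx].
  have /h1 : `|0 - z| < d1.
    by rewrite sub0r normrN gtr0_norm// (lt_trans zx)// (le_lt_trans xd).
  have := hb z; rewrite (ltW z0) (le_trans (ltW zx) (ltW xL)) => /(_ isT).
  exact: (neg_near e0 e1).
have [xd'|dx'] := leP (L - d) x.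
  rewrite -bL; apply: (@der_lt b b' x L) => // z /andP[zx zL].
  have /h2 : `|L - z| < d2.
    by rewrite gtr0_norm ?subr_gt0// ltrBlDr -ltrBlDl (lt_trans _ zx)// (lt_le_trans _ xd')// ltrD2l ltrN2.
  have := hb z; rewrite (ltW zL) (le_trans (ltW x0) (ltW zx)) => /(_ isT).
  exact: (pos_near e0 e2).
have := pc x; rewrite (ltW dx) (ltW dx') lerN2 => /(_ isT) px.
suff bp : `|b x - p x| < - p c.
  move: bp; rewrite ltr_norml => /andP[_]; rewrite ltrBlDr => /lt_le_trans; apply.
  by rewrite addrC subr_le0.
have -> : b x - p x = (b x - p x) - (b 0 - p 0) by rewrite b0 p0 subrr subr0.
apply: (@le_lt_trans _ _ (e * (x - 0))).
  apply: (@der_lip (fun z => b z - p z) (fun z => b' z - q z)) => [|z zx].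
  - exact: ltW.
  - by apply: hb; move: zx => /andP[-> zx]; exact: le_trans zx (ltW xL).
rewrite subr0.
apply: (@le_lt_trans _ _ (- p c / (2 * L) * x)); first by rewrite ler_wpM2r// ltW.
rewrite -mulrA gtr_pMr ?oppr_gt0// mulrC ltr_pdivrMr ?mulr_gt0// mul1r.
by rewrite (lt_trans xL)// ltr_pMl// ltr1n.
Qed.

Lemma unif_limit_continuous (f_ : nat -> R -> R) f :
  (forall n, continuous (f_ n)) ->
  (forall e : R, 0 < e -> exists n, forall x, `|f_ n x - f x| <= e) ->
  continuous f.
Proof.
move=> cf H x; apply/cvgrPdist_lt => e e0.
have [n hn] := H (e / 4) ltac:(lra).
have [d d0 hd] := cont_eps (cf n x) (e := e / 4) ltac:(lra).
exists d => //= y /hd h3; have := hn x; have := hn y.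
by move: h3; rewrite !ler_norml !ltr_norml => /andP[? ?] /andP[? ?] /andP[? ?]; lra.
Qed.

(** The limit is identified with a primitive of the limit derivative, up to its value at 0: each f_n
    minus that primitive has uniformly small slope. *)
Lemma unif_limit_der (f_ f'_ : nat -> R -> R) f f1 :
  (forall n x, is_derive x 1 (f_ n) (f'_ n x)) ->
  (forall n, continuous (f'_ n)) ->
  (forall x (e : R), 0 < e -> exists N, forall n, (N <= n)%N -> `|f_ n x - f x| <= e) ->
  (forall e : R, 0 < e ->
    exists N, forall n, (N <= n)%N -> forall x, `|f'_ n x - f1 x| <= e) ->
  forall x, is_derive x 1 f (f1 x).
Proof.
move=> df cf' H1 H2 x.
have cf1 : continuous f1.
  apply: (unif_limit_continuous cf') => e e0; have [N hN] := H2 e e0.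
  by exists N; exact: hN.
have [P [dP P0]] := der_primitive (`|x| + 1) cf1.
have E z : `|z| <= `|x| + 1 -> f z = P z + f 0.
  move=> zx; apply/eqP; rewrite -subr_eq0 -normr_le0; apply/ler_addgt0Pl => e e0.
  rewrite addr0.
  (* The errors at z and at 0 and the integrated slope error add up to e' + e' |z| + e' = e. *)
  pose e' := e / (`|z| + 2).
  have z0 := normr_ge0 z.
  have e'0 : 0 < e' by rewrite divr_gt0//; lra.
  have [N1 h1] := H1 z _ e'0; have [N2 h2] := H1 0 _ e'0.
  have [N3 h3] := H2 _ e'0.
  pose n := maxn N1 (maxn N2 N3).
  have {}h1 := h1 n (leq_maxl _ _).
  have {}h2 := h2 n (leq_trans (leq_maxl _ _) (leq_maxr _ _)).
  have {}h3 := h3 n (leq_trans (leq_maxr _ _) (leq_maxr _ _)).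
  have h : `|(f_ n z - P z) - (f_ n 0 - P 0)| <= e' * `|z|.
    have [z0'|z0'] := leP 0 z.
      rewrite (ger0_norm z0') -[in leRHS](subr0 z).
      apply: (@der_lip (fun t => f_ n t - P t) (fun t => f'_ n t - f1 t)) => // t /andP[t0 tz].
      have dPt : is_derive t 1 P (f1 t).
        by apply: dP; rewrite ger0_norm// (le_trans tz)// -(ger0_norm z0').
      exact: is_deriveB.
    rewrite distrC (ltr0_norm z0') -[in leRHS](sub0r z).
    apply: (@der_lip (fun t => f_ n t - P t) (fun t => f'_ n t - f1 t)) => // [|t /andP[t0 tz]].
      exact: ltW.
    have dPt : is_derive t 1 P (f1 t).
      apply: dP; rewrite ler0_norm//; apply: le_trans zx.
      by rewrite ltr0_norm// lerN2.
    exact: is_deriveB.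
  rewrite P0 in h.
  have -> : e = e' + e' * `|z| + e'.
    by rewrite /e'; field; lra.
  move: h1 h2 h; rewrite !ler_norml => /andP[? ?] /andP[? ?] /andP[? ?]; lra.
have dPx : is_derive x 1 P (f1 x) by apply: dP; rewrite lerDl.
have dPx' : is_derive x 1 (fun z => P z + f 0) (f1 x).
  by apply: is_derive_eq; rewrite addr0.
apply: near_eq_is_derive dPx'.
exists 1 => //= z xz; apply/esym/E.
have := ler_normD x (z - x); rewrite addrC subrK => /le_trans; apply.
by rewrite lerD2l distrC ltW.
Qed.

End calculus.

(** * The nonlinearity, its derivative and its antiderivative *)

Section nonlinearity.
Context {R : realType}.
Implicit Types (x y h : R).

Definition dnonlin (y : R) : R := ((1 + y) * (2 + y) ^+ 2)^-1.

(** An antiderivative of [nonlin] on y > -1. It stays between -1 and 0 even where [nonlin] diverges,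
    which keeps the energy identity usable up to rupture. *)
Definition prim_nonlin (y : R) : R := (1 + y) * ln ((1 + y) / (2 + y)).

Lemma is_derive_V2D y : -1 < y -> is_derive y 1 (fun z : R => (2 + z)^-1) (- (2 + y) ^- 2).
Proof.
move=> y1.
have h2' : 2 + y != 0 by rewrite gt_eqF//; lra.
have d2 : is_derive y 1 (fun z : R => 2 + z) 1 by apply: is_derive_eq; ring.
by apply: (is_derive_eq (is_deriveV h2' d2)); rewrite /GRing.scale/= mulr1.
Qed.

Lemma is_derive_ln_quot y : -1 < y ->
  is_derive y 1 (fun z : R => ln ((1 + z) / (2 + z))) ((1 + y) * (2 + y))^-1.
Proof.
move=> y1.
have dl : is_derive ((1 + y) / (2 + y)) 1 (@ln R) (((1 + y) / (2 + y))^-1).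
  by apply: is_derive1_ln; apply: divr_gt0; lra.
have dv := is_derive_V2D y1.
have dg : is_derive y 1 (fun z => (1 + z) * (2 + z)^-1) ((2 + y) ^- 2).
  by apply: is_derive_eq; rewrite /GRing.scale/=; field; lra.
apply: (is_derive_eq (@is_derive1_comp R (@ln R) (fun z => (1 + z) / (2 + z)) y _ _ dl dg)).
by field; apply/andP; split; lra.
Qed.

Lemma is_derive_nonlin y : -1 < y -> is_derive y 1 (@nonlin R) (dnonlin y).
Proof.
move=> y1; apply: (is_derive_eq (is_deriveD (is_derive_V2D y1) (is_derive_ln_quot y1))).
by rewrite /dnonlin; field; apply/andP; split; lra.
Qed.

Lemma is_derive_prim_nonlin y : -1 < y ->
  is_derive y 1 prim_nonlin (nonlin y).
Proof.
move=> y1.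
have d1 : is_derive y 1 (fun z : R => 1 + z) 1 by apply: is_derive_eq; ring.
apply: (is_derive_eq (is_deriveM d1 (is_derive_ln_quot y1))).
by rewrite /nonlin /GRing.scale/=; field; apply/andP; split; lra.
Qed.

Lemma dnonlin_cont (y : R) : -1 < y -> {for y, continuous dnonlin}.
Proof.
move=> y1; rewrite /continuous_at /dnonlin; apply: cvgV.
  by rewrite gt_eqF// mulr_gt0 ?exprn_gt0//; lra.
have h (a : R) : a + x @[x --> y] --> a + y by apply: cvgD; [exact: cvg_cst|exact: cvg_id].
apply: cvgM => //.
exact: (cvg_comp _ _ (h 2) (@exprn_continuous _ 2 (2 + y))).
Qed.

(** The cube of the height cancels the simple pole of [dnonlin] at y = -1; this is why h^3 h'''
    stays regular at rupture. *)
Lemma cube_dnonlin (y : R) : -1 < y ->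
  (1 + y) ^+ 3 * dnonlin y = ((1 + y) / (2 + y)) ^+ 2.
Proof. by move=> y1; rewrite /dnonlin; field; apply/andP; split; lra. Qed.

Lemma dnonlin_gt0 y : -1 < y -> 0 < dnonlin y.
Proof.
move=> y1; rewrite invr_gt0 mulr_gt0//; first by lra.
by rewrite exprn_gt0//; lra.
Qed.

Lemma dnonlin_le x y : -1 < x -> x <= y -> dnonlin y <= dnonlin x.
Proof.
move=> x1 xy; rewrite lef_pV2 ?posrE; last 2 first.
- by apply: mulr_gt0; [|apply: exprn_gt0]; lra.
- by apply: mulr_gt0; [|apply: exprn_gt0]; lra.
apply: ler_pM; rewrite ?exprn_ge0//; try lra.
by rewrite lerXn2r// ?nnegrE; lra.
Qed.

Lemma nonlin_le x y : -1 < x -> x <= y -> nonlin x <= nonlin y.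
Proof.
move=> x1 xy; apply: (der_le xy (f' := dnonlin)) => z /andP[xz _].
  by apply: is_derive_nonlin; lra.
by apply/ltW/dnonlin_gt0; lra.
Qed.

Lemma nonlin_lip x y (d : R) : 0 < d -> d <= 1 + x -> d <= 1 + y ->
  `|nonlin x - nonlin y| <= d^-1 * `|x - y|.
Proof.
move=> d0; wlog yx : x y / y <= x.
  move=> H hx hy; have [yx|/ltW xy] := leP y x; first exact: H.
  by rewrite distrC [`|x - y|]distrC H.
move=> _ dy; rewrite [`|x - y|]ger0_norm ?subr_ge0//.
apply: (@der_lip _ (@nonlin R) dnonlin) => // z /andP[yz zx].
  by apply: is_derive_nonlin; lra.
rewrite ger0_norm; last by apply/ltW/dnonlin_gt0; lra.
rewrite /dnonlin lef_pV2 ?posrE//; last first.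
  by apply: mulr_gt0; [|apply: exprn_gt0]; lra.
apply: (@le_trans _ _ ((1 + z) * 1)); first by lra.
rewrite ler_wpM2l//; first by lra.
by rewrite -(expr1n _ 2) lerXn2r// ?nnegrE; lra.
Qed.

Lemma nonlinE y : -1 < y -> nonlin y = (2 + y)^-1 + ln (1 + y) - ln (2 + y).
Proof.
by move=> y1; rewrite /nonlin ln_div ?posrE; [rewrite addrA|lra|lra].
Qed.

Lemma nonlin_le0 y : -1 < y -> nonlin y <= 0.
Proof.
move=> y1; rewrite /nonlin.
have -> : (1 + y) / (2 + y) = 1 + - (2 + y)^-1 by field; lra.
have h : (2 + y)^-1 < 1 by rewrite invf_lt1; lra.
by have := @le_ln1Dx R (- (2 + y)^-1) ltac:(lra); lra.
Qed.

Lemma nonlin_le_ln y : -1 < y -> nonlin y <= 1 + ln (1 + y).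
Proof.
move=> y1; rewrite nonlinE//.
have h : (2 + y)^-1 <= 1 by rewrite invf_le1; lra.
have : 0 <= ln (2 + y) by rewrite ln_ge0; lra.
lra.
Qed.

Lemma nonlin_ge_ln y : -1 < y -> - ln (1 + (1 + y)^-1) <= nonlin y.
Proof.
move=> y1.
have -> : 1 + (1 + y)^-1 = (2 + y) / (1 + y) by field; lra.
rewrite ln_div ?posrE ?nonlinE//; [|lra|lra].
have h : 0 <= (2 + y)^-1 by rewrite invr_ge0; lra.
lra.
Qed.

Lemma prim_nonlinE y : -1 < y ->
  prim_nonlin y = - ((1 + y) * ln (1 + (1 + y)^-1)).
Proof.
move=> y1; rewrite /prim_nonlin.
have -> : 1 + (1 + y)^-1 = ((1 + y) / (2 + y))^-1 by field; lra.
rewrite lnV; first by ring.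
by rewrite posrE; apply: divr_gt0; lra.
Qed.

Lemma prim_nonlin_le0 y : -1 < y -> prim_nonlin y <= 0.
Proof.
move=> y1; rewrite prim_nonlinE// oppr_le0 mulr_ge0//; first by lra.
by rewrite ln_ge0// lerDl invr_ge0; lra.
Qed.

Lemma prim_nonlin_ge y : -1 < y -> - 1 <= prim_nonlin y.
Proof.
move=> y1; rewrite prim_nonlinE// lerN2.
have h : 0 <= (1 + y)^-1 by rewrite invr_ge0; lra.
rewrite [leRHS](_ : 1 = (1 + y) * (1 + y)^-1); last by field; lra.
rewrite ler_wpM2l//; first by lra.
by apply: le_ln1Dx; lra.
Qed.

Lemma ln1D_le_sqrt x : 0 <= x -> ln (1 + x ^+ 2) <= 2 * x.
Proof.
move=> x0; apply: (@le_trans _ _ (ln ((1 + x) ^+ 2))).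
  by rewrite ler_ln ?posrE; [| nra | nra]; nra.
rewrite lnXn; last by lra.
by have := @le_ln1Dx R x ltac:(lra); rewrite mulr2n; lra.
Qed.

(** With s = sqrt (1 + y) the modulus of [prim_nonlin] is s^2 ln (1 + s^-2) <= 2 s. This decay makes
    slopes small at rupture. *)
Lemma prim_nonlin_ge_sqrt y : -1 < y -> - (2 * Num.sqrt (1 + y)) <= prim_nonlin y.
Proof.
move=> y1; rewrite prim_nonlinE// lerN2.
set s := Num.sqrt (1 + y).
have s0 : 0 < s by rewrite sqrtr_gt0; lra.
have -> : 1 + y = s ^+ 2 by rewrite sqr_sqrtr//; lra.
have := @ln1D_le_sqrt s^-1 ltac:(by rewrite invr_ge0 ltW).
rewrite exprVn => h.
rewrite (@le_trans _ _ (s ^+ 2 * (2 * s^-1)))//.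
  by rewrite ler_wpM2l// sqr_ge0.
by rewrite [leLHS](_ : _ = 2 * s)//; field; lra.
Qed.

(** [dnonlin 0 = 1 / 4] is the origin of the factor 4 in [Mstar]. *)
Lemma dnonlin_taylor z (d : R) : d <= 1 / 2 -> `|z| <= d ->
  `|dnonlin z - 1 / 4| <= 3 * d.
Proof.
move=> d2 zd; have := zd; rewrite ler_norml => /andP[z1 z2].
have p0 : 0 < 4 * (1 + z) * (2 + z) ^+ 2.
  by rewrite !mulr_gt0 ?exprn_gt0//; lra.
have -> : dnonlin z - 1 / 4 = - z * (8 + 5 * z + z ^+ 2) / (4 * (1 + z) * (2 + z) ^+ 2).
  by rewrite /dnonlin; field; apply/andP; split; lra.
rewrite normrM normfV (gtr0_norm p0) ler_pdivrMr// normrM normrN.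
have hn : 0 <= 8 + 5 * z + z ^+ 2 by nra.
rewrite (ger0_norm hn).
apply: (@le_trans _ _ (d * (8 + 5 * z + z ^+ 2))); first by rewrite ler_wpM2r.
have d0 : 0 <= d by lra.
rewrite [leRHS](_ : _ = d * (3 * (4 * (1 + z) * (2 + z) ^+ 2))); last by ring.
rewrite ler_wpM2l//.
have h : 9 / 4 <= (2 + z) ^+ 2 by nra.
have : 4 * (1 / 2) * (9 / 4) <= 4 * (1 + z) * (2 + z) ^+ 2.
  by apply: ler_pM => //; nra.
nra.
Qed.

Lemma nonlin_taylor x y (d : R) : d <= 1 / 2 -> `|x| <= d -> `|y| <= d ->
  `|(nonlin x - x / 4) - (nonlin y - y / 4)| <= 3 * d * `|x - y|.
Proof.
move=> d2; wlog yx : x y / y <= x.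
  move=> H hx hy; have [yx|/ltW xy] := leP y x; first exact: H.
  by rewrite distrC [`|x - y|]distrC H.
rewrite !ler_norml => /andP[dx1 dx2] /andP[dy1 dy2].
rewrite -ler_norml [`|x - y|]ger0_norm ?subr_ge0//.
apply: (@der_lip _ (fun z => nonlin z - z / 4) (fun z => dnonlin z - 1 / 4)) => // z /andP[yz zx].
  have ? := @is_derive_nonlin z ltac:(lra).
  by apply: is_derive_eq; rewrite /GRing.scale/=; lra.
apply: dnonlin_taylor => //; rewrite ler_norml; apply/andP; split; lra.
Qed.

End nonlinearity.

(** * Solutions of the stationary equation *)

Section profiles.
Context {R : realType}.
Implicit Types (g L m c x y : R) (w W : R -> R).

Definition rhs g m c (y : R) : R := g * y - m * nonlin y + c.

(** The constant c stands for M K(v). Zero mean is stated through a primitive vanishing at 0 and L,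
    which by evenness amounts to the mean over the cell; in this form the mean value theorem applies
    to it directly. *)
Record profile g L m c w (w1 : R -> R) : Prop := {
  prof_d1 : forall x, is_derive x 1 w (w1 x);
  prof_d2 : forall x, is_derive x 1 w1 (rhs g m c (w x));
  prof_gt : forall x, -1 < w x;
  prof_even : forall x, w (- x) = w x;
  prof_per : forall x, w (x + 2 * L) = w x;
  prof_mean : exists W, [/\ forall x, 0 <= x <= L -> is_derive x 1 W (w x),
    W 0 = 0 & W L = 0] }.

Definition onebump L (w1 : R -> R) := forall x, 0 < x < L -> w1 x < 0.

Lemma is_derive_inj (f : R -> R) x (a b : R) :
  is_derive x 1 f a -> is_derive x 1 f b -> a = b.
Proof. by move=> [_ <-] [_ <-]. Qed.

Lemma even_der_odd w (w1 : R -> R) : (forall x, is_derive x 1 w (w1 x)) ->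
  (forall x, w (- x) = w x) -> forall x, w1 (- x) = - w1 x.
Proof.
move=> dw ew x.
have d1 : is_derive x 1 (fun y => w (- y)) (w1 (- x) * (-1)).
  by apply: (@is_derive1_comp _ w (fun y => - y)); exact: is_derive_eq.
have d2 : is_derive x 1 (fun y => w (- y)) (w1 x).
  by rewrite (_ : (fun y => _) = w)//; apply/funext => y; rewrite ew.
by rewrite (is_derive_inj d2 d1); ring.
Qed.

Lemma per_der_per w (w1 : R -> R) (T : R) : (forall x, is_derive x 1 w (w1 x)) ->
  (forall x, w (x + T) = w x) -> forall x, w1 (x + T) = w1 x.
Proof.
move=> dw pw x.
have d1 : is_derive x 1 (fun y => w (y + T)) (w1 (x + T) * 1).
  by apply: (@is_derive1_comp _ w (fun y => y + T)); apply: is_derive_eq; ring.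
have d2 : is_derive x 1 (fun y => w (y + T)) (w1 x).
  by rewrite (_ : (fun y => _) = w)//; apply/funext => y; rewrite pw.
by rewrite (is_derive_inj d2 d1); ring.
Qed.

Lemma is_derive_rhs g m c y : -1 < y ->
  is_derive y 1 (rhs g m c) (g - m * dnonlin y).
Proof.
move=> y1; have d1 := is_deriveZ m (is_derive_nonlin y1).
have d2 := is_deriveZ g (is_derive_id y (1 : R)).
have d3 := is_derive_cst c y (1 : R).
apply: (is_derive_eq (is_deriveD (is_deriveB d2 d1) d3)).
by rewrite /GRing.scale/=; ring.
Qed.

Section profile_facts.
Variables (g L m c : R) (w w1 : R -> R).
Hypotheses (g0 : 0 < g) (L0 : 0 < L) (pw : profile g L m c w w1).

Let dw := prof_d1 pw.
Let dw1 := prof_d2 pw.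

Lemma prof_odd x : w1 (- x) = - w1 x.
Proof. exact: even_der_odd dw (prof_even pw) x. Qed.

Lemma prof_per1 x : w1 (x + 2 * L) = w1 x.
Proof. exact: per_der_per dw (prof_per pw) x. Qed.

Lemma prof_1_0 : w1 0 = 0.
Proof. by have := prof_odd 0; rewrite oppr0; lra. Qed.

Lemma prof_1_L : w1 L = 0.
Proof.
have := prof_odd L; have := prof_per1 (- L).
by rewrite (_ : - L + 2 * L = L); [lra|ring].
Qed.

Lemma prof_cont : continuous w.
Proof. exact: der_continuous dw. Qed.

Lemma prof_cont1 : continuous w1.
Proof. exact: der_continuous dw1. Qed.

Lemma prof_nonlin_d x :
  is_derive x 1 (fun y => nonlin (w y)) (dnonlin (w x) * w1 x).
Proof.
exact: (@is_derive1_comp _ nonlin w _ _ _ (is_derive_nonlin (prof_gt pw x)) (dw x)).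
Qed.

Lemma prof_d3 x : is_derive x 1 (fun y => rhs g m c (w y))
  ((g - m * dnonlin (w x)) * w1 x).
Proof.
apply: (is_derive_eq (@is_derive1_comp _ (rhs g m c) w _ _ _
  (is_derive_rhs g m c (prof_gt pw x)) (dw x))).
by ring.
Qed.

Lemma prof_cont_dnonlin : continuous (fun x => dnonlin (w x)).
Proof.
move=> x; exact: (cvg_comp _ _ (prof_cont (x := x)) (dnonlin_cont (prof_gt pw x))).
Qed.

Lemma prof_cont_rhs : continuous (fun x => rhs g m c (w x)).
Proof. exact: der_continuous prof_d3. Qed.

Lemma prof_energy x y :
  w1 x ^+ 2 / 2 - g * w x ^+ 2 / 2 + m * prim_nonlin (w x) - c * w x =
  w1 y ^+ 2 / 2 - g * w y ^+ 2 / 2 + m * prim_nonlin (w y) - c * w y.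
Proof.
pose E x := w1 x ^+ 2 / 2 - g * w x ^+ 2 / 2 + m * prim_nonlin (w x) - c * w x.
have dE (z : R) : is_derive z 1 E 0.
  have ? := dw z; have ? := dw1 z.
  have ? := @is_derive1_comp _ prim_nonlin w _ _ _ (is_derive_prim_nonlin (prof_gt pw z)) (dw z).
  by apply: is_derive_eq; rewrite /rhs /GRing.scale/=; field.
exact: (@is_derive_0_is_cst _ E x y dE).
Qed.

Lemma prof_per_nat x n : w (x + 2 * L *+ n) = w x.
Proof. exact: (periodicn (prof_per pw)). Qed.

(** w1 solves the linear equation w1'' = (g - m f'(w)) w1, f = [nonlin], with zero Cauchy data at
    x0, so Gronwall with A = e = 0 makes w constant to the right of x0. Periodicity carries every
    other point there, and the zero mean determines the constant. *)
Lemma prof_uniq x0 : w1 x0 = 0 -> rhs g m c (w x0) = 0 -> forall x, w x = 0.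
Proof.
move=> h1 h2.
have far (x1 : R) : x0 <= x1 -> w x1 = w x0.
  move=> x01.
  have [B hB] := cont_bound x01 prof_cont_dnonlin.
  have B0 : 0 <= B by apply: le_trans (hB x0 _); rewrite ?normr_ge0// lexx.
  apply: (der_cst x01 (f' := w1)) => // z zx.
  have := @gronwall2 _ w1 (fun y => rhs g m c (w y))
    (fun y => (g - m * dnonlin (w y)) * w1 y) 0 (g + `|m| * B) 0 x0 x1 x01.
  move=> /(_ (lexx _) _ (lexx _) (fun x _ => dw1 x) (fun x _ => prof_d3 x)).
  rewrite addr_ge0 ?mulr_ge0 ?(ltW g0)// => /(_ isT).
  rewrite h1 h2 expr0n/= addr0 => H.
  have := H _ (lexx 0) z zx; rewrite mul0r => /(_ _)/wrap[].
    move=> y yx; rewrite normrM addr0 ler_wpM2r// (le_trans (ler_normB _ _))//.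
    by rewrite (gtr0_norm g0) lerD2l normrM ler_wpM2l// hB.
  move=> h; apply/eqP; rewrite -sqrf_eq0 eq_le sqr_ge0 andbT.
  by apply: le_trans h; rewrite lerDl sqr_ge0.
have cst x : w x = w x0.
  pose n := Num.truncn ((`|x0 - x|) / (2 * L)).
  rewrite -(prof_per_nat x n.+1); apply: far.
  have : `|x0 - x| / (2 * L) < n.+1%:R by apply: truncnS_gt.
  have L2 : 0 < 2 * L by rewrite mulr_gt0.
  rewrite ltr_pdivrMr//.
  rewrite -mulr_natr => h.
  by have := ler_norm (x0 - x); lra.
have [W [dW W0 WL]] := prof_mean pw.
have [z [z0 zL]] := der_mvt L0 dW.
rewrite W0 WL cst subr0 => /esym/eqP; rewrite subr0 mulf_eq0 => /orP[/eqP w0 x|].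
  by rewrite cst.
by rewrite gt_eqF.
Qed.


(** An interior zero of w1 <= 0 is a maximum of w1, so w1' vanishes there as well and [prof_uniq]
    applies. *)
Lemma bump_closed : (forall x, 0 < x < L -> w1 x <= 0) ->
  (exists x, w x <> 0) -> onebump L w1.
Proof.
move=> h [x1 wx1] x /andP[x0 xL].
rewrite lt_neqAle h ?x0// andbT; apply/eqP => wx.
apply: wx1; apply: (prof_uniq wx).
have : is_derive x 1 w1 0.
  apply: (@derive1_at_max _ w1 0 L x) => //; first by rewrite ltW.
  - by move=> t _; exact: (@ex_derive _ _ _ _ _ _ _ (dw1 t)).
  - by rewrite in_itv/= x0.
  - by move=> t; rewrite in_itv/= => /h; rewrite wx.
exact: is_derive_inj (dw1 x).
Qed.

(** A wrong strict sign of w'' at an end would make w1 positive next to it, against [onebump]. The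
    value 0 is excluded by [prof_uniq], because w1 vanishes at both ends. *)
Lemma bump_ends : onebump L w1 -> rhs g m c (w 0) < 0 /\ 0 < rhs g m c (w L).
Proof.
have L0' := L0; move=> bw.
have nz : ~ forall x, w x = 0.
  move=> w0; have := bw (L / 2) ltac:(lra).
  rewrite (is_derive_inj (dw (L / 2)) (_ : is_derive (L / 2) 1 w 0)) ?ltxx//.
  by rewrite (_ : w = cst 0); [exact: is_derive_cst|exact/funext].
split; rewrite ltNge; apply/negP => h.
- have [h0|h0] := ltP 0 (rhs g m c (w 0)); last first.
    by apply: nz; apply: (prof_uniq prof_1_0); apply/eqP; rewrite eq_le h h0.
  have [d d0 hd] := cont_eps (@prof_cont_rhs 0) h0.
  pose x := Num.min (d / 2) (L / 2).
  have [x0 [xd xL]] : 0 < x /\ x <= d / 2 /\ x <= L / 2.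
    by rewrite /x lt_min !ge_min !lexx orbT; split => //; lra.
  have : w1 0 < w1 x.
    apply: (der_lt x0 (fun z _ => dw1 z)) => z /andP[z0 zx].
    have /hd : `|0 - z| < d by rewrite sub0r normrN gtr0_norm//; lra.
    by rewrite ltr_norml => /andP[_]; lra.
  by have := bw x ltac:(lra); rewrite prof_1_0; lra.
- have [h0|h0] := ltP (rhs g m c (w L)) 0; last first.
    by apply: nz; apply: (prof_uniq prof_1_L); apply/eqP; rewrite eq_le h h0.
  have [d d0 hd] := @cont_eps _ _ L (- rhs g m c (w L)) (@prof_cont_rhs L) ltac:(lra).
  pose x := L - Num.min (d / 2) (L / 2).
  have [x0 [xd xL]] : x < L /\ L - d / 2 <= x /\ L / 2 <= x.
    rewrite /x; have : 0 < Num.min (d / 2) (L / 2) by rewrite lt_min; lra.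
    have : Num.min (d / 2) (L / 2) <= d / 2 by rewrite ge_min lexx.
    have : Num.min (d / 2) (L / 2) <= L / 2 by rewrite ge_min lexx orbT.
    by move: (Num.min _ _) => u h1 h2 h3; split; [lra|split; lra].
  have : - w1 x < - w1 L.
    apply: (@der_lt _ (fun z => - w1 z) (fun z => - rhs g m c (w z))) => // [z _|z /andP[z0 zx]].
      exact: is_deriveN (dw1 z).
    have /hd : `|L - z| < d by rewrite gtr0_norm//; lra.
    by rewrite ltr_norml => /andP[? _]; lra.
  by have := bw x ltac:(lra); rewrite prof_1_L; lra.
Qed.

End profile_facts.
End profiles.

(** * A priori bounds for one-bump profiles *)

Section bumps.
Context {R : realType}.
Variables (g k0 L m c : R) (w w1 : R -> R).
Hypotheses (g0 : 0 < g) (k00 : 0 < k0) (kL : k0 * L = pi).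
Hypotheses (pw : profile g L m c w w1) (bw : onebump L w1).

Lemma half_period_gt0 : 0 < L.
Proof. by have := pi_gt0 R; rewrite -kL pmulr_rgt0. Qed.
Let L0 := half_period_gt0.

Lemma bump_decr x y : 0 <= x -> x <= y -> y <= L -> w y <= w x.
Proof.
move=> x0 xy yL; rewrite -lerN2.
apply: (@der_le _ (fun z => - w z) (fun z => - w1 z)) => // [z _|z /andP[xz zy]].
  exact: is_deriveN (prof_d1 pw z).
by rewrite oppr_ge0 ltW// bw// (le_lt_trans x0 xz) (lt_le_trans zy yL).
Qed.

Lemma bump_decr_lt x y : 0 <= x -> x < y -> y <= L -> w y < w x.
Proof.
move=> x0 xy yL; rewrite -ltrN2.
apply: (@der_lt _ (fun z => - w z) (fun z => - w1 z)) => // [z _|z /andP[xz zy]].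
  exact: is_deriveN (prof_d1 pw z).
by rewrite oppr_gt0 bw// (le_lt_trans x0 xz) (lt_le_trans zy yL).
Qed.

Lemma bump_zero : exists z, [/\ 0 < z, z < L & w z = 0].
Proof.
have [W [dW W0 WL]] := prof_mean pw.
have [z [z0 zL]] := der_mvt L0 dW.
rewrite W0 WL !subr0 => /esym/eqP; rewrite mulf_eq0 (gt_eqF L0) orbF => /eqP wz.
by exists z.
Qed.

Lemma bump_max : 0 < w 0.
Proof.
by have [z [z0 zL wz]] := bump_zero; rewrite -[X in X < _]wz; apply: bump_decr_lt => //; exact: ltW.
Qed.

Lemma bump_min : w L < 0.
Proof.
by have [z [z0 zL wz]] := bump_zero; rewrite -[X in _ < X]wz; apply: bump_decr_lt => //; exact: ltW.
Qed.

(* [- w1] is positive and vanishes at both ends, hence the first Dirichlet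
   eigenfunction of its own linearised equation. *)
Lemma bump_sturm : exists2 x, 0 < x < L & m * dnonlin (w x) = g + k0 ^+ 2.
Proof.
have kL' : k0 * (L - 0) = pi by rewrite subr0.
have [||||||x x0 E] := @sturm_eq _ (fun x => - w1 x) (fun x => - rhs g m c (w x))
  (fun x => m * dnonlin (w x) - g) 0 L k0 L0 k00 kL'.
- by move=> x _; exact: is_deriveN (prof_d2 pw x).
- move=> x _; apply: (is_derive_eq (is_deriveN (prof_d3 pw x))); ring.
- by move=> x /bw; rewrite oppr_gt0.
- move=> x; apply: cvgB; last exact: cvg_cst.
  by apply: cvgM; [exact: cvg_cst|exact: (prof_cont_dnonlin pw)].
- by rewrite (prof_1_0 pw) oppr0.
- by rewrite (prof_1_L pw) oppr0.
by exists x => //; lra.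
Qed.

Lemma bump_m_gt0 : 0 < m.
Proof.
have [x _ E] := bump_sturm.
have : 0 < m * dnonlin (w x) by rewrite E addr_gt0// exprn_gt0.
by rewrite pmulr_lgt0// dnonlin_gt0// (prof_gt pw).
Qed.

(** w >= w (L / 2) on the first half of [0, L] and w > -1 on the second; the zero mean balances the
    two. *)
Lemma bump_half : w (L / 2) <= 1.
Proof.
have L0' := L0.
have [W [dW W0 WL]] := prof_mean pw.
have h1 : w (L / 2) * (L / 2 - 0) <= W (L / 2) - W 0.
  apply: (@der_ge_bound _ W w) => [|x /andP[x0 xL]|x /andP[x0 xL]]; first by lra.
    by apply: dW; lra.
  by apply: bump_decr; lra.
have h2 : (- 1) * (L - L / 2) <= W L - W (L / 2).
  apply: (@der_ge_bound _ W w) => [|x /andP[x0 xL]|x /andP[x0 xL]]; first by lra.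
    by apply: dW; lra.
  exact/ltW/(prof_gt pw).
rewrite W0 WL in h1 h2; nra.
Qed.

(** The point of [bump_sturm] may sit where w is large and [dnonlin] tiny. Comparison on [L / 2, L]
    with the sine of wave number 2 k0 gives a point where w <= 1 by [bump_half], and
    [dnonlin 1 = 1 / 18]. *)
Lemma bump_m_le : m <= 18 * (g + 4 * k0 ^+ 2).
Proof.
have L0' := L0; have m0 := bump_m_gt0; have g0' := g0.
have kL2 : (2 * k0) * (L - L / 2) = pi by rewrite -kL; field.
have [|||||||x /andP[x0 xL] E] := @sturm_le _ (fun x => - w1 x) (fun x => - rhs g m c (w x))
  (fun x => m * dnonlin (w x) - g) (L / 2) L (2 * k0) _ _ kL2.
- lra.
- by rewrite mulr_gt0.
- by move=> x _; exact: is_deriveN (prof_d2 pw x).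
- move=> x _; apply: (is_derive_eq (is_deriveN (prof_d3 pw x))); ring.
- by move=> x /andP[x0 xL]; rewrite oppr_gt0 bw//; lra.
- by rewrite ltW// oppr_gt0 bw//; lra.
- by rewrite (prof_1_L pw) oppr0.
have wx : w x <= 1.
  by apply: le_trans bump_half; apply: bump_decr; lra.
have : dnonlin 1 <= dnonlin (w x) by apply: dnonlin_le => //; exact: (prof_gt pw).
have -> : dnonlin 1 = (18%:R)^-1 :> R by rewrite /dnonlin; congr (_^-1); ring.
move=> h; have : m * 18%:R^-1 <= m * dnonlin (w x) by rewrite ler_wpM2l// ltW.
rewrite exprMn in E; lra.
Qed.

(** Read off from w'' < 0 at the crest, where - m f(w) >= 0 with f = [nonlin]. In particular c <
    0. *)
Lemma bump_c_lt : c < - (g * w 0).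
Proof.
have [] := bump_ends g0 L0 pw bw; rewrite /rhs => h _.
have : m * nonlin (w 0) <= 0.
  by rewrite mulr_ge0_le0 ?(ltW bump_m_gt0)// nonlin_le0// (prof_gt pw).
lra.
Qed.

Lemma bump_c_gt : m * nonlin (w L) < c.
Proof.
have [_] := bump_ends g0 L0 pw bw; rewrite /rhs => h.
have : 0 < g * - w L by rewrite mulr_gt0// oppr_gt0 bump_min.
by rewrite mulrN; lra.
Qed.

Lemma bump_energy x : w1 x ^+ 2 / 2 + g * w L ^+ 2 / 2 + c * w L
  = g * w x ^+ 2 / 2 + c * w x - m * prim_nonlin (w x) + m * prim_nonlin (w L).
Proof.
have := prof_energy pw x L.
rewrite (prof_1_L pw) expr0n/= mul0r; lra.
Qed.

(** Energy is compared between L, where w1 = 0, and a zero of w. As [prim_nonlin] lies in [-1, 0],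
    its two values cost at most m. *)
Lemma bump_energy_bound : g * w L ^+ 2 / 2 + c * w L <= m.
Proof.
have [z [_ _ wz]] := bump_zero.
have := bump_energy z; rewrite wz expr0n/= !mulr0 mul0r add0r sub0r => E.
have h0 := sqr_ge0 (w1 z).
have h1 : - (m * prim_nonlin 0) <= m.
  rewrite -mulrN -[leRHS]mulr1 ler_wpM2l ?(ltW bump_m_gt0)//.
  by rewrite -[leRHS]opprK lerN2 prim_nonlin_ge// ltrN10.
have h2 : m * prim_nonlin (w L) <= 0.
  by rewrite mulr_ge0_le0 ?(ltW bump_m_gt0)// prim_nonlin_le0// (prof_gt pw).
lra.
Qed.

(** * Bounds once the trough lies at or below -1/2 *)

Section near_rupture.
Hypothesis wL : w L <= - 1 / 2.

(** c and w L are both negative, so [bump_energy_bound] leaves g (w L)^2 / 2 <= m, with (w L)^2 >= 1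
    / 4. *)
Lemma bump_m_ge : g / 8 <= m.
Proof.
have := bump_energy_bound; have := bump_c_lt; have := bump_max.
have := wL; have := g0 => g0' wL' w0 cw E.
have : 0 <= c * w L.
  by rewrite mulr_le0//; [rewrite ltW// (lt_trans cw)// oppr_lt0 mulr_gt0|lra].
have : (1 / 4) <= w L ^+ 2 by nra.
nra.
Qed.

(** Here the quadratic term of [bump_energy_bound] is dropped: c (w L) <= m with c < 0 and w L <= -1
    / 2. *)
Lemma bump_c_ge : - (2 * m) <= c.
Proof.
have := bump_energy_bound; have := bump_c_lt; have := bump_max.
have := wL; have := g0 => g0' wL' w0 cw E.
have : 0 <= g * w L ^+ 2 / 2 by rewrite divr_ge0// mulr_ge0 ?sqr_ge0// ltW.
have : c < 0 by rewrite (lt_trans cw)// oppr_lt0 mulr_gt0.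
nra.
Qed.

Lemma bump_max_le : g * w 0 <= 2 * m.
Proof. by have := bump_c_lt; have := bump_c_ge; lra. Qed.

(** In the energy identity between x and L the terms with c and with [prim_nonlin (w L)] have the
    favourable sign, and [prim_nonlin (w x)] is bounded by the square root. *)
Lemma bump_slope x : 0 <= x <= L ->
  w1 x ^+ 2 <= g * (w 0 + 1) * (w x - w L) + 4 * m * Num.sqrt (1 + w x).
Proof.
move=> /andP[x0 xL].
have := bump_energy x; have := bump_c_lt; have := bump_max; have := g0.
have := bump_m_gt0 => m0 g0' w0 cw E.
have h1 : w L <= w x by exact: bump_decr.
have h2 : w x <= w 0 by exact: bump_decr.
have h3 : c * (w x - w L) <= 0.
  by rewrite mulr_le0_ge0 ?subr_ge0// ltW// (lt_trans cw)// oppr_lt0 mulr_gt0.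
have h4 : m * prim_nonlin (w L) <= 0.
  by rewrite mulr_ge0_le0 ?(ltW bump_m_gt0)// prim_nonlin_le0// (prof_gt pw).
have h5 : - (m * prim_nonlin (w x)) <= m * (2 * Num.sqrt (1 + w x)).
  rewrite -mulrN ler_wpM2l ?(ltW m0)// lerNl.
  by apply: prim_nonlin_ge_sqrt; exact: (prof_gt pw).
have h6 : g * w x ^+ 2 - g * w L ^+ 2 <= g * (w 0 + 1) * (w x - w L).
  rewrite [leLHS](_ : _ = g * (w x + w L) * (w x - w L)); last by ring.
  rewrite ler_wpM2r ?subr_ge0// ler_wpM2l ?(ltW g0)//.
  by have := bump_min; lra.
lra.
Qed.

(** Where 1 + w < d, the condition on ln d gives - m f(w) >= g + 2 m + 1, f = [nonlin]. This
    outweighs g w >= - g and c >= - 2 m and leaves w'' >= 1 from x to L; two integrations starting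
    from w1 L = 0 give the parabola. *)
Lemma bump_lower (d : R) : 0 < d -> d <= 1 ->
  ln d <= - 1 - (g + 2 * m + 1) / m ->
  forall x, 0 <= x <= L -> d <= 1 + w x \/ (L - x) ^+ 2 / 2 <= 1 + w x.
Proof.
move=> d0 d1 dd x /andP[x0 xL].
have [h|h] := leP d (1 + w x); [by left|right].
have m0 := bump_m_gt0; have L0' := L0.
have conv z : x <= z -> z <= L -> 1 <= rhs g m c (w z).
  move=> xz zL; rewrite /rhs.
  have wz : w z <= w x by apply: bump_decr.
  have h1 : nonlin (w z) <= - ((g + 2 * m + 1) / m).
    have wz1 : 0 < 1 + w z by have := prof_gt pw z; lra.
    apply: (le_trans (nonlin_le_ln (prof_gt pw z))).
    have : ln (1 + w z) <= ln d by rewrite ler_ln ?posrE//; lra.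
    lra.
  have h2 : m * nonlin (w z) <= - (g + 2 * m + 1).
    rewrite (le_trans (ler_wpM2l (ltW m0) h1))// mulrN lerN2.
    by rewrite mulrCA divff ?mulr1// gt_eqF.
  have := bump_c_ge; have : - g <= g * w z.
    by rewrite -mulrN1 ler_wpM2l ?(ltW g0)// ltW// (prof_gt pw).
  lra.
have slope z : x <= z -> z <= L -> w1 z <= z - L.
  move=> xz zL.
  have := @der_ge_bound _ w1 (fun t => rhs g m c (w t)) z L 1 zL (fun t _ => prof_d2 pw t).
  rewrite (prof_1_L pw) sub0r mul1r => H.
  suff : L - z <= - w1 z by lra.
  by apply: H => t /andP[zt tL]; apply: conv; lra.
have : (L - x) ^+ 2 / 2 + w L <= w x.
  pose q z := (z - L) ^+ 2 / 2 - w z.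
  have dq z : x <= z <= L -> is_derive z 1 q ((z - L) - w1 z).
    move=> _; have ? := prof_d1 pw z.
    by apply: is_derive_eq; rewrite /GRing.scale/=; field.
  have : q x <= q L.
    apply: (der_le xL dq) => z /andP[xz zL].
    by rewrite subr_ge0; apply: slope; exact: ltW.
  by rewrite /q subrr expr0n/= mul0r; lra.
by have := prof_gt pw L; lra.
Qed.

End near_rupture.
End bumps.

(** * Small and perturbed profiles *)

Section branch_lemmas.
Context {R : realType}.
Implicit Types (g L m n c d x y : R).

Lemma cont_argmax (f : R -> R) (a b : R) : a <= b -> continuous f ->
  exists2 z, a <= z <= b & forall x, a <= x <= b -> `|f x| <= `|f z|.
Proof.
move=> ab cf.
have cnf : continuous (fun x => `|f x|).
  by move=> x; apply: continuous_comp; [exact: cf|exact: norm_continuous].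
have [z zab H] := @EVT_max R _ a b ab (continuous_subspaceT cnf).
by exists z => // x xab; apply: H; rewrite in_itv.
Qed.

(** Rolle's theorem for (w1 - v1) - (g + a) (W - V), where the slopes and the primitives W, V of w,
    v all vanish at 0 and L. The free parameter a serves to cancel the linear part of [nonlin] where
    a quadratic error is wanted. *)
Lemma prof_c_rolle g L m c n d (a : R) (w w1 v v1 : R -> R) : 0 < L ->
  profile g L m c w w1 -> profile g L n d v v1 ->
  exists2 z, 0 <= z <= L &
    c - d = m * nonlin (w z) - n * nonlin (v z) + a * (w z - v z).
Proof.
move=> L0 pw pv.
have [W [dW W0 WL]] := prof_mean pw; have [V [dV V0 VL]] := prof_mean pv.
pose P x := (w1 x - v1 x) - (g + a) * (W x - V x).
have dP x : 0 <= x <= L -> is_derive x 1 P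
    ((rhs g m c (w x) - rhs g n d (v x)) - (g + a) * (w x - v x)).
  move=> xL; have ? := dW x xL; have ? := dV x xL.
  have ? := prof_d2 pw x; have ? := prof_d2 pv x.
  by apply: is_derive_eq; rewrite /GRing.scale/=.
have [z [z0 zL]] := der_mvt L0 dP.
rewrite /P (prof_1_0 pw) (prof_1_0 pv) (prof_1_L pw) (prof_1_L pv) W0 WL V0 VL.
rewrite !subr0 mulr0 subrr => /esym/eqP; rewrite mulf_eq0 (gt_eqF L0) orbF => /eqP E.
exists z; first by rewrite !ltW.
by rewrite /rhs in E; lra.
Qed.

Lemma prof_zero g L : 0 < L -> profile g L 0 0 (fun _ => 0 : R) (fun _ => 0 : R).
Proof.
move=> L0; split => //=.
- by move=> x; exact: is_derive_cst.
- by move=> x; rewrite /rhs mulr0 mul0r subrr addr0; exact: is_derive_cst.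
- by exists (fun _ => 0); split => // x _; exact: is_derive_cst.
Qed.

(** Closeness of the profiles and of m controls c - d through [prof_c_rolle], hence the second
    derivatives, and [decr_stable] applies to the slopes. *)
Lemma bump_open g L m c (w w1 : R -> R) : 0 < g -> 0 < L ->
  profile g L m c w w1 -> onebump L w1 ->
  exists2 e : R, 0 < e & forall n d (v v1 : R -> R), profile g L n d v v1 ->
    (forall x, 0 <= x <= L -> `|w x - v x| <= e) -> `|m - n| <= e ->
    onebump L v1.
Proof.
move=> g0 L0 pw bw.
have [e0 h0] := bump_ends g0 L0 pw bw.
have [e e_gt0 He] := decr_stable L0 (prof_d2 pw) (prof_cont_rhs pw)
  (prof_1_0 pw) (prof_1_L pw) bw e0 h0.
have [a aL ha] := cont_min (ltW L0) (prof_cont pw).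
have wa : 0 < 1 + w a by have := prof_gt pw a; lra.
have cf : continuous (fun x => nonlin (w x)) := der_continuous (prof_nonlin_d pw).
have [B hB] := cont_bound (ltW L0) cf.
have B0 : 0 <= B by apply: le_trans (hB 0 _); rewrite ?normr_ge0// lexx ltW.
(* As the profiles differ by at most r <= D, both 1 + w and 1 + v stay above D, where [nonlin] has
   Lipschitz constant 1 / D. *)
pose D := (1 + w a) / 2.
have D0 : 0 < D by rewrite divr_gt0.
pose C := g + 2 * (B + (`|m| + 1) / D).
have C0 : 0 < C.
  rewrite /C ltr_wpDr// mulr_ge0// addr_ge0// divr_ge0//.
  exact: ltW.
have eC : 0 < e / C by rewrite divr_gt0.
have [r [r0 r1 r2 r3]] := min3 ltr01 D0 eC.
exists r => // n d v v1 pv hwv hmn.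
apply: (He _ _ (prof_d2 pv) (prof_1_0 pv) (prof_1_L pv)) => x xL.
have close y : 0 <= y <= L ->
    `|m * nonlin (w y) - n * nonlin (v y)| <= r * (B + (`|m| + 1) / D).
  move=> yL.
  have -> : m * nonlin (w y) - n * nonlin (v y) =
    (m - n) * nonlin (w y) + n * (nonlin (w y) - nonlin (v y)) by ring.
  apply: (le_trans (ler_normD _ _)); rewrite [leRHS]mulrDr; apply: lerD; rewrite normrM.
    by apply: ler_pM => //; exact: hB.
  have hn : `|n| <= `|m| + 1.
    have := ler_normD (n - m) m; rewrite subrK distrC.
    by move=> /le_trans; apply; rewrite addrC lerD2l (le_trans hmn).
  rewrite [leRHS](_ : _ = (`|m| + 1) * (D^-1 * r)); last by ring.
  apply: ler_pM => //.
  have h1 := ha y yL.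
  have := hwv y yL => h2.
  apply: (le_trans (@nonlin_lip _ _ _ D D0 _ _)).
  - by rewrite /D; lra.
  - by have := ler_norm (w y - v y); rewrite /D in r2 *; lra.
  - by rewrite ler_wpM2l// invr_ge0 ltW.
have [z zL] := prof_c_rolle 0 L0 pw pv; rewrite mul0r addr0 => cd.
have -> : rhs g n d (v x) - rhs g m c (w x) = - (g * (w x - v x)) +
   ((m * nonlin (w x) - n * nonlin (v x)) - (c - d)) by rewrite /rhs; ring.
rewrite cd (le_trans (ler_normD _ _))//.
apply: (@le_trans _ _ (r * C)); last by rewrite -ler_pdivlMr.
rewrite (_ : r * C = g * r + (r * (B + (`|m| + 1) / D) + r * (B + (`|m| + 1) / D))); last first.
  by rewrite /C; ring.
apply: lerD.
  by rewrite normrN normrM gtr0_norm// ler_wpM2l ?(ltW g0)// hwv.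
by apply: (le_trans (ler_normB _ _)); apply: lerD; exact: close.
Qed.

(** * Small solutions near the bifurcation point *)

Section small_amplitude.
Variables (g k0 L : R).
Hypotheses (g0 : 0 < g) (k00 : 0 < k0) (kL : k0 * L = pi).

Let L0 : 0 < L := half_period_gt0 k00 kL.
Let Mst := Mstar g k0.
Let Mst0 : 0 < Mst.
Proof. by rewrite /Mst /Mstar addr_gt0 ?mulr_gt0 ?exprn_gt0. Qed.

(** [nonlin] without its linear term at 0; the constant q 0 cancels in all differences. *)
Let q (y : R) := nonlin y - y / 4.

Let q_lip x y (d : R) : d <= 1 / 2 -> `|x| <= d -> `|y| <= d ->
  `|q x - q y| <= 3 * d * `|x - y|.
Proof. exact: nonlin_taylor. Qed.

Let q_bound x y (d : R) : d <= 1 / 2 -> `|x| <= d -> `|y| <= d ->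
  `|q x - q y| <= 6 * d ^+ 2.
Proof.
move=> d2 xd yd; apply: (le_trans (q_lip d2 xd yd)).
have d0 : 0 <= d by apply: le_trans xd.
rewrite [leRHS](_ : _ = 3 * d * (d + d)); last by ring.
by rewrite ler_wpM2l ?mulr_ge0// (le_trans (ler_normB _ _))// lerD.
Qed.

(* [v'' + k0 ^ 2 v] is quadratically small, up to the detuning of [m]. *)
Let forcing m c (v v1 : R -> R) (r t : R) : profile g L m c v v1 ->
  `|m - Mst| <= r -> r <= 1 -> t <= 1 / 2 ->
  (forall x, 0 <= x <= L -> `|v x| <= t) ->
  forall x, 0 <= x <= L ->
    `|rhs g m c (v x) + k0 ^+ 2 * v x| <= t * (r / 4 + 6 * (Mst + 1) * t).
Proof.
move=> pv mr r1 t2 vt x xL.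
(* Comparison with the zero profile and a = - m / 4 gives c = m q (v z), free of linear terms. *)
have [z zL] := prof_c_rolle (- m / 4) L0 pv (prof_zero g L0).
rewrite mul0r !subr0 => E.
have -> : rhs g m c (v x) + k0 ^+ 2 * v x =
   - ((m - Mst) / 4 * v x) - m * (q (v x) - q (v z)).
  by rewrite /rhs E /q /Mst /Mstar; field.
have t0 : 0 <= t by apply: le_trans (vt x xL).
have m1 : `|m| <= Mst + 1.
  have := ler_normD (m - Mst) Mst; rewrite subrK (gtr0_norm Mst0).
  by move=> /le_trans; apply; rewrite addrC lerD2l (le_trans mr).
rewrite (le_trans (ler_normB _ _))// normrN [leRHS]mulrDr lerD// normrM.
  rewrite mulrC; apply: ler_pM => //; first exact: vt.
  by rewrite normrM (gtr0_norm (_ : 0 < 4^-1))// ler_wpM2r.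
rewrite [leRHS](_ : _ = (Mst + 1) * (6 * t ^+ 2)); last by ring.
by apply: ler_pM => //; apply: q_bound => //; exact: vt.
Qed.

(** After division by s the profile is close to cos (k0 x), whose slope has the shape required by
    [decr_stable]. A sup-norm expansion is enough, since [forcing] upgrades it to second
    derivatives. *)
Lemma bump_near0 (C : R) : 0 <= C -> exists2 r : R, 0 < r &
  forall (s m c : R) (v v1 : R -> R), 0 < s -> s <= r -> `|m - Mst| <= r ->
    profile g L m c v v1 ->
    (forall x, 0 <= x <= L -> `|v x - s * cos (k0 * x)| <= C * s ^+ 2) ->
    onebump L v1.
Proof.
move=> C0.
have [|||||||e e0 He] := @decr_stable _ (fun x => - (k0 * sin (k0 * x)))
  (fun x => - (k0 ^+ 2 * cos (k0 * x))) L L0.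
- by move=> x; apply: is_derive_eq; rewrite /GRing.scale/=; ring.
- move=> x; apply: cvgN; apply: cvgM; first exact: cvg_cst.
  apply: (@continuous_comp _ _ _ (fun z => k0 * z) (@cos R)).
    by apply: cvgM; [exact: cvg_cst|exact: cvg_id].
  exact: continuous_cos.
- by rewrite mulr0 sin0 mulr0 oppr0.
- by rewrite kL sinpi mulr0 oppr0.
- move=> x /andP[x0 xL]; rewrite oppr_lt0 mulr_gt0// sin_gt0_pi// mulr_gt0//=.
  by rewrite -kL ltr_pM2l.
- by rewrite mulr0 cos0 mulr1 oppr_lt0 exprn_gt0.
- by rewrite kL cospi mulrN1 opprK exprn_gt0.
(* N bounds |v| / s, and K r bounds the distance of v'' / s from - k0^2 cos (k0 x). The condition r
   <= 1 / (2 N) keeps |v| <= 1 / 2. *)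
pose N := C + 1.
pose K := N * (1 / 4 + 6 * (Mst + 1) * N) + k0 ^+ 2 * C.
have N0 : 0 < N by rewrite /N; lra.
have K0 : 0 < K.
  apply: ltr_wpDr; first by apply: mulr_ge0 => //; exact: sqr_ge0.
  apply: mulr_gt0 => //; apply: addr_gt0; first by rewrite divr_gt0.
  by apply: mulr_gt0 => //; apply: mulr_gt0 => //; exact: addr_gt0.
have [r [r0 r1 r2 r3]] := min3 (ltr01 : (0 : R) < 1)
  (divr_gt0 e0 K0) (divr_gt0 (ltr01 : (0 : R) < 1) (mulr_gt0 (ltr0n R 2) N0)).
exists r => // s m c v v1 s0 sr mr pv hv.
have sN : s * N <= 1 / 2.
  have : s <= 1 / (2 * N) by lra.
  rewrite ler_pdivlMr ?mulr_gt0//; lra.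
have vb x : 0 <= x <= L -> `|v x| <= s * N.
  move=> xL; rewrite -[v x](subrK (s * cos (k0 * x))).
  apply: (le_trans (ler_normD _ _)).
  rewrite /N mulrDr mulr1 lerD//.
    apply: (le_trans (hv x xL)).
    rewrite expr2 mulrA mulrC ler_wpM2l ?(ltW s0)//.
    by rewrite -[leRHS]mulr1 ler_wpM2l//; lra.
  rewrite normrM (gtr0_norm s0) -[leRHS]mulr1 ler_wpM2l ?cos_max//.
  exact: ltW.
have fb := forcing pv mr r1 sN vb.
suff H x : 0 < x < L -> v1 x / s < 0.
  by move=> x /H; rewrite pmulr_llt0// invr_gt0.
apply: (He (fun x => v1 x / s) (fun x => rhs g m c (v x) / s)).
- move=> z; have ? := prof_d2 pv z.
  by apply: is_derive_eq; rewrite /GRing.scale/=; ring.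
- by rewrite (prof_1_0 pv) mul0r.
- by rewrite (prof_1_L pv) mul0r.
move=> z zL.
have -> : rhs g m c (v z) / s - - (k0 ^+ 2 * cos (k0 * z)) =
  ((rhs g m c (v z) + k0 ^+ 2 * v z) - k0 ^+ 2 * (v z - s * cos (k0 * z))) / s.
  by field; rewrite gt_eqF.
rewrite normrM normfV (gtr0_norm s0) ler_pdivrMr//.
apply: (le_trans (ler_normB _ _)).
have h1 := fb z zL.
have h2 : `|k0 ^+ 2 * (v z - s * cos (k0 * z))| <= k0 ^+ 2 * C * s ^+ 2.
  by rewrite normrM ger0_norm ?sqr_ge0// -mulrA ler_wpM2l ?sqr_ge0// hv.
apply: (@le_trans _ _ (K * r * s)); last first.
  rewrite ler_wpM2r ?(ltW s0)// mulrC -ler_pdivlMr//.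
apply: (le_trans (lerD h1 h2)).
have h3 : s * N * (r / 4 + 6 * (Mst + 1) * (s * N)) <=
    s * N * (r * (1 / 4 + 6 * (Mst + 1) * N)).
  rewrite ler_wpM2l ?mulr_ge0 ?(ltW s0) ?(ltW N0)// [leRHS]mulrDr lerD//.
    by rewrite mulrA mulr1.
  rewrite [leLHS](_ : _ = s * (6 * (Mst + 1) * N)); last by ring.
  rewrite ler_wpM2r// mulr_ge0 ?(ltW N0)// mulr_ge0//.
  by rewrite addr_ge0// ltW.
have h4 : k0 ^+ 2 * C * s ^+ 2 <= k0 ^+ 2 * C * (r * s).
  apply: ler_wpM2l; first by apply: mulr_ge0 => //; exact: sqr_ge0.
  by rewrite expr2; apply: ler_wpM2r => //; exact: ltW.
apply: (le_trans (lerD h3 h4)).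
by rewrite le_eqVlt; apply/orP; left; apply/eqP; rewrite /K; ring.
Qed.

Let N := 1 / 4 + 6 * (Mst + 1).
Let N_gt0 : 0 < N.
Proof.
apply: addr_gt0; first by rewrite divr_gt0.
by apply: mulr_gt0 => //; exact: addr_gt0.
Qed.

(** The height v 0 controls the whole profile: by variation of constants v differs from v 0 cos (k0
    x) by at most a sixteenth of T = max |v|, which gives T <= 2 v 0. *)
Let amplitude m c (v v1 : R -> R) (r : R) : profile g L m c v v1 ->
  0 < v 0 -> `|m - Mst| <= r -> r <= 1 / 2 -> 80 * N * L * r <= k0 ->
  (forall x, 0 <= x <= L -> `|v x| <= r) ->
  forall x, 0 <= x <= L -> `|v x| <= 2 * v 0 /\
    `|v x - v 0 * cos (k0 * x)| <= v 0 / 8.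
Proof.
move=> pv t0 mr r2 rk vr.
have [a aL ha] := cont_argmax (ltW L0) (prof_cont pv).
set t := v 0 in t0 *; set T : R := `|v a| in ha *.
have T0 : 0 <= T by exact: normr_ge0.
have Tr : T <= r by exact: vr.
have r0 : 0 <= r by exact: le_trans Tr.
have r1 : r <= 1 by lra.
have T2 : T <= 1 / 2 by lra.
have F := forcing pv mr r1 T2 ha.
have fb x : 0 <= x <= L -> `|rhs g m c (v x) + k0 ^+ 2 * v x| <= T * (r * N).
  move=> xL; apply: (le_trans (F x xL)); rewrite ler_wpM2l// /N [leRHS]mulrDr lerD//.
    lra.
  by rewrite mulrC ler_wpM2r// mulr_ge0// addr_ge0// ltW.
have vc x : 0 <= x <= L -> `|v x - t * cos (k0 * x)| <= T / 16.
  move=> xL.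
  have := @variation_of_constants _ (fun x => v x - t * cos (k0 * x))
    (fun x => v1 x + t * k0 * sin (k0 * x))
    (fun x => rhs g m c (v x) + k0 ^+ 2 * v x) k0 (T * (r * N)) L k00.
  case/(_ _ _ _ _ _ x xL)/wrap.
  - move=> z _; have ? := prof_d1 pv z.
    by apply: is_derive_eq; rewrite /GRing.scale/=; ring.
  - move=> z _; have ? := prof_d2 pv z.
    by apply: is_derive_eq; rewrite /GRing.scale/=; ring.
  - by rewrite mulr0 cos0 mulr1 subrr.
  - by rewrite mulr0 sin0 mulr0 addr0 (prof_1_0 pv).
  - by move=> z; exact: fb.
  move=> h; rewrite -(ler_pM2l k00); apply: (le_trans h).
  have : 2 * (T * (r * N)) * x <= 2 * (T * (r * N)) * L.
    rewrite ler_wpM2l ?mulr_ge0 ?(ltW N_gt0)//; by case/andP: xL.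
  move/le_trans; apply.
  have : T * (80 * N * L * r) <= T * k0 by rewrite ler_wpM2l.
  have : 0 <= T * k0 by rewrite mulr_ge0// ltW.
  nra.
have Tt : T <= 2 * t.
  have := vc a aL; rewrite /T.
  have := ler_normD (v a - t * cos (k0 * a)) (t * cos (k0 * a)); rewrite subrK.
  rewrite normrM (gtr0_norm t0).
  have : t * `|cos (k0 * a)| <= t by rewrite -[leRHS]mulr1 ler_wpM2l ?cos_max// ltW.
  lra.
move=> x xL; split; first exact: le_trans (ha x xL) Tt.
by apply: (le_trans (vc x xL)); lra.
Qed.

(** 12 am t^2 <= rho / 2 because 12 x 16 / 384 = 1 / 2, and r N' Z <= rho / 4 because 20 l r N' <= k
    / 4. Together rho <= 3 rho / 4. This fixes the constants 384 and 80. *)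
Let absorb (r N' l k rho am t Z : R) : 0 < k -> 0 <= r -> 0 <= N' -> 0 <= am ->
  0 <= t -> t <= 1 / 384 -> 0 <= rho -> 80 * N' * l * r <= k ->
  rho = r * N' * Z + 12 * am * t ^+ 2 -> am * t <= 16 * rho ->
  k * Z <= 20 * rho * l -> rho <= 0.
Proof.
move=> k1 r1 N1 am1 t1 t2 rho1 rk rhoE amt kZ.
have h1 : 12 * am * t ^+ 2 <= rho / 2.
  have : am * t * t <= 16 * rho * (1 / 384) by apply: ler_pM => //; exact: mulr_ge0.
  rewrite expr2; lra.
have h2 : rho <= 2 * (r * N' * Z) by lra.
have h3 : (r * N') * (k * Z) <= (r * N') * (20 * rho * l).
  by apply: ler_wpM2l => //; exact: mulr_ge0.
have h4 : rho * (80 * N' * l * r) <= rho * k by rewrite ler_wpM2l.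
have h5 : k * rho <= k * (2 * (r * N' * Z)) by rewrite ler_pM2l.
by rewrite leNgt; apply/negP => rp; have := mulr_gt0 k1 rp; lra.
Qed.

Let lower_J (t l J : R) : 0 < t -> 0 < l ->
  - (t / 8) * l <= J - t * (l / 2) -> t * l / 4 <= J.
Proof. by move=> t0 l0; have := mulr_gt0 t0 l0; lra. Qed.

Let ten_rho (rho x : R) : x <= 16 * rho -> rho + rho + x / 2 <= 10 * rho.
Proof. lra. Qed.

(** A Lyapunov-Schmidt reduction by hand. The difference of two solutions of equal height has zero
    Cauchy data at 0; its mean controls the multiplier difference e, its cosine component controls
    mu = m - n, and variation of constants controls the rest. All are bounded by rho, which [absorb]
    shows to vanish. *)
Lemma small_uniqueness : exists2 r : R, 0 < r &
  forall (m n c d : R) (w w1 v v1 : R -> R),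
    profile g L m c w w1 -> profile g L n d v v1 ->
    `|m - Mst| <= r -> `|n - Mst| <= r ->
    (forall x, 0 <= x <= L -> `|w x| <= r) ->
    (forall x, 0 <= x <= L -> `|v x| <= r) ->
    w 0 = v 0 -> 0 < w 0 -> (forall x, 0 <= x <= L -> w x = v x) /\ m = n.
Proof.
have kN : 0 < k0 / (80 * N * L) by rewrite divr_gt0 ?mulr_gt0 ?N_gt0.
have c384 : 0 < 1 / 384 :> R by rewrite div1r invr_gt0 ltr0n.
have [r [r0 r1 r2 r11]] := min3 c384 kN (ltr01 : (0 : R) < 1).
exists r => // m n c d w w1 v v1 pw pv mr nr wr vr wv t0.
have rk : 80 * N * L * r <= k0.
  by rewrite mulrC -ler_pdivlMr// !mulr_gt0 ?N_gt0.
have r12 : r <= 1 / 2 by lra.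
have Aw := amplitude pw t0 mr r12 rk wr.
have t0' := t0; rewrite wv in t0'.
have Av := amplitude pv t0' nr r12 rk vr.
move: Aw Av; rewrite -wv; set t := w 0 in t0 *; move=> Aw Av.
have tr : t <= r.
  by apply: le_trans (wr 0 _); [exact: ler_norm|rewrite lexx ltW].
have t2 : 2 * t <= 1 / 2 by lra.
have t384 : t <= 1 / 384 by exact: le_trans tr r1.
have t20 : 0 <= 2 * t by rewrite mulr_ge0// ltW.
have t30 : 0 <= 3 * (2 * t) by rewrite mulr_ge0.
have t6 : 3 * (2 * t) <= 6 * r by lra.
clear r1 r2 c384 kN.
pose zt x := w x - v x; pose zt1 x := w1 x - v1 x.
have czt : continuous zt by move=> x; apply: cvgB; [exact: (prof_cont pw)|exact: (prof_cont pv)].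
have [a aL hZ] := cont_argmax (ltW L0) czt.
set Z : R := `|zt a| in hZ.
have Z0 : 0 <= Z by exact: normr_ge0.
(* The constant mu q 0 is moved into e, so that [rem] contains only q (v x) - q 0, which is
   quadratic in the amplitude. *)
pose mu := m - n; pose e := c - d - mu * q 0.
pose rem x := (g + k0 ^+ 2 - m / 4) * zt x - m * (q (w x) - q (v x)) - mu * (q (v x) - q 0).
have dzt x : is_derive x 1 zt (zt1 x).
  by have ? := prof_d1 pw x; have ? := prof_d1 pv x; exact: is_deriveB.
have dzt1 x : is_derive x 1 zt1 ((rem x + e - mu / 4 * v x) - k0 ^+ 2 * zt x).
  have h1 := prof_d2 pw x; have h2 := prof_d2 pv x.
  apply: (is_derive_eq (is_deriveB h1 h2)).
  by rewrite /rem /e /mu /zt /q /rhs; field.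
pose rho := r * N * Z + 12 * `|mu| * t ^+ 2.
have rho0 : 0 <= rho.
  by rewrite /rho addr_ge0// !mulr_ge0// ?sqr_ge0// ltW ?N_gt0.
have m1 : `|m| <= Mst + 1.
  have := ler_normD (m - Mst) Mst; rewrite subrK (gtr0_norm Mst0).
  by move=> /le_trans; apply; rewrite addrC lerD2l (le_trans mr).
have remb x : 0 <= x <= L -> `|rem x| <= rho.
  move=> xL; have [wx _] := Aw x xL; have [vx _] := Av x xL.
  rewrite /rem /rho.
  apply: (le_trans (ler_normB _ _)); apply: lerD; last first.
    rewrite normrM -mulrA mulrCA ler_wpM2l//.
    have := @q_lip (v x) 0 (2 * t) t2 vx.
    rewrite normr0 subr0 => /(_ t20) /le_trans; apply.
    rewrite [leRHS](_ : _ = 3 * (2 * t) * (2 * t)); last by ring.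
    exact: ler_wpM2l.
  apply: (le_trans (ler_normB _ _)).
  have -> : r * N * Z = r / 4 * Z + (Mst + 1) * (6 * r * Z) by rewrite /N; field.
  apply: lerD.
    rewrite normrM; apply: ler_pM => //; last exact: hZ.
    rewrite [X in `|X|](_ : _ = - (m - Mst) / 4); last by rewrite /Mst /Mstar; field.
    by rewrite normrM normrN (gtr0_norm (_ : 0 < 4^-1))// ler_wpM2r.
  rewrite normrM; apply: ler_pM => //.
  apply: (le_trans (q_lip t2 wx vx)).
  by apply: ler_pM => //; exact: hZ.
(* integrating the equation of [zt] over a period *)
have eb : `|e| <= rho.
  have [W [dW W0 WL]] := prof_mean pw; have [V [dV V0 VL]] := prof_mean pv.
  pose P x := zt1 x + k0 ^+ 2 * (W x - V x) + mu / 4 * V x.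
  have dP x : 0 <= x <= L -> is_derive x 1 P (rem x + e).
    move=> xL; have ? := dW x xL; have ? := dV x xL; have ? := dzt1 x.
    by apply: is_derive_eq; rewrite /zt /GRing.scale/=; ring.
  have [z [z0 zL]] := der_mvt L0 dP.
  rewrite /P /zt1 (prof_1_0 pw) (prof_1_0 pv) (prof_1_L pw) (prof_1_L pv) W0 WL V0 VL.
  rewrite subr0 mulr0 subrr => /esym/eqP; rewrite mulf_eq0 subr0 (gt_eqF L0) orbF => /eqP E.
  have -> : e = - rem z by apply/eqP; rewrite -addr_eq0 addrC E.
  by rewrite normrN remb// !ltW.
(* testing it against the cosine *)
have mub : `|mu| * t <= 16 * rho.
  have cv : continuous (fun x => v x * cos (k0 * x)).
    move=> x; apply: cvgM; first exact: (prof_cont pv).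
    apply: (@continuous_comp _ _ _ (fun z => k0 * z) (@cos R)).
      by apply: cvgM; [exact: cvg_cst|exact: cvg_id].
    exact: continuous_cos.
  have [J [dJ J0]] := der_primitive L cv.
  have {}dJ x : 0 <= x <= L -> is_derive x 1 J (v x * cos (k0 * x)).
    by move=> /andP[x0 xL]; apply: dJ; rewrite ger0_norm.
  (* v is within t / 8 of t cos (k0 x), and t cos^2 integrates to t L / 2 over [0, L]; so the cosine
     component of v, which multiplies mu, cannot degenerate. *)
  have JL : t * L / 4 <= J L.
    pose P x := J x - t * (x / 2 + sin (2 * k0 * x) / (4 * k0)).
    have dP x : 0 <= x <= L -> is_derive x 1 P (v x * cos (k0 * x) - t * cos (k0 * x) ^+ 2).
      move=> xL; have ? := dJ x xL.
      apply: is_derive_eq; rewrite /GRing.scale/= -mulrA.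
      have -> : cos (2 * (k0 * x)) = 2 * cos (k0 * x) ^+ 2 - 1.
        by rewrite mulr_natl cos_mulr2n mulr2n; ring.
      by field; rewrite gt_eqF.
    have := @der_ge_bound _ P _ 0 L (- (t / 8)) (ltW L0) dP.
    rewrite /P J0 mulr0 sin0 mul0r mul0r addr0 mulr0 subrr !subr0.
    have -> : 2 * k0 * L = pi *+ 2 by rewrite -mulrA kL mulr_natl.
    rewrite sin2pi mul0r addr0 => H.
    apply: (lower_J t0 L0); apply: H => x /andP[x0 xL].
    have [_ h] := Av x ltac:(by rewrite !ltW).
    have -> : v x * cos (k0 * x) - t * cos (k0 * x) ^+ 2 =
       (v x - t * cos (k0 * x)) * cos (k0 * x) by ring.
    rewrite lerNl (le_trans (ler_norm _))// normrN normrM -[leRHS]mulr1.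
    by apply: ler_pM => //; exact: cos_max.
  pose P x := zt1 x * cos (k0 * x) + k0 * (zt x * sin (k0 * x)) + mu / 4 * J x
    - e * (sin (k0 * x) / k0).
  have dP x : 0 <= x <= L -> is_derive x 1 P (rem x * cos (k0 * x)).
    move=> xL; have ? := dJ x xL; have ? := dzt x; have ? := dzt1 x.
    apply: is_derive_eq; rewrite /GRing.scale/=.
    by field; rewrite gt_eqF.
  have := @der_lip _ P _ 0 L rho (ltW L0) dP.
  rewrite /P /zt1 /zt (prof_1_0 pw) (prof_1_0 pv) (prof_1_L pw) (prof_1_L pv) J0.
  rewrite kL sinpi !mulr0 sin0 !(mul0r, mulr0, subrr, addr0, subr0, add0r) => H.
  have {}H : `|mu / 4 * J L| <= rho * L.
    apply: H => x xL; rewrite normrM -[leRHS]mulr1.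
    by apply: ler_pM => //; [exact: remb|exact: cos_max].
  have JL0 : 0 <= J L by apply: le_trans JL; rewrite !mulr_ge0// ltW.
  rewrite !normrM (ger0_norm JL0) (gtr0_norm (_ : 0 < 4^-1))// in H.
  have : `|mu| / 4 * (t * L / 4) <= rho * L.
    by apply: le_trans H; rewrite ler_wpM2l.
  rewrite [leLHS](_ : _ = (`|mu| * t / 16) * L); last by field.
  by rewrite ler_pM2r// ler_pdivrMr// [leRHS]mulrC.
have zb : k0 * Z <= 20 * rho * L.
  have := @variation_of_constants _ zt zt1 (fun x => rem x + e - mu / 4 * v x) k0 (10 * rho) L k00.
  case/(_ _ _ _ _ _ a aL)/wrap.
  - by rewrite /zt wv subrr.
  - by rewrite /zt1 (prof_1_0 pw) (prof_1_0 pv) subrr.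
  - move=> z zL; have [vz _] := Av z zL.
    have H : `|mu / 4 * v z| <= `|mu| * t / 2.
      rewrite !normrM (gtr0_norm (_ : 0 < 4^-1))//.
      have -> : `|mu| * t / 2 = `|mu| / 4 * (2 * t) by field.
      by rewrite ler_wpM2l.
    apply: (le_trans (ler_normB _ _)); apply: le_trans (ten_rho mub).
    by apply: lerD => //; apply: (le_trans (ler_normD _ _)); apply: lerD => //; exact: remb.
  move=> h; apply: (le_trans h); have /andP[a0 aL'] := aL.
  rewrite (_ : 20 * rho * L = 2 * (10 * rho) * L); last by ring.
  by rewrite ler_wpM2l// !mulr_ge0.
have rho_le : rho <= 0.
  apply: (absorb k00 (ltW r0) (ltW N_gt0) (normr_ge0 mu) (ltW t0) t384 rho0 rk) => //.
have rho00 : rho = 0 by apply/eqP; rewrite eq_le rho_le.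
rewrite rho00 mulr0 in mub; rewrite rho00 mulr0 mul0r in zb.
split.
  move=> x xL; apply/eqP; rewrite -subr_eq0 -normr_le0.
  apply: (le_trans (hZ x xL)).
  by rewrite -(pmulr_rle0 _ k00).
apply/eqP; rewrite -subr_eq0 -normr_le0 -/mu.
by rewrite -(pmulr_lle0 _ t0).
Qed.

End small_amplitude.
End branch_lemmas.

(** * Smooth test functions *)

Section smooth_functions.
Context {R : realType}.
Implicit Types (u v f g : R -> R) (x a b : R) (n k : nat).

(** [smooth] unrolled from the first derivative on, the form in which the product and chain rules
    pass through an induction on n over all functions at once. *)
Fixpoint ndiff n u : Prop :=
  if n is n'.+1 then (forall x, derivable u x 1) /\ ndiff n' (u^`())
  else True.

Lemma ndiffW n u : ndiff n.+1 u -> ndiff n u.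
Proof. by elim: n u => [//|n ih] u [du /ih]. Qed.

Lemma smooth_ndiff u : smooth u <-> forall n, ndiff n u.
Proof.
split=> [su n|H n].
  elim: n u su => [//|n ih] u su; split; first exact: (su 0%N).
  by apply: ih => k x; rewrite -derive1Sn.
have: ndiff n.+1 u by exact: H.
elim: n u {H} => [|n ih] u; first by move=> [].
by rewrite derive1Sn => -[_ /ih].
Qed.

Lemma derive1_is_derive u x (d : R) : is_derive x 1 u d -> u^`() x = d.
Proof. by move=> [_ <-]; rewrite derive1E. Qed.

Lemma derivable_is_derive u x : derivable u x 1 -> is_derive x 1 u (u^`() x).
Proof. by move=> ud; rewrite derive1E; exact: derivableP. Qed.

Lemma ndiff_der n u v : (forall x, is_derive x 1 u (v x)) -> ndiff n v ->
  ndiff n.+1 u.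
Proof.
move=> du dv; split.
  by move=> x; exact: (@ex_derive _ _ _ _ _ _ _ (du x)).
by rewrite (_ : u^`() = v)//; apply/funext => x; exact: derive1_is_derive.
Qed.

Lemma ndiff_cst n (a : R) : ndiff n (fun _ : R => a).
Proof.
elim: n a => // n ih a; apply: (@ndiff_der _ _ (fun _ => 0)) => // x; exact: is_derive_cst.
Qed.

Lemma ndiffD n u v : ndiff n u -> ndiff n v -> ndiff n (fun x => u x + v x).
Proof.
elim: n u v => // n ih u v [du du'] [dv dv'].
apply: (ndiff_der _ (ih _ _ du' dv')) => x.
by apply: is_deriveD; exact: derivable_is_derive.
Qed.

Lemma ndiffM n u v : ndiff n u -> ndiff n v -> ndiff n (fun x => u x * v x).
Proof.
elim: n u v => // n ih u v hu hv; have [du du'] := hu; have [dv dv'] := hv.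
have h : ndiff n (fun x => derive1 u x * v x + u x * derive1 v x).
  by apply: ndiffD; apply: ih => //; exact: ndiffW.
apply: (ndiff_der _ h) => x.
apply: (is_derive_eq (is_deriveM (derivable_is_derive (du x)) (derivable_is_derive (dv x)))).
by rewrite /GRing.scale/=; ring.
Qed.

Lemma ndiff_affine n u (a b : R) : ndiff n u -> ndiff n (fun x => u (a * x + b)).
Proof.
elim: n u => // n ih u [du du'].
have h : ndiff n (fun x => a * derive1 u (a * x + b)).
  by apply: ndiffM; [exact: ndiff_cst|exact: ih].
apply: (ndiff_der _ h) => x.
have dg : is_derive x 1 (fun y : R => a * y + b) a.
  by apply: is_derive_eq; rewrite /GRing.scale/=; ring.
apply: (is_derive_eq (@is_derive1_comp _ u _ _ _ _ (derivable_is_derive (du _)) dg)).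
by ring.
Qed.

Lemma smoothD u v : smooth u -> smooth v -> smooth (fun x => u x + v x).
Proof.
by move=> /smooth_ndiff su /smooth_ndiff sv; apply/smooth_ndiff => n; exact: ndiffD.
Qed.

Lemma smoothM u v : smooth u -> smooth v -> smooth (fun x => u x * v x).
Proof.
by move=> /smooth_ndiff su /smooth_ndiff sv; apply/smooth_ndiff => n; exact: ndiffM.
Qed.

Lemma smooth_cst (a : R) : smooth (fun _ : R => a).
Proof. by apply/smooth_ndiff => n; exact: ndiff_cst. Qed.

Lemma smooth_affine u (a b : R) : smooth u -> smooth (fun x => u (a * x + b)).
Proof. by move=> /smooth_ndiff su; apply/smooth_ndiff => n; exact: ndiff_affine. Qed.

Lemma smooth_sub u v : smooth u -> smooth v -> smooth (fun x => u x - v x).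
Proof.
move=> su sv; rewrite (_ : (fun x => _) = (fun x => u x + (-1) * v x)).
  by apply: smoothD; [exact: su|apply: smoothM; [exact: smooth_cst|exact: sv]].
by apply/funext => x; rewrite mulN1r.
Qed.

Lemma smooth_exp u n : smooth u -> smooth (fun x => u x ^+ n).
Proof.
move=> su; elim: n => [|n ih]; first exact: smooth_cst.
by under eq_fun do rewrite exprS; exact: smoothM.
Qed.

Lemma smooth_cos : smooth (@cos R).
Proof.
apply/smooth_ndiff => n; suff [] : ndiff n (@cos R) /\ ndiff n (@sin R) by [].
elim: n => // n [ihc ihs]; split; last by apply: ndiff_der ihc => x; exact: is_derive_sin.
have h : ndiff n (fun x : R => (-1) * sin x) by apply: ndiffM => //; exact: ndiff_cst.
apply: (ndiff_der _ h) => x.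
by apply: (is_derive_eq (is_derive_cos x)); ring.
Qed.

Lemma smooth_der u : smooth u -> smooth (u^`()).
Proof. by move=> su n x; rewrite -derive1Sn; exact: su. Qed.

Lemma smooth_der_n u n : smooth u -> smooth (u^`(n)).
Proof.
elim: n u => [u su|n ih u su]; first exact: su.
by rewrite derive1Sn; apply: ih; exact: smooth_der.
Qed.

Lemma smooth_is_derive u n x : smooth u -> is_derive x 1 (u^`(n)) (u^`(n.+1) x).
Proof. by move=> su; rewrite derive1nS; apply: derivable_is_derive; exact: su. Qed.

Lemma smooth_continuous u n : smooth u -> continuous (u^`(n)).
Proof. by move=> su; apply: der_continuous => x; exact: smooth_is_derive. Qed.

Lemma smooth_cont u : smooth u -> continuous u.
Proof. by move=> su; have := @smooth_continuous u 0 su; rewrite derive1n0. Qed.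

Lemma is_derive_quadratic f x (C : R) :
  (forall y, `|f y - f x| <= C * (y - x) ^+ 2) -> is_derive x 1 f 0.
Proof.
move=> H.
have H0 : (fun h : R => h^-1 *: (f (h *: 1 + x) - f x)) @ (0 : R)^' --> (0 : R).
  apply/cvgrPdist_le => e e0.
  have C0 : 0 <= `|C| by [].
  exists (e / (`|C| + 1)) => /=.
    by rewrite divr_gt0// ltr_wpDl.
  move=> h he h0.
  have {}he : `|h| < e / (`|C| + 1) by move: he; rewrite /= sub0r normrN.
  rewrite sub0r normrN /GRing.scale/= mulr1.
  rewrite normrM normfV mulrC ler_pdivrMr ?normr_gt0//.
  apply: (le_trans (H _)); rewrite addrK -(real_normK (num_real h)).
  rewrite expr2 mulrA ler_wpM2r//.
  apply: (@le_trans _ _ (`|C| * `|h|)); first by rewrite ler_wpM2r// ler_norm.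
  apply: (@le_trans _ _ ((`|C| + 1) * `|h|)); first by rewrite ler_wpM2r// lerDl.
  by rewrite mulrC -ler_pdivlMr ?ltr_wpDl// ltW.
split; first by apply/cvg_ex; exists 0.
exact: cvg_lim H0.
Qed.

(* [flat k] is the building block [x ^ (-k) exp (-1 / x)] of all derivatives of
   [exp (-1 / x)]. *)
Definition flat (k : nat) (x : R) : R :=
  if 0 < x then x ^- k * expR (- x^-1) else 0.

(** The Taylor term of order k + 2 of exp (1 / x) beats x^-(k+1) by one power of x. *)
Lemma flat_bound k x : `|flat k.+1 x| <= k.+2`!%:R * `|x|.
Proof.
rewrite /flat; case: ltP => x0; last by rewrite normr0 mulr_ge0.
have xp : 0 < x ^- k.+1 by rewrite invr_gt0 exprn_gt0.
rewrite normrM (gtr0_norm xp) (gtr0_norm (expR_gt0 _)) (gtr0_norm x0).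
rewrite expRN ler_pdivrMr ?expR_gt0//.
have h := @expR_ge1Dxn R x^-1 k.+1 ltac:(by rewrite invr_ge0 ltW).
have f0 : (0 : R) < k.+2`!%:R by rewrite ltr0n fact_gt0.
apply: (@le_trans _ _ (k.+2`!%:R * x * (x^-1 ^+ k.+2 / k.+2`!%:R))).
  rewrite (_ : _ * _ * _ = x * x^-1 ^+ k.+2).
    by rewrite [in leRHS]exprS mulrA mulfV ?gt_eqF// mul1r exprVn.
  by field; rewrite !gt_eqF.
rewrite ler_wpM2l ?mulr_ge0 ?(ltW x0)//.
by apply: le_trans h; rewrite lerDr.
Qed.

Lemma flatS k x : flat k x = x * flat k.+1 x.
Proof.
rewrite /flat; case: ltP => x0; last by rewrite mulr0.
by rewrite mulrA exprS invfM mulrA mulfV ?gt_eqF// mul1r.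
Qed.

Lemma near_is_derive f g x (a d : R) : 0 < d ->
  (forall y, `|x - y| < d -> f y = g y) -> is_derive x 1 f a -> is_derive x 1 g a.
Proof. by move=> d0 H; apply: near_eq_is_derive; exists d. Qed.

Lemma is_derive_flat k x :
  is_derive x 1 (flat k) (flat k.+2 x - k%:R * flat k.+1 x).
Proof.
have [x0|x0|->] := ltgtP x 0.
- rewrite /flat ltNge (ltW x0)/= mulr0 subrr.
  apply: (@near_is_derive (cst 0) _ x 0 (- x)); first by rewrite oppr_gt0.
  move=> y; rewrite distrC ltr_norml => /andP[_ h].
  by rewrite ltNge (_ : y <= 0)//; lra.
- have xN0 : x != 0 by rewrite gt_eqF.
  pose F (y : R) := (y^-1) ^+ k * expR (- y^-1).
  have dF : is_derive x 1 F (flat k.+2 x - k%:R * flat k.+1 x).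
    have dv : is_derive x 1 (fun y : R => y^-1) (- x ^- 2).
      by apply: (is_derive_eq (is_deriveV xN0 (is_derive_id x (1 : R)))); rewrite /GRing.scale/= mulr1.
    have de : is_derive x 1 (fun y : R => expR (- y^-1)) (expR (- x^-1) * x ^- 2).
      apply: (is_derive_eq (@is_derive1_comp _ (@expR R) (fun y => - y^-1) _ _ _ (is_derive_expR _) (is_deriveN dv))).
      by rewrite opprK.
    have dk : is_derive x 1 (fun y : R => y^-1 ^+ k) (- (k%:R * x^-1 ^+ k.+1)).
      have := @is_deriveX _ _ (fun y : R => y^-1) k x 1 _ dv.
      rewrite (_ : (fun y : R => y^-1) ^+ k = (fun y => y^-1 ^+ k)); last by apply/funext => y; rewrite exprfctE.
      move=> /is_derive_eq; apply; rewrite /GRing.scale/=.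
      case: k {F} => [|k]; first by rewrite !mul0r oppr0.
      by rewrite !exprS !exprVn; field; rewrite expf_neq0.
    apply: (is_derive_eq (is_deriveM dk de)).
    by rewrite /flat x0 /GRing.scale/= !exprVn !exprS; field; rewrite expf_neq0.
  apply: (@near_is_derive F _ x _ x) => // y.
  rewrite ltr_norml => /andP[_ h].
  by rewrite /flat /F (_ : 0 < y) ?exprVn//; lra.
(* At 0, [flatS] and [flat_bound] give a quadratic bound, so the derivative is 0. *)
- rewrite {2 3}/flat ltxx mulr0 subrr.
  apply: (@is_derive_quadratic _ _ (k.+3`!%:R)) => y.
  rewrite subr0 {2}/flat ltxx subr0 flatS.
  rewrite normrM -(real_normK (num_real y)) mulrC expr2 mulrA.
  rewrite ler_wpM2r//; apply: (le_trans (flat_bound _ _)).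
  by rewrite ler_wpM2r// ler_nat leq_pfact.
Qed.

Lemma smooth_flat k : smooth (flat k).
Proof.
apply/smooth_ndiff => n; elim: n k => // n ih k.
apply: (ndiff_der (is_derive_flat k)).
rewrite (_ : (fun _ => _) = (fun x => flat k.+2 x + (- k%:R) * flat k.+1 x)).
  by apply: ndiffD => //; apply: ndiffM => //; exact: ndiff_cst.
by apply/funext => x; rewrite mulNr.
Qed.

Definition hump (a b x : R) : R := flat 0 (x - a) * flat 0 (b - x).

Lemma flat0_itv x : 0 <= flat 0 x < 1.
Proof.
rewrite /flat; case: ltP => x0; last by rewrite lexx ltr01.
by rewrite expr0 invr1 mul1r expR_ge0 expR_lt1 oppr_lt0 invr_gt0.
Qed.

Lemma flat0_gt0 x : 0 < x -> 0 < flat 0 x.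
Proof. by move=> x0; rewrite /flat x0 expr0 invr1 mul1r expR_gt0. Qed.

Lemma smooth_hump a b : smooth (hump a b).
Proof.
apply: smoothM.
  have := @smooth_affine _ 1 (- a) (@smooth_flat 0).
  by under eq_fun do rewrite mul1r.
have := @smooth_affine _ (-1) b (@smooth_flat 0).
by under eq_fun do rewrite mulN1r addrC.
Qed.

Lemma hump_out a b x : ~ (a < x < b) -> hump a b x = 0.
Proof.
move=> h; rewrite /hump /flat !subr_gt0.
by case: (ltP a x) => h1; case: (ltP x b) => h2; rewrite ?mul0r ?mulr0//; case: h; rewrite h1 h2.
Qed.

Lemma hump_itv a b x : 0 <= hump a b x < 1.
Proof.
have /andP[h1 h2] := flat0_itv (x - a); have /andP[h3 h4] := flat0_itv (b - x).
rewrite mulr_ge0//=; apply: (@le_lt_trans _ _ (flat 0 (x - a))) => //.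
by rewrite -[leRHS]mulr1 ler_wpM2l// ltW.
Qed.

Lemma hump_gt0 a b x : a < x -> x < b -> 0 < hump a b x.
Proof. by move=> h1 h2; rewrite mulr_gt0// flat0_gt0 ?subr_gt0. Qed.

(* [plateau a b n] increases to the indicator of ]a, b[ as [n] grows. *)
Definition plateau (a b : R) (n : nat) (x : R) : R := 1 - (1 - hump a b x) ^+ n.

Lemma smooth_plateau a b n : smooth (plateau a b n).
Proof.
apply: smooth_sub; first exact: smooth_cst.
apply: smooth_exp; apply: smooth_sub; [exact: smooth_cst|exact: smooth_hump].
Qed.

Lemma plateau_out a b n x : ~ (a < x < b) -> plateau a b n x = 0.
Proof. by move=> h; rewrite /plateau hump_out// subr0 expr1n subrr. Qed.

Lemma plateau_itv a b n x : 0 <= plateau a b n x <= 1.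
Proof.
have /andP[h1 h2] := hump_itv a b x.
have h3 : 0 <= 1 - hump a b x by rewrite subr_ge0 ltW.
rewrite /plateau subr_ge0 exprn_ile1//=; last by rewrite gerBl.
by rewrite gerBl exprn_ge0.
Qed.

Lemma plateau_cvg a b x : a < x -> x < b -> plateau a b n x @[n --> \oo] --> (1 : R).
Proof.
move=> h1 h2; rewrite -[X in _ --> X]subr0.
apply: cvgB; first exact: cvg_cst.
apply: cvg_expr; have /andP[h3 h4] := hump_itv a b x.
have := hump_gt0 h1 h2 => h5.
by rewrite ger0_norm ?subr_ge0 ?(ltW h4)// gtrBl.
Qed.

End smooth_functions.

(** * Weak derivatives *)

Section weak_derivatives.
Context {R : realType}.
Notation mu := (@lebesgue_measure R).
Implicit Types (u v w f phi : R -> R) (D K A : set R) (n : nat).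

Lemma ae_mono (P Q : R -> Prop) : (forall x, P x -> Q x) ->
  {ae mu, forall x, P x} -> {ae mu, forall x, Q x}.
Proof. exact: (@filterS _ _ (ae_filter_ringOfSetsType mu)). Qed.

Lemma ae_and (P Q : R -> Prop) : {ae mu, forall x, P x} ->
  {ae mu, forall x, Q x} -> {ae mu, forall x, P x /\ Q x}.
Proof. exact: (@filterI _ _ (ae_filter_ringOfSetsType mu)). Qed.

Lemma compact_itv K : compact K ->
  exists2 b : R, 0 < b & forall x, K x -> - b < x < b.
Proof.
move=> /compact_bounded[M [Mr H]]; exists (`|M| + 2); first by rewrite ltr_wpDl.
move=> x Kx; rewrite -ltr_norml; apply: (@le_lt_trans _ _ (`|M| + 1)).
  by apply: H Kx; rewrite (le_lt_trans (ler_norm M))// ltrDl.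
by rewrite ltrD2l ltr1n.
Qed.

Lemma supp_der K u n : closed K -> (forall x, ~ K x -> u x = 0) ->
  forall x, ~ K x -> derive1n n u x = 0.
Proof.
move=> cK u0; elim: n => [//|n ih] x Kx.
have : nbhs x (~` K) by apply: open_nbhs_nbhs; split => //; exact: closed_openC.
move=> [d /= d0 H]; apply: (@derive1_is_derive _ (derive1n n u)).
apply: (@near_is_derive _ (fun _ => 0) _ x 0 d d0) => y xy.
by rewrite ih//; exact: H.
Qed.

Lemma supp_bounded K u : compact K -> continuous u ->
  (forall x, ~ K x -> u x = 0) -> exists2 B : R, 0 <= B & forall x, `|u x| <= B.
Proof.
move=> cK cu u0; have [b b0 Kb] := compact_itv cK.
have [B hB] := @cont_bound _ u (- b) b ltac:(lra) cu.
have B0 : 0 <= B by apply: le_trans (hB 0 _); [exact: normr_ge0|lra].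
exists B => // x; have [/Kb /andP[h1 h2]|/u0 ->] := pselect (K x).
  by apply: hB; rewrite !ltW.
by rewrite normr0.
Qed.

Lemma loc_int_integrable D K w : locally_integrable D w -> compact K ->
  K `<=` D -> mu.-integrable K (EFin \o w).
Proof.
move=> [mw oD iw] cK KD; apply/integrableP; split; last exact: iw.
apply/measurable_EFinP; apply: measurable_funS mw => //; exact: open_measurable.
Qed.

Lemma loc_int_mul_integrable D K w u : locally_integrable D w -> compact K ->
  K `<=` D -> continuous u -> (forall x, ~ K x -> u x = 0) ->
  mu.-integrable D (EFin \o (fun x => w x * u x)).
Proof.
move=> lw cK KD cu u0; have [mw oD iw] := lw.
have mD := open_measurable oD; have mK := compact_measurable cK.
have [B B0 hB] := supp_bounded cK cu u0.
have mwu : measurable_fun D (fun x => w x * u x).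
  apply: measurable_funM => //; apply: measurable_funTS.
  exact: continuous_measurable_fun.
apply/integrableP; split; first exact/measurable_EFinP.
rewrite /=; have -> : (\int[mu]_(x in D) `|(w x * u x)%:E| =
           \int[mu]_(x in K) `|(w x * u x)%:E|)%E.
  rewrite -[in RHS](setIidr KD) integral_mkcondr; apply: eq_integral => x xD.
  rewrite patchE; case: ifPn => //; rewrite notin_setE => xK.
  by rewrite /= u0// mulr0 normr0.
apply: (@le_lt_trans _ _ (\int[mu]_(x in K) (B%:E * `|(w x)%:E|))%E).
  apply: ge0_le_integral => //.
  - apply/measurable_EFinP/measurableT_comp => //; exact: measurable_funS mwu.
  - apply/measurable_EFinP; apply: measurable_funM => //; apply: measurableT_comp => //.
    exact: measurable_funS mw.
  - move=> x Kx; rewrite -EFinM lee_fin normrM mulrC ler_wpM2r//.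
rewrite ge0_integralZl//.
- by rewrite lte_mul_pinfty//; exact: iw.
- apply/measurable_EFinP; apply: measurableT_comp => //; exact: measurable_funS mw.
Qed.

Lemma test_fun_der D phi n : test_fun D phi -> exists K,
  [/\ compact K, K `<=` D, continuous (phi^`(n)) &
      forall x, ~ K x -> derive1n n phi x = 0].
Proof.
move=> [sp [K [cK KD p0]]]; exists K; split => //.
  exact: smooth_continuous.
by apply: supp_der => //; exact: compact_closed cK.
Qed.

Lemma test_integrable D phi n w : locally_integrable D w -> test_fun D phi ->
  mu.-integrable D (EFin \o (fun x => w x * derive1n n phi x)).
Proof.
by move=> lw /(test_fun_der n)[K [cK KD cp p0]]; exact: loc_int_mul_integrable p0.
Qed.

Lemma Rint_dominated D (f_ : nat -> R -> R) f (G : R -> R) : measurable D ->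
  (forall n, measurable_fun D (f_ n)) -> measurable_fun D f ->
  {ae mu, forall x, D x -> f_ n x @[n --> \oo] --> f x} ->
  mu.-integrable D (EFin \o G) ->
  {ae mu, forall x n, D x -> `|f_ n x| <= G x} ->
  (\int[mu]_(x in D) f_ n x)%R @[n --> \oo] --> (\int[mu]_(x in D) f x)%R.
Proof.
move=> mD mf_ mf cf iG fG.
have [] := @dominated_convergence _ _ _ mu D mD (fun n => EFin \o f_ n) (EFin \o f) (EFin \o G).
- by move=> n; apply/measurable_EFinP; exact: mf_.
- exact/measurable_EFinP.
- by apply: ae_mono cf => x H Dx; apply: cvg_EFin (H Dx); exact: nearW.
- exact: iG.
- by apply: ae_mono fG => x H n Dx; rewrite lee_fin; exact: H.
move=> ifi _ H; apply: fine_cvg; rewrite fineK//.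
exact: integrable_fin_num.
Qed.

(** Plateaus are admissible test functions tending to the indicator of ]a, b[; dominated convergence
    gives the integral over [a, b], the two end points being negligible. *)
Lemma test_int_itv D f (a b : R) : locally_integrable D f ->
  (forall phi, test_fun D phi -> \int[mu]_(x in D) (f x * phi x) = 0) ->
  `[a, b] `<=` D -> \int[mu]_(x in `[a, b]) f x = 0.
Proof.
move=> lf H abD.
have cab : compact (`[a, b] : set R) by exact: segment_compact.
have iab := loc_int_integrable lf cab abD.
have mf : measurable_fun `[a, b] f by apply/measurable_EFinP; case/integrableP: iab.
have mD : measurable D by case: lf => _ /open_measurable.
have tp n : test_fun D (plateau a b n).
  split; first exact: smooth_plateau.
  exists `[a, b]; split => // x; rewrite /= in_itv/= => xab; apply: plateau_out.
  by move=> /andP[h1 h2]; apply: xab; rewrite !ltW.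
have int0 n : \int[mu]_(x in `[a, b]) (f x * plateau a b n x) = 0.
  rewrite -(H _ (tp n)) -[in LHS](setIidr abD) Rintegral_mkcondr.
  apply: eq_Rintegral => x xD; rewrite patchE; case: ifPn => //.
  rewrite notin_setE /= in_itv/= => xab; rewrite plateau_out ?mulr0//.
  by move=> /andP[h1 h2]; apply: xab; rewrite !ltW.
have mp n : measurable_fun `[a, b] (plateau a b n).
  apply: measurable_funTS; apply: continuous_measurable_fun.
  by apply: smooth_cont; exact: smooth_plateau.
have := @Rint_dominated `[a, b] (fun n x => f x * plateau a b n x) f (fun x => `|f x|).
move=> /(_ _ _ mf)/wrap[//|n|].
  by apply: measurable_funM => //; exact: mp.
move=> /(_ _ _ _)/wrap[].
- have n1 : mu [set a; b] = 0%E.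
    apply: countable_lebesgue_measure0; exact: finite_set_countable.
  exists [set a; b]; split => //; first by apply: measurableU; exact: measurable_set1.
  move=> x /= /not_implyP[]; rewrite in_itv/= => /andP[ax xb] nc.
  apply: contrapT => /not_orP[/eqP xa /eqP xb'].
  apply: nc; rewrite -[X in _ --> X]mulr1.
  apply: cvgM; first exact: cvg_cst.
  by apply: plateau_cvg; rewrite lt_neqAle ?ax ?xb ?andbT// eq_sym.
- exact: integrable_norm iab.
- apply: aeW => x n _; rewrite normrM.
  have /andP[p0 p1] := plateau_itv a b n x.
  by rewrite (ger0_norm p0) -[leRHS]mulr1 ler_wpM2l.
under eq_fun do rewrite int0.
by move=> /(cvg_lim (@Rhausdorff R)) <-; rewrite lim_cst.
Qed.

(** The integrals of f over [a, y] all vanish, so the primitive of the restricted f is constant on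
    (a, b), and Lebesgue's differentiation theorem gives f = 0 almost everywhere there. *)
Lemma test_ae_itv D f (a b : R) : locally_integrable D f ->
  (forall phi, test_fun D phi -> \int[mu]_(x in D) (f x * phi x) = 0) ->
  `[a, b] `<=` D -> {ae mu, forall x, a < x < b -> f x = 0}.
Proof.
move=> lf H abD.
have cab : compact (`[a, b] : set R) by exact: segment_compact.
have iab := loc_int_integrable lf cab abD.
have ig : mu.-integrable setT (EFin \o (f \_ `[a, b])).
  by rewrite -restrict_EFin; apply/integrable_restrict => //=; rewrite setTI.
have lg : locally_integrable setT (f \_ `[a, b]) by exact: open_integrable_locally openT ig.
have := @FTC1Ny _ _ _ lg; move=> /(_ _)/wrap[y|].
  by apply: integrableS ig => //; exact: measurable_itv.
apply: ae_mono => x [_ +] /andP[ax xb].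
rewrite patchE mem_set; last by rewrite /= in_itv/= !ltW.
move=> <-; apply: derive1_is_derive.
pose d := Num.min (x - a) (b - x).
have d0 : 0 < d by rewrite lt_min !subr_gt0 ax.
apply: (@near_is_derive _ (fun _ => 0) _ x 0 d d0) => y; rewrite lt_min => /andP[h1 h2].
have ay : a < y by move: h1; rewrite ltr_norml => /andP[]; lra.
have yb : y < b by move: h2; rewrite ltr_norml => /andP[]; lra.
rewrite -Rintegral_mkcondr (_ : _ `&` _ = `[a, y]%classic); last first.
  apply/seteqP; split => z /=; rewrite !in_itv/=; first by move=> [-> /andP[->]].
  by move=> /andP[-> zy]; rewrite zy (le_trans zy) ?ltW.
apply/esym/(test_int_itv lf H); apply: subset_trans abD.
by apply: subset_itvl; rewrite bnd_simp ltW.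
Qed.

(** The fundamental lemma of the calculus of variations. Rational intervals inside D cover it;
    [unpickle] enumerates them, so that the exceptional null sets are countably many. *)
Lemma test_ae0 D f : locally_integrable D f ->
  (forall phi, test_fun D phi -> \int[mu]_(x in D) (f x * phi x) = 0) ->
  {ae mu, forall x, D x -> f x = 0}.
Proof.
move=> lf H.
pose P (n : nat) (x : R) := forall p q : rat, unpickle n = Some (p, q) ->
  `[ratr p, ratr q] `<=` D -> ratr p < x < ratr q -> f x = 0.
have : {ae mu, forall x, forall n, P n x}.
  apply: ae_foralln => n; rewrite /P; case: unpickle => [[p q]|]; last exact: aeW.
  have [pqD|pqD] := pselect (`[ratr p, ratr q] `<=` D); last first.
    by apply: aeW => x p' q' [<- <-].
  by apply: ae_mono (test_ae_itv lf H pqD) => x h p' q' [<- <-].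
apply: ae_mono => x HP Dx.
have [_ oD _] := lf; have [d /= d0 hd] : nbhs x D by exact: open_nbhs_nbhs.
have [p] := @rat_in_itvoo R (x - d / 2) x ltac:(rewrite gtrBl divr_gt0//).
rewrite in_itv/= => /andP[p1 p2].
have [q] := @rat_in_itvoo R x (x + d / 2) ltac:(rewrite ltrDl divr_gt0//).
rewrite in_itv/= => /andP[q1 q2].
apply: (HP (pickle (p, q)) p q); rewrite ?pickleK//; last by rewrite p2.
move=> y; rewrite /= in_itv/= => /andP[py yq].
by apply: hd => /=; rewrite ltr_norml; lra.
Qed.

Lemma loc_intB D v w : locally_integrable D v -> locally_integrable D w ->
  locally_integrable D (fun x => v x - w x).
Proof. exact: locally_integrableB. Qed.

Lemma is_wderiv_unique D n u v w : is_wderiv D n u v -> is_wderiv D n u w ->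
  {ae mu, forall x, D x -> v x = w x}.
Proof.
move=> [lu lv Hv] [_ lw Hw].
have mD : measurable D by case: lu => _ /open_measurable.
suff : {ae mu, forall x, D x -> v x - w x = 0}.
  by apply: ae_mono => x H /H /eqP; rewrite subr_eq0 => /eqP.
apply: test_ae0; first exact: loc_intB.
move=> phi tp; under eq_Rintegral do rewrite mulrBl.
rewrite RintegralB//; last 2 first.
- exact: (test_integrable 0 lv tp).
- exact: (test_integrable 0 lw tp).
have := Hv _ tp; rewrite (Hw _ tp) => /mulrI H.
by rewrite H ?subrr// unitrX// unitrN1.
Qed.

Lemma is_wderiv_wderiv D n u w : is_wderiv D n u w ->
  is_wderiv D n u (wderiv D n u).
Proof. by move=> H; rewrite /wderiv; case: xgetP => [v -> //|/(_ w)]. Qed.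

Lemma wderiv_ae D n u w : is_wderiv D n u w ->
  {ae mu, forall x, D x -> wderiv D n u x = w x}.
Proof. by move=> H; exact: is_wderiv_unique (is_wderiv_wderiv H) H. Qed.

Lemma continuous_loc_int D u : open D -> continuous u -> locally_integrable D u.
Proof.
move=> oD cu; split => //.
  by apply: measurable_funTS; exact: continuous_measurable_fun.
move=> K KD cK.
have : mu.-integrable K (EFin \o u).
  by apply: continuous_compact_integrable => //; exact: continuous_subspaceT.
by case/integrableP.
Qed.

Lemma Rint_supp D K f : measurable D -> K `<=` D -> (forall x, ~ K x -> f x = 0) ->
  \int[mu]_(x in D) f x = \int[mu]_(x in K) f x.
Proof.
move=> mD KD f0; rewrite -[in RHS](setIidr KD) Rintegral_mkcondr.
apply: eq_Rintegral => x _; rewrite patchE; case: ifPn => //.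
by rewrite notin_setE => /f0.
Qed.

Lemma smooth_parts (b : R) u v : 0 < b -> smooth u -> smooth v ->
  v (- b) = 0 -> v b = 0 ->
  \int[mu]_(x in `[- b, b]) (u x * derive1 v x) = - \int[mu]_(x in `[- b, b]) (derive1 u x * v x).
Proof.
move=> b0 su sv v1 v2.
have LR w : smooth w -> derivable_oo_LRcontinuous w (- b) b.
  move=> sw; have cw : continuous w := smooth_cont sw.
  split; first by move=> x _; exact: (sw 0%N).
  - exact: cvg_at_right_filter (cw _).
  - exact: cvg_at_left_filter (cw _).
rewrite (@Rintegration_by_parts _ u v (u^`()) (v^`())) ?v1 ?v2.
- by rewrite !mulr0 subrr sub0r.
- lra.
- by apply: continuous_subspaceT; exact: smooth_cont (smooth_der su).
- exact: LR.
- by [].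
- by apply: continuous_subspaceT; exact: smooth_cont (smooth_der sv).
- exact: LR.
- by [].
Qed.

Lemma smooth_wderiv D n u : open D -> smooth u -> is_wderiv D n u (u^`(n)).
Proof.
move=> oD su; split; first by apply: continuous_loc_int => //; exact: smooth_cont.
  by apply: continuous_loc_int => //; exact: smooth_continuous.
move=> phi [sp [K [cK KD p0]]].
have [b b0 Kb] := compact_itv cK.
have clK : closed K by exact: compact_closed cK.
have pn k : forall x, ~ K x -> derive1n k phi x = 0 by exact: supp_der.
have mD := open_measurable oD.
have tob (w : R -> R) k : \int[mu]_(x in D) (w x * derive1n k phi x) =
    \int[mu]_(x in `[- b, b]) (w x * derive1n k phi x).
  have z x : ~ K x -> w x * derive1n k phi x = 0 by move=> /(pn k) ->; rewrite mulr0.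
  rewrite (@Rint_supp D K)// (@Rint_supp `[- b, b] K)//.
  by move=> x /Kb /andP[h1 h2]; rewrite /= in_itv/= !ltW.
rewrite (tob u n) (tob _ 0%N) derive1n0.
(* The outermost derivative of phi is moved onto u and the induction hypothesis is used for u';
   hence the generalisation over u. *)
elim: n u su => [|n ih] u su; first by rewrite expr0 mul1r.
have p1 : derive1n n phi (- b) = 0 by apply: pn => /Kb; rewrite ltxx.
have p2 : derive1n n phi b = 0 by apply: pn => /Kb; rewrite ltxx andbF.
rewrite derive1nS (smooth_parts b0 su (smooth_der_n sp) p1 p2) ih; last exact: smooth_der.
by rewrite exprS mulN1r mulNr -derive1Sn.
Qed.

Lemma loc_intP D f : open D -> measurable_fun D f ->
  (forall K, compact K -> K `<=` D -> mu.-integrable K (EFin \o f)) ->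
  locally_integrable D f.
Proof.
move=> oD mf H; split => // K KD cK.
by have /integrableP[] := H K cK KD.
Qed.

Lemma integrable_scale A (a : R) u : measurable A ->
  mu.-integrable A (EFin \o u) -> mu.-integrable A (EFin \o (fun x => a * u x)).
Proof.
move=> mA iu; have := @integrableZl _ _ _ mu A mA a _ iu.
by congr is_true; congr integrable; apply/funext => x /=; rewrite EFinM.
Qed.

Lemma integrable_lin A (a : R) u v : measurable A ->
  mu.-integrable A (EFin \o u) -> mu.-integrable A (EFin \o v) ->
  mu.-integrable A (EFin \o (fun x => a * u x + v x)).
Proof.
move=> mA iu iv.
have := @integrableD _ _ _ mu A mA _ _ (integrable_scale a mA iu) iv.
by congr is_true; congr integrable; apply/funext => x /=; rewrite EFinD.
Qed.

Lemma loc_int_lin D (a : R) u v : locally_integrable D u ->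
  locally_integrable D v -> locally_integrable D (fun x => a * u x + v x).
Proof.
move=> lu lv; have [mu' oD _] := lu; have [mv _ _] := lv.
apply: loc_intP => //.
  by apply: measurable_funD => //; exact: measurable_funM.
by move=> K cK KD; apply: integrable_lin; [exact: compact_measurable|exact: loc_int_integrable lu cK KD|exact: loc_int_integrable lv cK KD].
Qed.

Lemma is_wderiv_lin D n (a : R) u u' w w' : is_wderiv D n u w ->
  is_wderiv D n u' w' ->
  is_wderiv D n (fun x => a * u x + u' x) (fun x => a * w x + w' x).
Proof.
move=> [lu lw H] [lu' lw' H']; split; [exact: loc_int_lin|exact: loc_int_lin|].
have mD : measurable D by case: lu => _ /open_measurable.
have E (f1 f2 : R -> R) phi k : locally_integrable D f1 -> locally_integrable D f2 ->
    test_fun D phi ->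
    \int[mu]_(x in D) ((a * f1 x + f2 x) * derive1n k phi x) =
    a * \int[mu]_(x in D) (f1 x * derive1n k phi x) +
    \int[mu]_(x in D) (f2 x * derive1n k phi x).
  move=> l1 l2 tp; have i1 := test_integrable k l1 tp; have i2 := test_integrable k l2 tp.
  rewrite -RintegralZl// -RintegralD//.
    by apply: eq_Rintegral => x _; rewrite mulrDl mulrA.
  exact: integrable_scale.
move=> phi tp; rewrite E// H// H'// (E w w' phi 0%N)//.
by rewrite derive1n0; ring.
Qed.

(** Both sides of the defining identity pass to the limit by dominated convergence on the support of
    the test function. In this way weak derivatives of the singular limit come from classical
    derivatives of smooth profiles. *)
Lemma is_wderiv_limit D n (u_ w_ : nat -> R -> R) u w : open D ->
  (forall k, is_wderiv D n (u_ k) (w_ k)) ->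
  measurable_fun D u -> measurable_fun D w ->
  {ae mu, forall x, D x -> u_ k x @[k --> \oo] --> u x} ->
  {ae mu, forall x, D x -> w_ k x @[k --> \oo] --> w x} ->
  (forall K, compact K -> K `<=` D -> exists G : R -> R,
     mu.-integrable K (EFin \o G) /\
     {ae mu, forall x, K x -> (forall k, `|u_ k x| <= G x /\ `|w_ k x| <= G x)}) ->
  is_wderiv D n u w.
Proof.
move=> oD H mu' mw cu cw dom.
have lim (f_ : nat -> R -> R) f : measurable_fun D f ->
    (forall k, locally_integrable D (f_ k)) ->
    {ae mu, forall x, D x -> f_ k x @[k --> \oo] --> f x} ->
    (forall K, compact K -> K `<=` D -> exists G : R -> R,
      mu.-integrable K (EFin \o G) /\
      {ae mu, forall x, K x -> (forall k, `|f_ k x| <= G x)}) ->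
    locally_integrable D f /\ forall phi k, test_fun D phi ->
      (\int[mu]_(x in D) (f_ j x * derive1n k phi x))%R @[j --> \oo] -->
      (\int[mu]_(x in D) (f x * derive1n k phi x))%R.
  move=> mf lf cf domf; split.
    apply: loc_intP => // K cK KD; have [G [iG hG]] := domf K cK KD.
    have mK := compact_measurable cK.
    have := @dominated_convergence _ _ _ mu K mK (fun n => EFin \o f_ n) (EFin \o f) (EFin \o G).
    case.
    - move=> j; apply/measurable_EFinP; have [mfj _ _] := lf j.
      by apply: measurable_funS mfj => //; exact: open_measurable.
    - by apply/measurable_EFinP; apply: measurable_funS mf => //; exact: open_measurable.
    - apply: ae_mono cf => x Hx Kx; apply: cvg_EFin (Hx (KD _ Kx)); exact: nearW.
    - exact: iG.
    - by apply: ae_mono hG => x Hx j Kx; rewrite lee_fin; exact: Hx.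
    - by [].
  move=> phi k tp; have [K [cK KD cp p0]] := test_fun_der k tp.
  have [G [iG hG]] := domf K cK KD.
  have mK := compact_measurable cK.
  have [B B0 hB] := supp_bounded cK cp p0.
  have mD := open_measurable oD.
  have z (f1 : R -> R) x : ~ K x -> f1 x * derive1n k phi x = 0 by move=> /p0 ->; rewrite mulr0.
  rewrite (Rint_supp mD KD (z f)).
  under eq_cvg do rewrite (Rint_supp mD KD (z (f_ _))).
  have mp : measurable_fun K (derive1n k phi).
    by apply: measurable_funTS; exact: continuous_measurable_fun.
  apply: (@Rint_dominated _ _ _ (fun x => B * G x)) => //.
  - move=> j; apply: measurable_funM => //; have [mfj _ _] := lf j.
    by apply: measurable_funS mfj.
  - by apply: measurable_funM => //; apply: measurable_funS mf.
  - apply: ae_mono cf => x Hx Kx; apply: cvgM; [exact: Hx (KD _ Kx)|exact: cvg_cst].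
  - exact: integrable_scale.
  - apply: ae_mono hG => x Hx j Kx; rewrite normrM mulrC.
    by apply: ler_pM => //; exact: Hx.
have [|||lu Hu] := lim u_ u mu'.
- by move=> k; case: (H k).
- exact: cu.
- move=> K cK KD; have [G [iG hG]] := dom K cK KD; exists G; split => //.
  by apply: ae_mono hG => x Hx Kx k; have [] := Hx Kx k.
have [|||lw Hw] := lim w_ w mw.
- by move=> k; case: (H k).
- exact: cw.
- move=> K cK KD; have [G [iG hG]] := dom K cK KD; exists G; split => //.
  by apply: ae_mono hG => x Hx Kx k; have [] := Hx Kx k.
split=> // phi tp.
have h1 := Hu phi n tp; have := Hw phi 0%N tp.
rewrite derive1n0 => h2.
have h3 : ((-1) ^+ n * \int[mu]_(x in D) (w_ j x * phi x))%R @[j --> \oo] -->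
   ((-1) ^+ n * \int[mu]_(x in D) (w x * phi x))%R.
  by apply: cvgM; [exact: cvg_cst|exact: h2].
have E j : \int[mu]_(x in D) (u_ j x * derive1n n phi x) =
    (-1) ^+ n * \int[mu]_(x in D) (w_ j x * phi x).
  by have [_ _ ->] := H j.
move: h1; under eq_cvg do rewrite E.
by move=> h1; exact: (cvg_unique (@Rhausdorff R) h1 h3).
Qed.

End weak_derivatives.

(** * Norms on the period cell *)

Section norms.
Context {R : realType}.
Notation mu := (@lebesgue_measure R).
Implicit Types (u v w f : R -> R) (A D : set R) (p : R).

Lemma Lp_norm_int A p u : 0 < p ->
  Lp_norm A p u = ((\int[mu]_(x in A) (`|u x| `^ p)%:E) `^ p^-1)%E.
Proof.
move=> p0; rewrite /Lp_norm unlock.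
suff -> : (\int[mu]_(x in A) (`|u x| `^ p)%:E)%E =
    (\int[mu]_x `|(EFin \o (u \_ A)) x| `^ p)%E by [].
rewrite [LHS]integral_mkcond; apply: eq_integral => x _.
rewrite /= !patchE; case: ifPn => // _.
by rewrite normr0 powR0// gt_eqF.
Qed.

Lemma measurable_powR_norm A p u : measurable_fun A u ->
  measurable_fun A (fun x => `|u x| `^ p).
Proof.
move=> mu'; apply: (@measurableT_comp _ _ _ _ _ _ (fun z : R => z `^ p)) => //.
exact: measurableT_comp.
Qed.

Lemma Lp_norm_ae A p u v : 0 < p -> measurable A -> measurable_fun A u ->
  measurable_fun A v -> {ae mu, forall x, A x -> u x = v x} ->
  Lp_norm A p u = Lp_norm A p v.
Proof.
move=> p0 mA mu' mv uv; rewrite (Lp_norm_int _ _ p0) (Lp_norm_int _ _ p0).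
suff -> : (\int[mu]_(x in A) (`|u x| `^ p)%:E)%E =
    (\int[mu]_(x in A) (`|v x| `^ p)%:E)%E by [].
apply: ge0_ae_eq_integral => //.
- by apply/measurable_EFinP; exact: measurable_powR_norm.
- by apply/measurable_EFinP; exact: measurable_powR_norm.
- by apply: ae_mono uv => x H Ax; rewrite H.
Qed.

Lemma dominated_Lp A p u (G : R -> R) : 0 < p -> measurable A ->
  measurable_fun A u -> mu.-integrable A (EFin \o G) ->
  {ae mu, forall x, A x -> `|u x| `^ p <= G x} -> Lp A p u.
Proof.
move=> p0 mA mu' iG uG; split => //; rewrite (Lp_norm_int _ _ p0).
apply: poweR_lty; have /integrableP[mG iG'] := iG.
apply: le_lt_trans iG'; apply: ae_ge0_le_integral => //.
- by apply/measurable_EFinP; exact: measurable_powR_norm.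
- exact: measurableT_comp.
- by apply: ae_mono uG => x H /H h; rewrite /= lee_fin (le_trans h)// ler_norm.
Qed.

Lemma cvg_powR0 p (a_ : nat -> R) : 0 < p -> a_ n @[n --> \oo] --> (0 : R) ->
  (`|a_ n| `^ p)%R @[n --> \oo] --> (0 : R).
Proof.
move=> p0 /cvgrPdist_lt H; apply/cvgrPdist_lt => e e0.
have := H (e `^ p^-1) (powR_gt0 _ e0); apply: filterS => n.
rewrite !sub0r !normrN (ger0_norm (powR_ge0 _ _)) => h.
rewrite -[ltRHS](powRr1 (ltW e0)) -(mulVf (lt0r_neq0 p0)) powRrM.
by apply: gt0_ltr_powR => //; rewrite nnegrE ?powR_ge0.
Qed.

Lemma Lp_norm_cvg0 A p (u_ : nat -> R -> R) (G : R -> R) : 0 < p ->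
  measurable A -> (forall n, measurable_fun A (u_ n)) ->
  {ae mu, forall x, A x -> u_ n x @[n --> \oo] --> (0 : R)} ->
  mu.-integrable A (EFin \o G) ->
  {ae mu, forall x, A x -> forall n, `|u_ n x| `^ p <= G x} ->
  Lp_norm A p (u_ n) @[n --> \oo] --> 0%E.
Proof.
move=> p0 mA mu_ cu iG uG.
have [|||||_ _ h] := @dominated_convergence _ _ _ mu A mA
  (fun n x => (`|u_ n x| `^ p)%:E) (cst 0%E) (EFin \o G).
- by move=> n; apply/measurable_EFinP; exact: measurable_powR_norm.
- exact: measurable_cst.
- apply: ae_mono cu => x Hx Ax; apply: cvg_EFin; first exact: nearW.
  by apply: cvg_powR0 => //; exact: Hx.
- exact: iG.
- by apply: ae_mono uG => x Hx n Ax; rewrite /= lee_fin ger0_norm ?powR_ge0// Hx.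
pose I n := (\int[mu]_(x in A) (`|u_ n x| `^ p)%:E)%E.
have {}h : I n @[n --> \oo] --> 0%E.
  by move: h; rewrite integral0.
have [h1 h2] : (\forall n \near \oo, I n \is a fin_num) /\
    fine (I n) @[n --> \oo] --> (0 : R) by exact/fine_cvgP.
have h3 : ((`|fine (I n)| `^ p^-1)%:E)%E @[n --> \oo] --> 0%E.
  apply: cvg_EFin; first exact: nearW.
  by apply: cvg_powR0 h2; rewrite invr_gt0.
apply: cvg_trans h3; apply: near_eq_cvg.
apply: filterS h1 => n fn.
rewrite (Lp_norm_int _ _ p0) -/(I n) -(fineK fn) poweR_EFin /= ger0_norm//.
by apply: fine_ge0; apply: integral_ge0 => x _; rewrite lee_fin powR_ge0.
Qed.

(** A nonzero value persists on a ball, which has positive measure. *)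
Lemma ae_cont0 f : continuous f -> {ae mu, forall x, f x = 0} -> forall x, f x = 0.
Proof.
move=> cf [N [mN N0 fN]] x; apply: contrapT => /eqP fx.
have [d d0 H] := @cont_eps _ f x `|f x| (cf x) ltac:(by rewrite normr_gt0).
have : (mu (ball x d) <= mu N)%E.
  apply: le_measure; rewrite ?inE//; first exact: measurable_ball.
  apply: subset_trans fN => y /= /H h fy; move: h; rewrite fy subr0.
  by rewrite ltxx.
by rewrite N0 lebesgue_measure_ball ?(ltW d0)// lee_fin leNgt mulrn_wgt0.
Qed.

Lemma der_FTC f (F : R -> R) (a b : R) : a < b -> continuous f ->
  (forall x : R, a <= x <= b -> is_derive x 1 F (f x)) ->
  (\int[mu]_(x in `[a, b]) (f x)%:E = (F b - F a)%:E)%E.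
Proof.
move=> ab cf dF.
have cF (x : R) : a <= x <= b -> {for x, continuous F}.
  move=> /dF h; apply/differentiable_continuous/derivable1_diffP.
  exact: (@ex_derive _ _ _ _ _ _ _ h).
rewrite (@continuous_FTC2 _ f F)//.
- exact: continuous_subspaceT.
- split.
  + move=> x; rewrite in_itv/= => /andP[h1 h2].
    by apply: (@ex_derive _ _ _ _ _ _ _ (dF x _)); rewrite !ltW.
  + by apply: cvg_at_right_filter; apply: cF; rewrite lexx ltW.
  + by apply: cvg_at_left_filter; apply: cF; rewrite lexx ltW.
- move=> x; rewrite in_itv/= => /andP[h1 h2].
  by apply: derive1_is_derive; apply: dF; rewrite !ltW.
Qed.

Section cell.
Variable (k0 : R).
Hypothesis k00 : 0 < k0.
Let L := pi / k0.

Let L0 : 0 < L.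
Proof. by rewrite divr_gt0// pi_gt0. Qed.

Lemma cellE : cell k0 = `]- L, L[%classic.
Proof. by apply/seteqP; split => x; [move=> /set_mem|move=> h; exact: mem_set]. Qed.

Lemma measurable_cell : measurable (cell k0).
Proof. by rewrite cellE; exact: measurable_itv. Qed.

Lemma cell_FTC f (F : R -> R) : continuous f ->
  (forall x : R, `|x| <= L -> is_derive x 1 F (f x)) ->
  (\int[mu]_(x in cell k0) (f x)%:E = (F L - F (- L))%:E)%E.
Proof.
move=> cf dF; have L0' := L0.
have mf (i : interval R) : measurable_fun [set` i] f.
  by apply: measurable_funTS; exact: continuous_measurable_fun.
have LL : - L < L by lra.
have dF' (x : R) : - L <= x <= L -> is_derive x 1 F (f x) by rewrite -ler_norml; exact: dF.
apply: etrans (der_FTC LL cf dF').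
rewrite cellE (@integral_itv_bndo_bndc _ (BRight (- L)) L); last by apply/measurable_EFinP; exact: mf.
by rewrite (@integral_itv_obnd_cbnd _ (- L) (BRight L))//; apply/measurable_EFinP; exact: mf.
Qed.

Lemma X_norm_ge u w : is_wderiv setT 1 u w ->
  (Lp_norm (cell k0) 2 w <= X_norm k0 u)%E.
Proof.
move=> uw.
rewrite -(@Lp_norm_ae _ _ (wderiv setT 1 u))//; last 4 first.
- exact: measurable_cell.
- have [_ [m _ _] _] := is_wderiv_wderiv uw; exact: measurable_funS m.
- have [_ [m _ _] _] := uw; exact: measurable_funS m.
- by apply: ae_mono (wderiv_ae uw) => x H _; exact: H.
rewrite /X_norm /W_norm !big_ord_recl big_ord0 /= adde0.
by rewrite addeCA leeDl// adde_ge0// Lnorm_ge0.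
Qed.

(* AM-GM replaces Cauchy-Schwarz in this one-dimensional Sobolev inequality. *)
Lemma X_norm_sup u (e : R) : smooth u -> mean_zero k0 u -> 0 < e ->
  (X_norm k0 u <= e%:E)%E -> forall x, - L <= x <= L -> `|u x| <= (L + 1) * e.
Proof.
move=> su mz e0 ue.
have cu := smooth_cont su; have cu' := smooth_cont (smooth_der su).
have L0' := L0.
have [U [dU U0]] := der_primitive L cu.
have : (\int[mu]_(x in cell k0) (u x)%:E = (U L - U (- L))%:E)%E by exact: cell_FTC.
have := mz; rewrite /mean_zero /Rintegral => + E; rewrite E /= => UL.
have [z [z1 z2 uz]] := @der_mvt _ U u (- L) L ltac:(lra)
  (fun x h => dU x ltac:(by rewrite ler_norml)).
have {}uz : u z = 0.
  move: uz; rewrite UL => /esym/eqP; rewrite mulf_eq0 => /orP[/eqP//|].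
  by rewrite opprK gt_eqF// addr_gt0.
have cq : continuous (fun x => derive1 u x ^+ 2).
  move=> x; apply: (@continuous_comp _ _ _ (derive1 u) (fun z : R => z ^+ 2)); first exact: cu'.
  exact: exprn_continuous.
have [J [dJ J0]] := der_primitive L cq.
have JL : J L - J (- L) <= e ^+ 2.
  have := X_norm_ge (smooth_wderiv 1 openT su) => /le_trans/(_ ue).
  rewrite (Lp_norm_int _ _ (ltr0n R 2)).
  have -> : (\int[mu]_(x in cell k0) (`|derive1n 1 u x| `^ 2)%:E =
     \int[mu]_(x in cell k0) (derive1 u x ^+ 2)%:E)%E.
    by apply: eq_integral => x _; rewrite powR_mulrn// real_normK// num_real.
  rewrite (cell_FTC cq dJ) poweR_EFin lee_fin => h.
  have JJ : 0 <= J L - J (- L).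
    rewrite subr_ge0; apply: (@der_le _ J (fun x => derive1 u x ^+ 2)) => [|x|x _].
    - lra.
    - by rewrite -ler_norml => /dJ.
    - exact: sqr_ge0.
  rewrite powR12_sqrt// in h.
  by rewrite -[leLHS]sqr_sqrtr// lerXn2r// nnegrE// ltW.
have mono (sg : R) : sg ^+ 2 = 1 -> forall x y, - L <= x -> x <= y -> y <= L ->
    sg * (u x - u y) <= (L + 1) * e.
  move=> sg1 x y Lx xy yL.
  (* As J is a primitive of u'^2, H' = (sg u' + e)^2 / (2 e) >= 0; this is the AM-GM inequality with
     weight e. *)
  pose H t := sg * u t + (e / 2 * t + J t / (2 * e)).
  have dH t : x <= t <= y -> is_derive t 1 H
      ((derive1 u t * sg + e) ^+ 2 / (2 * e)).
    move=> /andP[xt ty].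
    have h1 : is_derive t 1 u (derive1 u t) by apply: derivable_is_derive; exact: (su 0%N).
    have h2 : is_derive t 1 J (derive1 u t ^+ 2) by apply: dJ; rewrite ler_norml; lra.
    apply: is_derive_eq; rewrite /GRing.scale/=.
    rewrite sqrrD exprMn sg1; field; rewrite gt_eqF//.
  have : H x <= H y.
    apply: (der_le xy dH) => t _; rewrite divr_ge0 ?sqr_ge0// mulr_ge0// ltW//.
  have Jxy : J y - J x <= e ^+ 2.
    have : J (- L) <= J x.
      apply: (@der_le _ J (fun x => derive1 u x ^+ 2)) => // [t h|t _].
        by apply: dJ; rewrite ler_norml; lra.
      exact: sqr_ge0.
    have : J y <= J L.
      apply: (@der_le _ J (fun x => derive1 u x ^+ 2)) => // [t h|t _].
        by apply: dJ; rewrite ler_norml; lra.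
      exact: sqr_ge0.
    lra.
  have : (J y - J x) / (2 * e) <= e / 2.
    rewrite ler_pdivrMr ?mulr_gt0//; lra.
  have : e / 2 * (y - x) <= e / 2 * (2 * L) by rewrite ler_wpM2l//; lra.
  rewrite /H; lra.
have ab x y : - L <= x -> x <= y -> y <= L -> `|u x - u y| <= (L + 1) * e.
  move=> h1 h2 h3; rewrite ler_norml; apply/andP; split.
    by have := mono (- 1) ltac:(by rewrite sqrrN expr1n) x y h1 h2 h3; lra.
  by have := mono 1 ltac:(by rewrite expr1n) x y h1 h2 h3; lra.
move=> x /andP[x1 x2]; have [xz|/ltW zx] := leP x z.
  by have := ab x z x1 xz (ltW z2); rewrite uz subr0.
by have := ab z x (ltW z1) zx x2; rewrite uz sub0r normrN.
Qed.

(** Smoothness upgrades the equation from almost everywhere to everywhere, by continuity of both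
    sides. *)
Lemma solution_profile g v (M : R) : smooth v -> solution g k0 v M ->
  profile g L M (M * Kmean k0 v) v (v^`()).
Proof.
move=> sv [[[[pv _] cv ev mv] v1] Fv].
have dv (x : R) : is_derive x 1 v (derive1 v x).
  by apply: derivable_is_derive; exact: (sv 0%N).
have dv1 (x : R) : is_derive x 1 (derive1 v) (derive1n 2 v x).
  by apply: derivable_is_derive; exact: (sv 1%N).
have E : forall x, derive1n 2 v x - rhs g M (M * Kmean k0 v) (v x) = 0.
  apply: ae_cont0.
    move=> x; apply: cvgB; first exact: (smooth_continuous (n:=2) sv).
    apply: (@der_continuous _ (fun x => rhs g M (M * Kmean k0 v) (v x))
      (fun x => (g - M * dnonlin (v x)) * derive1 v x)) => y.
    exact: (@is_derive1_comp _ (rhs g M (M * Kmean k0 v)) v _ _ _ (is_derive_rhs _ _ _ (v1 y)) (dv y)).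
  apply: ae_mono (ae_and Fv (wderiv_ae (smooth_wderiv 2 openT sv))) => x.
  rewrite /F /rhs => -[h1 h2]; rewrite -(h2 I); lra.
have per x : v (x + 2 * L) = v x by rewrite -(pv x) /L mulrA.
split => //.
- by move=> x; have /eqP := E x; rewrite subr_eq0 => /eqP <-.
have [W [dW W0]] := der_primitive L cv.
exists W; split => //.
  by move=> x /andP[x0 xL]; apply: dW; rewrite ger0_norm.
have := cell_FTC cv dW; have := mv; rewrite /mean_zero /Rintegral => + H.
rewrite H /= => WL.
(* W is odd because v is even, so the vanishing integral over the cell, that is W L = W (- L), gives
   W L = 0. *)
pose G x := W x + W (- x).
have L0' := L0.
have dG (x : R) : 0 <= x <= L -> is_derive x 1 G 0.
  move=> /andP[x0 xL].
  have h1 : is_derive x 1 W (v x) by apply: dW; rewrite ger0_norm.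
  have h2 : is_derive (- x) 1 W (v (- x)) by apply: dW; rewrite normrN ger0_norm.
  have h3 : is_derive x 1 (fun y => W (- y)) (- v x).
    apply: (is_derive_eq (@is_derive1_comp _ W (fun y => - y) x _ (-1) h2 _)).
    by rewrite ev; ring.
  by apply: (is_derive_eq (is_deriveD h1 h3)); rewrite subrr.
have := @der_cst _ G (fun=> 0) 0 L (ltW L0) dG (fun _ _ => erefl).
by rewrite /G oppr0 W0; lra.
Qed.

End cell.
End norms.

(** * One-bump profiles along the branch *)

Section symmetry.
Context {R : realType}.
Implicit Types (u v : R -> R) (x L : R).

Lemma per_int u (T : R) (j : int) x : (forall x, u (x + T) = u x) ->
  u (x + T * j%:~R) = u x.
Proof.
move=> pu; have pn n y : u (y + T * n%:R) = u y.
  by rewrite mulr_natr; exact: (periodicn pu).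
case: j => n; first exact: pn.
rewrite NegzE mulrNz mulrN.
by rewrite -[in RHS](subrK (T * n.+1%:R) x) pn.
Qed.

(** Folding into a half period: facts on [0, L] about even or odd functions of period 2 L are
    transferred to the whole line through y, the sign sg and the period count j. *)
Lemma fold_half L x : 0 < L -> exists y sg (j : int),
  [/\ 0 <= y <= L, sg = 1 \/ sg = - 1 & x = sg * y + 2 * L * j%:~R].
Proof.
move=> L0.
pose j := Num.floor ((x + L) / (2 * L)).
have L2 : 0 < 2 * L by rewrite mulr_gt0.
have h1 : j%:~R * (2 * L) <= x + L by rewrite -ler_pdivlMr// floor_le_tmp.
have h2 : x + L < (j%:~R + 1) * (2 * L).
  by rewrite -ltr_pdivrMr// -intrD1 floorD1_gt.
pose z := x - 2 * L * j%:~R.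
have [z0|z0] := leP 0 z.
  exists z, 1, j; split; [|by left|rewrite /z; ring].
  by rewrite z0 /= /z; lra.
exists (- z), (- 1), j; split; [|by right|rewrite /z; ring].
by rewrite oppr_ge0 (ltW z0) /= /z; lra.
Qed.

Lemma even_per_fold L u y sg (j : int) : (forall x, u (- x) = u x) ->
  (forall x, u (x + 2 * L) = u x) -> sg = 1 \/ sg = - 1 ->
  u (sg * y + 2 * L * j%:~R) = u y.
Proof.
by move=> ue up sgE; rewrite (per_int _ _ up); case: sgE => ->; rewrite ?mulN1r ?ue ?mul1r.
Qed.

Lemma even_per_eq L u v : 0 < L -> (forall x, u (- x) = u x) ->
  (forall x, v (- x) = v x) -> (forall x, u (x + 2 * L) = u x) ->
  (forall x, v (x + 2 * L) = v x) -> (forall x, 0 <= x <= L -> u x = v x) -> u = v.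
Proof.
move=> L0 eu ev pu pv uv; apply/funext => x.
have [y [sg [j [yL sgE ->]]]] := fold_half x L0.
by rewrite !even_per_fold//; exact: uv.
Qed.

End symmetry.

(** * The one-bump property along the branch *)

Section branch.
Context {R : realType}.
Notation mu := (@lebesgue_measure R).
Variables (g k0 : R).
Hypotheses (g0 : 0 < g) (k00 : 0 < k0).
Variables (v : R -> R -> R) (M : R -> R).
Hypothesis br : global_branch g k0 v M.
Let L := pi / k0.

Let kL : k0 * L = pi.
Proof. by rewrite /L mulrCA divff ?mulr1// gt_eqF. Qed.

Let L0 : 0 < L := half_period_gt0 k00 kL.

Definition branch_c (s : R) := M s * Kmean k0 (v s).

Let w1 s := derive1 (v s).

Lemma branch_profile s : profile g L (M s) (branch_c s) (v s) (derive1 (v s)).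
Proof. apply: (solution_profile k00); [exact: (global_smooth br)|exact: (global_solution br)]. Qed.
Let pr := branch_profile.

Lemma mean_zero_sub u w : continuous u -> continuous w -> mean_zero k0 u ->
  mean_zero k0 w -> mean_zero k0 (fun x => u x - w x).
Proof.
move=> cu cw mu' mw; rewrite /mean_zero RintegralB//; last 3 first.
- exact: measurable_cell.
- apply: (@integrableS _ _ _ mu `[- L, L]) => //; first exact: measurable_cell.
    by rewrite cellE; exact: subset_itv_oo_cc.
  by apply: continuous_compact_integrable; [exact: segment_compact|exact: continuous_subspaceT].
- apply: (@integrableS _ _ _ mu `[- L, L]) => //; first exact: measurable_cell.
    by rewrite cellE; exact: subset_itv_oo_cc.
  by apply: continuous_compact_integrable; [exact: segment_compact|exact: continuous_subspaceT].
by rewrite mu' mw subrr.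
Qed.

Let mean0 s : mean_zero k0 (v s).
Proof. by have [[[]]] := global_solution br s. Qed.

Lemma X_norm_ge0 u : (0 <= X_norm k0 u)%E.
Proof. by rewrite /X_norm /W_norm sume_ge0// => i _; exact: Lnorm_ge0. Qed.

Lemma ereal_cvg0_le (T : Type) (F : set_system T) (FF : Filter F)
    (f : T -> \bar R) (e : R) : f @ F --> 0%E -> 0 < e ->
  \forall x \near F, (f x <= e%:E)%E.
Proof.
move=> /fine_cvgP[ff /cvgrPdist_lt/(_ e)] H e0.
have {}H := H e0; apply: filterS2 ff H => x fx.
by rewrite sub0r normrN => h; rewrite -(fineK fx) lee_fin (le_trans (ler_norm _))// ltW.
Qed.

(** The X-norm is converted by [X_norm_sup], whose constant is L + 1; sup-norm continuity on a half
    period is what the perturbation lemmas ask for. *)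
Lemma branch_cont s0 (e : R) : 0 < e -> exists2 d : R, 0 < d &
  forall s, `|s - s0| < d ->
    (forall x, 0 <= x <= L -> `|v s x - v s0 x| <= e) /\ `|M s - M s0| <= e.
Proof.
move=> e0; have L0' := L0.
pose e' := e / (L + 1).
have e'0 : 0 < e' by rewrite divr_gt0//; lra.
have e'e : e' <= e by rewrite ler_pdivrMr; [nra|lra].
have := @ereal_cvg0_le _ _ _ _ e' (global_continuous br s0) e'0.
move=> [d /= d0 H]; exists d => // s ss0.
have := H s; rewrite /= distrC => /(_ ss0); rewrite /XR_norm => h.
split.
  move=> x /andP[x0 xL].
  have -> : e = (L + 1) * e' by rewrite /e' mulrCA divff ?mulr1//; lra.
  apply: (@X_norm_sup _ k0 k00 (fun x => v s x - v s0 x) e').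
  - by apply: smooth_sub; exact: (global_smooth br).
  - apply: mean_zero_sub; [exact: prof_cont (pr s)|exact: prof_cont (pr s0)|exact: mean0|exact: mean0].
  - exact: e'0.
  - by apply: le_trans h; rewrite leeDl.
  - by rewrite -/L xL andbT; lra.
rewrite -lee_fin; apply: (@le_trans _ _ e'%:E); last by rewrite lee_fin.
by apply: le_trans h; rewrite leeDr// X_norm_ge0.
Qed.

Lemma branch_near0 : exists C d : R, [/\ 0 <= C, 0 < d, M 0 = Mstar g k0,
  (forall x, 0 <= x <= L -> v 0 x = 0) &
  forall s, 0 < `|s| -> `|s| < d ->
    forall x, 0 <= x <= L -> `|v s x - s * cos (k0 * x)| <= C * s ^+ 2].
Proof.
have L0' := L0.
have [eps [vl [Ml [lb [d0 /= d00 H0]]]]] := global_local br.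
have [C [d1 /= d10 H1]] := local_v lb.
have [C' [d2 /= d20 H2]] := local_M lb.
have H00 := H0 0 ltac:(by rewrite /= subrr normr0).
have sm s : smooth (fun x => v s x - s * cos (k0 * x)).
  apply: smooth_sub; first exact: (global_smooth br).
  apply: smoothM; first exact: smooth_cst.
  have := @smooth_affine _ (@cos R) k0 0 (@smooth_cos R).
  by under eq_fun do rewrite addr0.
have ccos s : continuous (fun x => s * cos (k0 * x)).
  have := smooth_cont (@smooth_affine _ (@cos R) k0 0 (@smooth_cos R)) => cc x.
  apply: cvgM; first exact: cvg_cst.
  by have := cc x; under eq_fun do rewrite addr0.
have mz s : mean_zero k0 (fun x => v s x - s * cos (k0 * x)).
  apply: mean_zero_sub => //; first exact: prof_cont (pr s).
  have dF (x : R) : `|x| <= pi / k0 ->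
      is_derive x 1 (fun x => s * (sin (k0 * x) / k0)) (s * cos (k0 * x)).
    move=> _; apply: is_derive_eq; rewrite /GRing.scale/=.
    by field; rewrite gt_eqF.
  rewrite /mean_zero /Rintegral (cell_FTC k00 (@ccos s) dF).
  by rewrite -/L mulrN sinN kL sinpi oppr0 mul0r mulr0 subrr.
have bd s (e : R) : 0 < e -> (X_norm k0 (fun x => v s x - s * cos (k0 * x))%R <= e%:E)%E ->
    forall x, 0 <= x <= L -> `|v s x - s * cos (k0 * x)| <= (L + 1) * e.
  move=> e0 h x /andP[x0 xL].
  apply: (@X_norm_sup _ k0 k00 (fun x => v s x - s * cos (k0 * x)) e) => //.
  by rewrite -/L xL andbT; lra.
(* [bd] needs a positive radius and C may be negative or 0, hence |C| + 1 together with s <> 0. *)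
exists ((L + 1) * (`|C| + 1)), (Num.min d0 d1); split.
- by apply: mulr_ge0; [lra|exact: addr_ge0].
- by rewrite lt_min d00 d10.
- have := H2 0 ltac:(by rewrite /= subrr normr0).
  rewrite H00.2 !expr0n/= normr0 !mulr0 subr0 expr0n/= mulr0 => h.
  by apply/eqP; rewrite -subr_eq0 -normr_le0.
- move=> x xL; apply/eqP; rewrite -normr_le0; apply/ler_addgt0Pl => e e0.
  rewrite addr0.
  have := @bd 0 (e / (L + 1)) _ _ x xL; rewrite mul0r subr0.
  rewrite mulrCA divff ?mulr1; last lra.
  apply; first by rewrite divr_gt0//; lra.
  have := H1 0 ltac:(by rewrite /= subrr normr0).
  rewrite H00.1 => /le_trans; apply.
  by rewrite lee_fin expr0n/= mulr0 divr_ge0//; lra.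
- move=> s s0; rewrite lt_min => /andP[sd0 sd1] x xL.
  rewrite -mulrA; apply: bd => //.
    by rewrite mulr_gt0 ?ltr_wpDl// exprn_even_gt0//= -normr_gt0.
  have [-> _] := H0 s ltac:(by rewrite /= sub0r normrN).
  apply: (le_trans (H1 s _)); first by rewrite /= sub0r normrN.
  rewrite lee_fin ler_wpM2r ?sqr_ge0//.
  by apply: (le_trans (ler_norm C)); rewrite lerDl.
Qed.

Let A s := onebump L (derive1 (v s)).

Let A_near0 : exists2 d : R, 0 < d & forall s, 0 < s -> s <= d -> A s.
Proof.
have [C [d [C0 d0 M0 v0 H]]] := branch_near0.
have [r r0 Hr] := bump_near0 g0 k00 kL C0.
have [d1 d10 H1] := branch_cont 0 r0.
have [d2 [d20 h1 h2 h3]] := min3 (divr_gt0 d0 (ltr0n R 2)) (divr_gt0 d10 (ltr0n R 2)) r0.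
exists d2 => // s s0 sd.
apply: (Hr s _ _ _ _ s0 _ _ (pr s)); first by lra.
  have [|_] := H1 s; first by rewrite subr0 gtr0_norm//; lra.
  by rewrite M0.
by apply: H; rewrite gtr0_norm//; lra.
Qed.

Let A_open s : A s -> exists2 d : R, 0 < d & forall t, `|t - s| < d -> A t.
Proof.
move=> As; have [e e0 He] := bump_open g0 L0 (pr s) As.
have [d d0 Hd] := branch_cont s e0; exists d => // t ts.
have [h1 h2] := Hd t ts; apply: (He _ _ _ _ (pr t)).
  by move=> x xL; rewrite distrC; exact: h1.
by rewrite distrC.
Qed.

(** Uniform limits of decreasing profiles are nonincreasing, so v' <= 0 at s, and [bump_closed]
    makes this strict unless v s vanishes identically. *)
Let A_closed s : 0 < s -> (forall t, 0 < t -> t < s -> A t) -> ~ A s ->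
  forall x, v s x = 0.
Proof.
move=> s0 H nA; apply: contrapT => /existsNP nz; apply: nA.
apply: (bump_closed g0 L0 (pr s)) nz => x /andP[x0 xL].
have mono a b : 0 <= a -> a <= b -> b <= L -> v s b <= v s a.
  move=> a0 ab bL; apply/ler_addgt0Pl => e e0.
  have [d d0 Hd] := branch_cont s (divr_gt0 e0 (ltr0n R 2)).
  pose t := s - Num.min (d / 2) (s / 2).
  have [t0 ts tsd] : [/\ 0 < t, t < s & `|t - s| < d].
    rewrite /t; have : 0 < Num.min (d / 2) (s / 2) by rewrite lt_min; lra.
    have : Num.min (d / 2) (s / 2) <= d / 2 by rewrite ge_min lexx.
    have : Num.min (d / 2) (s / 2) <= s / 2 by rewrite ge_min lexx orbT.
    move: (Num.min _ _) => u h1 h2 h3.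
    by split; [lra|lra|rewrite distrC gtr0_norm; lra].
  have [h1 _] := Hd t tsd.
  have := bump_decr (pr t) (H t t0 ts) a0 ab bL.
  have := h1 a ltac:(by rewrite a0 (le_trans ab)).
  have := h1 b ltac:(by rewrite bL (le_trans a0)).
  by rewrite !ler_norml => /andP[? ?] /andP[? ?]; lra.
rewrite leNgt; apply/negP => w0.
have [d d0 hd] := cont_eps (@prof_cont1 _ _ _ _ _ _ _ (pr s) x) w0.
pose y := x + Num.min (d / 2) ((L - x) / 2).
have [xy yL yd] : [/\ x < y, y <= L & y - x < d].
  rewrite /y; have : 0 < Num.min (d / 2) ((L - x) / 2) by rewrite lt_min; lra.
  have : Num.min (d / 2) ((L - x) / 2) <= d / 2 by rewrite ge_min lexx.
  have : Num.min (d / 2) ((L - x) / 2) <= (L - x) / 2 by rewrite ge_min lexx orbT.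
  by move: (Num.min _ _) => u h1 h2 h3; split; lra.
have : v s x < v s y.
  apply: (der_lt xy (fun z _ => prof_d1 (pr s) z)) => z /andP[xz zy].
  have /hd : `|x - z| < d by rewrite distrC gtr0_norm; lra.
  by rewrite ltr_norml => /andP[_]; lra.
by have := mono x y (ltW x0) (ltW xy) yL; lra.
Qed.

(** Just before s, [bump_sturm] gives M t f'(v t x) = g + k0^2 at some x, f = [nonlin]. As v t tends
    to 0 uniformly, f'(v t x) tends to 1 / 4 wherever x lies. *)
Let M_zero s : 0 < s -> (forall t, 0 < t -> t < s -> A t) ->
  (forall x, v s x = 0) -> M s = Mstar g k0.
Proof.
move=> s0 H vs.
have key (e : R) : 0 < e -> `|M s / 4 - (g + k0 ^+ 2)| <= e.
  move=> e0.
  pose K := 3 * (`|M s| + 1) + 1.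
  have K0 : 0 < K by rewrite /K ltr_wpDl// mulr_ge0// addr_ge0.
  have [e1 [e10 h1 h2 h3]] := min3 (divr_gt0 e0 K0) (ltr01 : (0 : R) < 1) (divr_gt0 (ltr01 : (0 : R) < 1) (ltr0n R 2)).
  have [d d0 Hd] := branch_cont s e10.
  pose t := s - Num.min (d / 2) (s / 2).
  have [t0 ts tsd] : [/\ 0 < t, t < s & `|t - s| < d].
    rewrite /t; have : 0 < Num.min (d / 2) (s / 2) by rewrite lt_min; lra.
    have : Num.min (d / 2) (s / 2) <= d / 2 by rewrite ge_min lexx.
    have : Num.min (d / 2) (s / 2) <= s / 2 by rewrite ge_min lexx orbT.
    move: (Num.min _ _) => u k1 k2 k3.
    by split; [lra|lra|rewrite distrC gtr0_norm; lra].
  have [hv hM] := Hd t tsd.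
  have [x /andP[x0 xL] <-] := bump_sturm k00 kL (pr t) (H t t0 ts).
  have vx : `|v t x| <= e1.
    by have := hv x ltac:(by rewrite !ltW); rewrite vs subr0.
  have := dnonlin_taylor h3 vx => hd.
  have -> : M s / 4 - M t * dnonlin (v t x) =
     - ((M t - M s) / 4) - M t * (dnonlin (v t x) - 1 / 4) by field.
  apply: (le_trans (ler_normB _ _)); rewrite normrN !normrM.
  rewrite (gtr0_norm (_ : 0 < 4^-1))//.
  have Mt : `|M t| <= `|M s| + 1.
    have := ler_normD (M t - M s) (M s); rewrite subrK => /le_trans; apply.
    by rewrite addrC lerD2l (le_trans hM).
  have : `|M t| * `|dnonlin (v t x) - 1 / 4| <= (`|M s| + 1) * (3 * e1).
    exact: ler_pM.
  have : e1 * K <= e by rewrite -ler_pdivlMr.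
  rewrite /K; lra.
have : M s / 4 - (g + k0 ^+ 2) = 0.
  apply/eqP; rewrite -normr_le0; apply/ler_addgt0Pl => e e0.
  by rewrite addr0; exact: key.
by rewrite /Mstar; lra.
Qed.

Let height_cont : continuous (fun s => v s 0).
Proof.
move=> z; apply/cvgrPdist_lt => e e0; have e2 : e / 2 < e by lra.
have [q q0 Hq] := branch_cont z (divr_gt0 e0 (ltr0n R 2)).
exists q => //= y yz; have [hq _] := Hq y ltac:(by rewrite distrC).
by rewrite distrC; apply: le_lt_trans e2; apply: hq; rewrite lexx ltW.
Qed.

Let step_back (s0 s1 d : R) : 0 < d -> d < s0 / 2 -> s1 <= s0 / 2 ->
  [/\ 0 < s0 - d, s0 - d < s0, `|s0 - d - s0| = d & s1 < s0 - d].
Proof. by move=> *; split; [lra|lra|rewrite distrC gtr0_norm; lra|lra]. Qed.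

(** n = 0 would give t = s1, and n >= 1 a gap of at least T >= s0. *)
Let no_turn (n : nat) (T t s1 s0 : R) : 0 < T -> s0 <= T -> t < s0 -> 0 < s1 ->
  s1 < t -> t - s1 = n%:R * T -> False.
Proof.
move=> T0 Ts ts s10 st; case: n => [|n] nT; first by rewrite mul0r in nT; lra.
have : T <= n.+1%:R * T by rewrite ler_peMl ?(ltW T0)// ler1n.
by rewrite -nT; lra.
Qed.

Let below4 (a b c d : R) : 0 < a -> 0 < b -> 0 < c -> 0 < d ->
  exists e : R, [/\ 0 < e, e < a, e < b, e < c & e < d].
Proof.
move=> a0 b0 c0 d0; have [e [e0 ea eb ec]] := min3 a0 b0 c0.
have [f [f0 fe fd _]] := min3 e0 d0 d0.
by exists (f / 2); split; lra.
Qed.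

Let no_return s0 : 0 < s0 -> (forall t, 0 < t -> t < s0 -> A t) ->
  (forall x, v s0 x = 0) -> M s0 = Mstar g k0 -> False.
Proof.
move=> s00 below vs0 Ms0; have [d d0 Hd] := A_near0.
have [r r0 Hr] := small_uniqueness g0 k00 kL.
have [C [_ [_ _ M0 v0 _]]] := branch_near0.
have [e1 e10 H1] := branch_cont 0 r0.
have [e2 e20 H2] := branch_cont s0 r0.
have [s1 [s10 s1a s1b s1c]] := min3 (divr_gt0 e10 (ltr0n R 2)) (divr_gt0 s00 (ltr0n R 2)) d0.
have As1 : A s1 by apply: Hd.
have a0 : 0 < v s1 0 := bump_max k00 kL (pr s1) As1.
have [e3 e30 H3] := branch_cont s0 (divr_gt0 a0 (ltr0n R 2)).
(* Parameters with nontrivial kernel are isolated, so the self-intersection clause applies at every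
   t close to s0 and different from it. *)
have [e4 e40 H4] : exists2 e : R, 0 < e & forall t, t != s0 -> `|s0 - t| < e ->
    ker_trivial g k0 (v t) (M t).
  have : ~ limit_point [set s | ~ ker_trivial g k0 (v s) (M s)] s0.
    by rewrite (global_kernel br).
  rewrite /limit_point /= => /existsNP[N /not_implyP[[e /= e0 He] h]].
  exists e => // t ts te; apply: contrapT => nk; apply: h.
  by exists t; split => //; exact: He.
have [dd [dd0 dd2 dd3 dd4 dd5]] := below4 e20 e30 e40 (divr_gt0 s00 (ltr0n R 2)).
have [t0 ts0 td s1t] := step_back dd0 dd5 s1b; move: (s0 - dd) t0 ts0 td s1t => t t0 ts0 td s1t.
have ss1 : s1 < e1 by apply: (le_lt_trans s1a); rewrite ltr_pdivrMr// ltr_pMr// ltr1n.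
have s't (s' : R) : s' <= s1 -> s' < t by move=> h; exact: le_lt_trans h s1t.
have At : A t := below t t0 ts0.
have bt : 0 < v t 0 := bump_max k00 kL (pr t) At.
have zL : 0 <= (0 : R) <= L by rewrite lexx ltW.
have [h3 _] := H3 t ltac:(by rewrite td).
have vt0 : v t 0 < v s1 0.
  have := h3 0 zL; rewrite vs0 subr0 => h.
  have h' : v s1 0 / 2 < v s1 0 by rewrite ltr_pdivrMr// ltr_pMr// ltr1n.
  exact: le_lt_trans (ler_norm _) (le_lt_trans h h').
(* The height is continuous in s and runs from 0 to v s1 0 on [0, s1], so the height at t is already
   attained there. *)
have [s' /andP[s'0 s's1] vs'] := @ivt _ (fun s => v s 0) 0 s1 (v t 0) (ltW s10) height_cont
  ltac:(by rewrite /= v0// !ltW).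
have s'p : 0 < s'.
  rewrite lt_neqAle s'0 andbT; apply/eqP => z; move: vs'; rewrite -z v0// => E.
  by rewrite -E ltxx in bt.
have [h2 h2'] := H2 t ltac:(by rewrite td).
have [h1 h1'] := H1 s' ltac:(by rewrite subr0 gtr0_norm// (le_lt_trans s's1)).
have [||||||vE ME] := Hr _ _ _ _ _ _ _ _ (pr s') (pr t).
- by rewrite M0 in h1'.
- by rewrite Ms0 in h2'.
- by move=> x xL; have := h1 x xL; rewrite v0// subr0.
- by move=> x xL; have := h2 x xL; rewrite vs0 subr0.
- exact: vs'.
- by rewrite vs'.
have vE' : v s' = v t.
  apply: (even_per_eq L0 (prof_even (pr s')) (prof_even (pr t)) (prof_per (pr s')) (prof_per (pr t))).
  exact: vE.
have [T [[[T0 HT] _] [n nT]]] : exists T, closed_loop v M T /\ exists n : nat, `|t - s'| = n%:R * T.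
  apply: (half_intersection (global_right br)).
  - exact: ltW.
  - exact: ltW.
  - by rewrite gt_eqF// s't.
  - by rewrite vE'.
  - by rewrite ME.
  - by apply: H4; [rewrite lt_eqF|rewrite distrC td].
(* At T the profile is again v 0, which vanishes and so is not a one-bump profile. *)
have Ts0 : s0 <= T.
  rewrite leNgt; apply/negP => Ts.
  have := bump_max k00 kL (pr T) (below T T0 Ts).
  by have [+ _] := HT 0 (lexx 0); rewrite add0r => ->; rewrite v0// ltxx.
have st := s't s' s's1; rewrite gtr0_norm ?subr_gt0// in nT.
exact: no_turn T0 Ts0 ts0 s'p st nT.
Qed.

Lemma branch_bump s : 0 < s -> A s.
Proof.
have [d d0 Hd] := A_near0.
move=> sp; apply: contrapT => nA.
pose S := [set t | 0 < t /\ forall r, 0 < r -> r <= t -> A r].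
have Sd : S d by split => // r; exact: Hd.
have Sub : ubound S s.
  move=> t [t0 Ht]; rewrite leNgt; apply/negP => st.
  by apply: nA; apply: Ht => //; exact: ltW.
have hS : has_sup S by split; [exists d|exists s].
pose s0 := sup S.
have ds0 : d <= s0 by apply: sup_upper_bound.
have s00 : 0 < s0 by exact: lt_le_trans ds0.
have below t : 0 < t -> t < s0 -> A t.
  move=> t0 ts; have e0 : 0 < s0 - t by rewrite subr_gt0.
  have [r [r0 Hr]] := sup_adherent e0 hS; rewrite -/s0 opprB addrC subrK => tr.
  by apply: Hr => //; exact: ltW.
have nAs0 : ~ A s0.
  move=> As0; have [e e0 He] := A_open As0.
  have : S (s0 + e / 2).
    split; first by lra.
    move=> r r0 rs; have [rs0|rs0] := ltP r s0; first exact: below.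
    by apply: He; rewrite ger0_norm; lra.
  by move=> /(sup_upper_bound hS); rewrite -/s0; lra.
have vs0 := A_closed s00 below nAs0.
have Ms0 := M_zero s00 below vs0.
exact: no_return s00 below vs0 Ms0.
Qed.

Lemma Lp_norm_le_bound (B : R) : exists K : R, forall u : R -> R, measurable_fun (cell k0) u ->
  (forall x : R, - L <= x <= L -> `|u x| <= B) -> (Lp_norm (cell k0) 2 u <= K%:E)%E.
Proof.
pose I := (\int[mu]_(x in cell k0) (`|B| ^+ 2)%:E)%E.
have II : (I < +oo)%E.
  rewrite /I integral_cst; last exact: measurable_cell.
  rewrite lte_mul_pinfty// cellE.
  have : (lebesgue_measure (`](- L)%R, L[%classic : set R) < +oo)%E.
    by rewrite lebesgue_measure_itv/=; case: ifP => // _; rewrite -EFinD ltry.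
  by [].
have I0 : (0 <= I)%E by apply: integral_ge0 => x _; rewrite lee_fin.
have fI : I \is a fin_num by rewrite ge0_fin_numE.
exists (fine I `^ 2^-1) => u mu' uB.
rewrite (Lp_norm_int _ _ (ltr0n R 2)) -poweR_EFin fineK//.
apply: gt0_ler_poweR => //.
- by rewrite in_itv/= leey andbT; apply: integral_ge0 => x _; rewrite lee_fin powR_ge0.
- by rewrite in_itv/= leey andbT.
apply: ge0_le_integral => //.
- exact: measurable_cell.
- by apply/measurable_EFinP; exact: measurable_powR_norm.
- move=> x; rewrite cellE/= in_itv/= => /andP[h1 h2].
  rewrite lee_fin powR_mulrn// lerXn2r ?nnegrE//.
  apply: le_trans (ler_norm B); apply: uB; rewrite !ltW//.
Qed.

Lemma branch_boundary : approaches_boundary v.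
Proof.
have L0' := L0; have g0' := g0.
have [bu|//|[T [[T0 HT] _]]] := half_alternatives (global_right br); last first.
  exfalso; have [C [_ [_ _ _ v0 _]]] := branch_near0.
  have := bump_max k00 kL (pr T) (branch_bump T0).
  have [+ _] := HT 0 (lexx 0); rewrite add0r => ->.
  by rewrite v0 ?ltxx// lexx ltW.
apply: contrapT => /existsNP[e /existsNP[S /not_implyP[e0 nb]]].
have low s x : S <= s -> - 1 + e <= v s x.
  by move=> Ss; rewrite leNgt; apply/negP => h; apply: nb; exists s; split => //; exists x.
(* Bounds valid while v >= -1 + e: M1 for M; f1 for |nonlin|, which is largest at -1 + e; M1 f1 for
   |c|; hence B0 for |v|, since g v(0) < - c; B2 for v'' and B2 L for v'. *)
pose M1 := 18 * (g + 4 * k0 ^+ 2).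
pose f1 : R := `|@nonlin R (- 1 + e)|.
pose B0 := M1 * f1 / g + 1.
pose B2 := g * B0 + M1 * f1 + M1 * f1.
pose B := B0 + B2 * L + B2.
have M10 : 0 <= M1.
  by apply: mulr_ge0 => //; apply: addr_ge0; [exact: ltW|apply: mulr_ge0 => //; exact: sqr_ge0].
have f10 : 0 <= f1 by exact: normr_ge0.
have q0 : 0 <= M1 * f1 / g by apply: divr_ge0; [exact: mulr_ge0|exact: ltW].
have B00 : 0 <= B0 by apply: addr_ge0.
have B20 : 0 <= B2.
  by apply: addr_ge0; [apply: addr_ge0|]; apply: mulr_ge0 => //; exact: ltW.
have BL : 0 <= B2 * L by rewrite mulr_ge0// ltW.
have B01 : 1 <= B0 by rewrite lerDr.
have [BB0 BB1 BB2] : [/\ B0 <= B, B2 * L <= B & B2 <= B] by split; rewrite /B; lra.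
have bounds s : 0 < s -> S <= s -> [/\ forall x, - L <= x <= L -> `|v s x| <= B,
   forall x, - L <= x <= L -> `|derive1n 1 (v s) x| <= B &
   forall x, - L <= x <= L -> `|derive1n 2 (v s) x| <= B].
  move=> s0 Ss; have bs := branch_bump s0.
  have m0 := bump_m_gt0 g0 k00 kL (pr s) bs.
  have mM := bump_m_le g0 k00 kL (pr s) bs; rewrite -/M1 in mM.
  have e1 : -1 < -1 + e by lra.
  have fl x : `|nonlin (v s x)| <= f1.
    rewrite ler0_norm ?nonlin_le0 ?(prof_gt (pr s))//.
    rewrite /f1 ler0_norm ?nonlin_le0// lerN2.
    by apply: nonlin_le => //; exact: low.
  have mf x : `|M s * nonlin (v s x)| <= M1 * f1.
    by rewrite normrM (gtr0_norm m0); apply: ler_pM => //; exact: ltW.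
  have cl := bump_c_gt g0 k00 kL (pr s) bs.
  have cu := bump_c_lt g0 k00 kL (pr s) bs.
  have v00 := bump_max k00 kL (pr s) bs.
  have gv : 0 < g * v s 0 by rewrite mulr_gt0.
  have cb : `|branch_c s| <= M1 * f1.
    have := mf L; rewrite ler_norml => /andP[h1 h2].
    by rewrite ltr0_norm; lra.
  have vb x : 0 <= x <= L -> `|v s x| <= B0.
    move=> /andP[x0 xL]; rewrite ler_norml; apply/andP; split.
      by apply: le_trans (ltW (prof_gt (pr s) x)); rewrite lerN2.
    have := bump_decr (pr s) bs (lexx 0) x0 xL => /le_trans; apply.
    apply: (@le_trans _ _ (M1 * f1 / g)); last by rewrite lerDl.
    rewrite ler_pdivlMr// mulrC; apply: (@le_trans _ _ (- branch_c s)).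
      by rewrite lerNr ltW.
    by apply: (le_trans (ler_norm _)); rewrite normrN.
  have v2b x : 0 <= x <= L -> `|rhs g (M s) (branch_c s) (v s x)| <= B2.
    move=> xL; rewrite /rhs (le_trans (ler_normD _ _))// lerD//.
    rewrite (le_trans (ler_normB _ _))// lerD//.
    by rewrite normrM gtr0_norm// ler_wpM2l ?(ltW g0)// vb.
  have v1b x : 0 <= x <= L -> `|derive1 (v s) x| <= B2 * L.
    move=> /andP[x0 xL].
    have := @der_lip _ _ _ 0 x B2 x0 (fun z _ => prof_d2 (pr s) z).
    rewrite (prof_1_0 (pr s)) !subr0 => H.
    apply: (@le_trans _ _ (B2 * x)); last by rewrite ler_wpM2l.
    by apply: H => z /andP[z0 zx]; apply: v2b; rewrite z0 (le_trans zx).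
  have E2 x : derive1n 2 (v s) x = rhs g (M s) (branch_c s) (v s x).
    exact: derive1_is_derive (prof_d2 (pr s) x).
  have fold (u : R -> R) (x : R) : (forall x, 0 <= x <= L -> `|u x| <= B) ->
      `|u (- x)| = `|u x| -> - L <= x <= L -> `|u x| <= B.
    move=> uB uN /andP[x1 x2]; have [x0|x0] := leP 0 x; first by apply: uB; rewrite x0.
    by rewrite -uN; apply: uB; rewrite oppr_ge0 (ltW x0) lerNl.
  split=> x; apply: fold => [y yL|].
  - exact: le_trans (vb y yL) BB0.
  - by rewrite (prof_even (pr s)).
  - by rewrite derive1n1; exact: le_trans (v1b y yL) BB1.
  - by rewrite derive1n1 (prof_odd (pr s)) normrN.
  - by rewrite E2; exact: le_trans (v2b y yL) BB2.
  - by rewrite !E2 (prof_even (pr s)).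
have [K HK] := Lp_norm_le_bound B.
have XK s : 0 < s -> S <= s -> (X_norm k0 (v s) <= (K + (K + K))%:E)%E.
  move=> s0 Ss; have [b0 b1 b2] := bounds s s0 Ss.
  have sv : smooth (v s) by exact: (global_smooth br).
  have le j : (forall x, - L <= x <= L -> `|derive1n j (v s) x| <= B) ->
      (Lp_norm (cell k0) 2 (wderiv setT j (v s)) <= K%:E)%E.
    move=> bj; have wj := smooth_wderiv j openT sv.
    have mj : measurable_fun (cell k0) (derive1n j (v s)).
      by apply: measurable_funTS; apply: continuous_measurable_fun; exact: smooth_continuous.
    rewrite (@Lp_norm_ae _ _ _ _ (derive1n j (v s)))//.
    - exact: HK.
    - exact: measurable_cell.
    - have [_ [m _ _] _] := is_wderiv_wderiv wj; exact: measurable_funS m.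
    - by apply: ae_mono (wderiv_ae wj) => x H _; exact: H.
  rewrite /X_norm /W_norm !big_ord_recl big_ord0 /= adde0 !EFinD.
  by apply: leeD; [exact: le|apply: leeD; exact: le].
have := cvgey_gt bu (K + (K + K) + M1 + 1) => -[S' [_ HS']].
pose s := Num.max S' (Num.max S 0) + 1.
have [ss' sS s0] : [/\ S' < s, S <= s & 0 < s].
  rewrite /s; have h1 : S' <= Num.max S' (Num.max S 0) by rewrite le_max lexx.
  have h2 : S <= Num.max S' (Num.max S 0) by rewrite !le_max lexx orbT.
  have h3 : 0 <= Num.max S' (Num.max S 0) by rewrite !le_max lexx !orbT.
  by split; lra.
have := HS' s ss'; rewrite /XR_norm ltNge => /negP; apply.
have m0 := bump_m_gt0 g0 k00 kL (pr s) (branch_bump s0).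
have mM := bump_m_le g0 k00 kL (pr s) (branch_bump s0); rewrite -/M1 in mM.
rewrite -[X in (_ <= X)%E]/((K + (K + K) + M1 + 1)%:E) -addrA EFinD.
apply: leeD; first exact: XK.
by rewrite lee_fin gtr0_norm//; lra.
Qed.

End branch.

(** * Uniform convergence of the profiles *)

Section uniform_limits.
Context {R : realType}.

Definition ucvg (u_ : nat -> R -> R) (u : R -> R) := forall e : R, 0 < e ->
  exists N, forall n, (N <= n)%N -> forall x, `|u_ n x - u x| <= e.

Lemma unif_cauchy_limit (u : nat -> R -> R) :
  (forall e : R, 0 < e -> exists N, forall n k, (N <= n)%N -> (N <= k)%N ->
    forall x, `|u n x - u k x| <= e) ->
  exists v : R -> R, ucvg u v.
Proof.
move=> H.
have cu x : cvg (u n x @[n --> \oo]).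
  apply: cauchy_cvg; apply: cauchy_exP => e e0.
  have [N HN] := H (e / 2) ltac:(by rewrite divr_gt0).
  exists (u N x); exists N => // n /= Nn.
  apply: le_lt_trans (HN N n (leqnn _) Nn x) _.
  by rewrite ltr_pdivrMr// ltr_pMr// ltr1n.
exists (fun x => lim (u n x @[n --> \oo])) => e e0.
have [N HN] := H (e / 2) ltac:(by rewrite divr_gt0).
exists N => n Nn x.
have /cvgrPdist_le/(_ (e / 2)) := cu x.
rewrite divr_gt0// => /(_ isT) [K _ HK].
have := HK (maxn N K) (leq_maxr _ _); have := HN n (maxn N K) Nn (leq_maxl _ _) x.
rewrite !ler_norml => /andP[? ?] /andP[? ?]; lra.
Qed.

Lemma unif_pointwise (u : nat -> R -> R) (v : R -> R) x : ucvg u v -> u n x @[n --> \oo] --> v x.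
Proof.
move=> H; apply/cvgrPdist_le => e e0; have [N HN] := H e e0.
by exists N => // n /= Nn; rewrite distrC; exact: HN.
Qed.

Lemma ucvg_cst (a_ : nat -> R) (a : R) : a_ n @[n --> \oo] --> a ->
  ucvg (fun n _ => a_ n) (fun=> a).
Proof.
move=> /cvgrPdist_le H e e0; have [N _ HN] := H e e0.
by exists N => n Nn _; rewrite distrC; exact: HN.
Qed.

Lemma ucvgB u_ v_ u v : ucvg u_ u -> ucvg v_ v ->
  ucvg (fun n x => u_ n x - v_ n x) (fun x => u x - v x).
Proof.
move=> cu cv e e0; have e2 : 0 < e / 2 by rewrite divr_gt0.
have [N1 H1] := cu _ e2; have [N2 H2] := cv _ e2.
exists (maxn N1 N2) => n; rewrite geq_max => /andP[n1 n2] x.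
have := H1 n n1 x; have := H2 n n2 x; rewrite !ler_norml => /andP[? ?] /andP[? ?].
by apply/andP; split; lra.
Qed.

Lemma ucvgM u_ v_ u v (A B : R) : (forall n x, `|u_ n x| <= A) ->
  (forall x, `|v x| <= B) -> ucvg u_ u -> ucvg v_ v ->
  ucvg (fun n x => u_ n x * v_ n x) (fun x => u x * v x).
Proof.
move=> uA vB cu cv e e0.
have A0 : 0 < `|A| + 1 by rewrite ltr_wpDl// normr_ge0.
have B0 : 0 < `|B| + 1 by rewrite ltr_wpDl// normr_ge0.
have e2 : 0 < e / 2 by rewrite divr_gt0.
have [N1 H1] := cu _ (divr_gt0 e2 B0); have [N2 H2] := cv _ (divr_gt0 e2 A0).
exists (maxn N1 N2) => n; rewrite geq_max => /andP[n1 n2] x.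
have -> : u_ n x * v_ n x - u x * v x =
  u_ n x * (v_ n x - v x) + (u_ n x - u x) * v x by ring.
apply: (le_trans (ler_normD _ _)); rewrite !normrM [leRHS]splitr; apply: lerD.
  apply: (@le_trans _ _ ((`|A| + 1) * (e / 2 / (`|A| + 1)))).
    apply: ler_pM => //; last exact: H2.
    by apply: (le_trans (uA n x)); have := ler_norm A; lra.
  by rewrite mulrC divfK// gt_eqF.
apply: (@le_trans _ _ (e / 2 / (`|B| + 1) * (`|B| + 1))).
  apply: ler_pM => //; first exact: H1.
  by apply: (le_trans (vB x)); have := ler_norm B; lra.
by rewrite divfK// gt_eqF.
Qed.

End uniform_limits.

(** * Uniform estimates for profiles approaching rupture *)

Section limit_profile.
Context {R : realType}.
Variables (g k0 L : R).
Hypotheses (g0 : 0 < g) (k00 : 0 < k0) (kL : k0 * L = pi).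
Variables (w w1 : nat -> R -> R) (m c : nat -> R) (mi ci ai : R).
Hypothesis pw : forall n, profile g L (m n) (c n) (w n) (w1 n).
Hypothesis bw : forall n, onebump L (w1 n).
Hypothesis wL : forall n, w n L <= - 1 / 2.
Hypothesis cL : w n L @[n --> \oo] --> (- 1 : R).
Hypothesis cm : m n @[n --> \oo] --> mi.
Hypothesis cc : c n @[n --> \oo] --> ci.
Hypothesis ca : w n 0 @[n --> \oo] --> ai.

Let L0 : 0 < L := half_period_gt0 k00 kL.
(* the bound of [bump_m_le] *)
Definition mmax : R := 18 * (g + 4 * k0 ^+ 2).
Let m0 n : 0 < m n := bump_m_gt0 g0 k00 kL (pw n) (@bw n).
Let m_ge n : g / 8 <= m n := bump_m_ge g0 k00 kL (pw n) (@bw n) (wL n).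
Let m_le n : m n <= mmax := bump_m_le g0 k00 kL (pw n) (@bw n).
Definition wmax : R := 2 * mmax / g.

Let mmax0 : 0 < mmax.
Proof. exact: lt_le_trans (m0 0) (m_le 0). Qed.

Let wmax0 : 0 < wmax.
Proof. by apply: divr_gt0 => //; exact: mulr_gt0. Qed.

Lemma lim_c_bound n : `|c n| <= 2 * mmax.
Proof.
have h1 := bump_c_lt g0 k00 kL (pw n) (@bw n).
have h2 := bump_c_ge g0 k00 kL (pw n) (@bw n) (wL n).
have h3 : 0 < g * w n 0 by rewrite mulr_gt0// (bump_max k00 kL (pw n) (@bw n)).
have h4 := m_le n.
by rewrite ltr0_norm; lra.
Qed.

Lemma lim_w_le n x : 0 <= x <= L -> w n x <= wmax.
Proof.
move=> /andP[x0 xL]; apply: le_trans (bump_decr (pw n) (@bw n) (lexx 0) x0 xL) _.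
have := bump_max_le g0 k00 kL (pw n) (@bw n) (wL n).
rewrite /wmax ler_pdivlMr// mulrC => /le_trans; apply.
by rewrite ler_pM2l// m_le.
Qed.

(** The threshold d of [bump_lower] made independent of n: m becomes [mmax] in the numerator and its
    lower bound g / 8 in the denominator. The minimum in [kap] merges the two alternatives of that
    lemma, as (L - x)^2 <= L^2. *)
Definition kap0 : R := expR (- 1 - (g + 2 * mmax + 1) / (g / 8)).
Definition kap : R := Num.min (1 / 2) (kap0 / L ^+ 2).

Lemma kap_gt0 : 0 < kap.
Proof. by rewrite /kap lt_min !divr_gt0 ?expR_gt0 ?exprn_gt0. Qed.

Lemma lim_lower n x : 0 <= x <= L -> kap * (L - x) ^+ 2 <= 1 + w n x.
Proof.
move=> xL; have /andP[x0 xL'] := xL; have L0' := L0.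
have k1 : 0 < kap0 by exact: expR_gt0.
have g8 : 0 < g / 8 by rewrite divr_gt0.
have k2 : kap0 <= 1.
  rewrite /kap0 expR_le1; have : 0 <= (g + 2 * mmax + 1) / (g / 8).
    by apply: divr_ge0; [have := g0; have := mmax0; lra|exact: ltW].
  lra.
have k3 : ln kap0 <= - 1 - (g + 2 * m n + 1) / m n.
  rewrite /kap0 expRK lerD2l lerN2; apply: ler_pM.
  - by have := g0; have := m0 n; lra.
  - by rewrite invr_ge0 ltW.
  - by have := m_le n; lra.
  - by rewrite lef_pV2 ?posrE.
have := bump_lower g0 k00 kL (pw n) (@bw n) (wL n) k1 k2 k3 xL.
have sq : 0 <= (L - x) ^+ 2 by exact: sqr_ge0.
case=> h; apply: le_trans h.
  apply: (@le_trans _ _ (kap0 / L ^+ 2 * (L - x) ^+ 2)).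
    by rewrite ler_wpM2r// /kap ge_min lexx orbT.
  rewrite mulrAC ler_pdivrMr ?exprn_gt0// ler_pM2l//.
  by rewrite lerXn2r ?nnegrE; lra.
rewrite mulrC ler_wpM2l//.
by rewrite /kap div1r ge_min lexx.
Qed.

Let C1 := g * (wmax + 1) + 4 * mmax.
Let C10 : 0 < C1.
Proof. by rewrite /C1; have := g0; have := wmax0; have := mmax0; nra. Qed.

Lemma lim_slope n x : 0 <= x <= L ->
  w1 n x ^+ 2 <= C1 * ((1 + w n x) + Num.sqrt (1 + w n x)).
Proof.
move=> xL; have h := bump_slope g0 k00 kL (pw n) (@bw n) xL.
apply: (le_trans h); rewrite /C1.
have w0 := lim_w_le n (_ : 0 <= (0 : R) <= L).
have {}w0 : w n 0 <= wmax by apply: w0; rewrite lexx ltW.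
have hL := prof_gt (pw n) L; have hx := prof_gt (pw n) x.
have wx : w n L <= w n x by case/andP: xL => x0 xL; exact: bump_decr (pw n) (@bw n) _ _ x0 xL (lexx L).
have s0 : 0 <= Num.sqrt (1 + w n x) by exact: sqrtr_ge0.
have w00 := bump_max k00 kL (pw n) (@bw n).
have h1 : g * (w n 0 + 1) * (w n x - w n L) <= g * (wmax + 1) * (1 + w n x).
  apply: ler_pM.
  - by apply: mulr_ge0; [exact: ltW|lra].
  - lra.
  - by rewrite ler_pM2l//; lra.
  - lra.
have h2 : 4 * m n * Num.sqrt (1 + w n x) <= 4 * mmax * Num.sqrt (1 + w n x).
  by rewrite ler_wpM2r// ler_pM2l.
have h3 : 0 <= g * (wmax + 1) * Num.sqrt (1 + w n x).
  by apply: mulr_ge0 => //; apply: mulr_ge0; [exact: ltW|have := wmax0; lra].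
have h4 : 0 <= 4 * mmax * (1 + w n x).
  by apply: mulr_ge0; [have := mmax0; lra|lra].
lra.
Qed.

(** The first summand bounds w1^2; adding 1 avoids a square root, since s - 1 <= s^2. *)
Definition slmax : R := C1 * ((1 + wmax) + Num.sqrt (1 + wmax)) + 1.

Lemma slmax_gt0 : 0 < slmax.
Proof.
have := C10; have := wmax0; have := sqrtr_ge0 (1 + wmax) => h1 h2 h3.
by apply: ltr_wpDl => //; apply: mulr_ge0; lra.
Qed.

Lemma lim_slope_bound n x : 0 <= x <= L -> `|w1 n x| <= slmax.
Proof.
move=> xL; have := lim_slope n xL => h.
have wx := lim_w_le n xL; have hx := prof_gt (pw n) x.
have h1 : w1 n x ^+ 2 <= slmax - 1.
  apply: (le_trans h); rewrite /slmax addrK ler_pM2l//; apply: lerD; first lra.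
  by rewrite ler_wsqrtr//; lra.
have h2 := slmax_gt0.
rewrite -(@ler_pXn2r _ 2)// ?nnegrE//; last exact: ltW.
by rewrite real_normK ?num_real//; have := sqr_ge0 (w1 n x); nra.
Qed.

(** Next to L the equation is too singular for Gronwall, but 1 + w and w1 are small by themselves: w
    L tends to -1, slopes are uniformly bounded, and [lim_slope] makes w1 small where 1 + w is. *)
Let near_end (e : R) : 0 < e -> exists eta N, [/\ 0 < eta, eta < L &
  forall n, (N <= n)%N -> forall x, L - eta <= x <= L ->
    1 + w n x <= e / 2 /\ `|w1 n x| <= e / 2].
Proof.
move=> e0; have K0 := slmax_gt0; have L0' := L0.
have C1' := C10.
(* [t ^ 2] bounds the height; then the slope is at most [C1 (t ^ 2 + t)] *)
have [t [t0 t1 t2 t3]] := min3 (ltr01 : (0 : R) < 1)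
  (divr_gt0 e0 (ltr0n R 2)) (divr_gt0 (exprn_gt0 2 (divr_gt0 e0 (ltr0n R 2))) (mulr_gt0 (ltr0n R 2) C1')).
have t20 : 0 < t ^+ 2 / (2 * slmax) by rewrite divr_gt0 ?exprn_gt0 ?mulr_gt0.
have [eta [eta0 eta1 eta2 _]] := min3 t20 (divr_gt0 L0' (ltr0n R 2)) (ltr01 : (0 : R) < 1).
have /cvgrPdist_le/(_ (t ^+ 2 / 2)) := cL.
rewrite divr_gt0 ?exprn_gt0// => /(_ isT) [N _ HN].
exists eta, N; split => //; first by lra.
move=> n Nn x /andP[x1 x2].
have xL : 0 <= x <= L by rewrite x2 andbT; lra.
have hL : 1 + w n L <= t ^+ 2 / 2.
  by have := HN n Nn; rewrite ler_norml => /andP[]; lra.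
have hx : 1 + w n x <= t ^+ 2.
  have := @der_lip _ _ _ x L slmax x2 (fun z _ => prof_d1 (pw n) z).
  move=> H; have {}H : `|w n L - w n x| <= slmax * (L - x).
    apply: H => z /andP[z1 z2]; apply: lim_slope_bound.
    by rewrite z2 andbT; lra.
  have : slmax * (L - x) <= slmax * (t ^+ 2 / (2 * slmax)).
    by rewrite ler_pM2l//; lra.
  rewrite [X in _ <= X](_ : _ = t ^+ 2 / 2); last by field; rewrite gt_eqF.
  by move: H; rewrite ler_norml => /andP[]; lra.
have hx0 := prof_gt (pw n) x.
split; first by nra.
have sq : Num.sqrt (1 + w n x) <= t.
  by rewrite -[leRHS](ger0_norm (ltW t0)) -sqrtr_sqr ler_wsqrtr.
have h := lim_slope n xL.
have h2 : w1 n x ^+ 2 <= (e / 2) ^+ 2.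
  apply: (le_trans h); apply: (@le_trans _ _ (C1 * (2 * t))).
    by rewrite ler_pM2l//; nra.
  by rewrite mulrA mulrC -ler_pdivlMr ?mulr_gt0// [C1 * 2]mulrC.
rewrite -(@ler_pXn2r _ 2)// ?nnegrE//; last lra.
by rewrite real_normK ?num_real.
Qed.

(** On [0, L - eta] every profile keeps the distance d = kap eta^2 from -1, where [nonlin] has
    Lipschitz constant 1 / d; Gronwall then compares two profiles with w1 0 = 0 and convergent data
    m, c, w 0. *)
Let cauchy_mid (e eta : R) : 0 < e -> 0 < eta -> eta < L ->
  exists N, forall n k, (N <= n)%N -> (N <= k)%N -> forall x, 0 <= x <= L - eta ->
    `|w n x - w k x| <= e /\ `|w1 n x - w1 k x| <= e.
Proof.
move=> e0 eta0 etaL; have L0' := L0.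
pose d : R := kap * eta ^+ 2.
have d0 : 0 < d by rewrite mulr_gt0 ?kap_gt0 ?exprn_gt0.
pose F0 : R := `|@nonlin R (- 1 + d)|.
pose B : R := g + mmax / d.
have B0 : 0 < B by rewrite addr_gt0// divr_gt0.
pose E : R := expR ((2 + B) * (L - eta - 0)).
have E0 : 0 < E by exact: expR_gt0.
(* Makes Gronwall's bound (r^2 + r^2) E equal to e^2: one r^2 for the initial heights, the other for
   the data m and c. *)
pose r : R := Num.sqrt (e ^+ 2 / (2 * E)).
have r0 : 0 < r by rewrite sqrtr_gt0 divr_gt0 ?exprn_gt0// mulr_gt0.
have rr : r ^+ 2 = e ^+ 2 / (2 * E).
  by rewrite sqr_sqrtr// divr_ge0 ?sqr_ge0// mulr_ge0// ltW.
have F1 : 0 < F0 + 1 by rewrite ltr_wpDl// normr_ge0.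
have near_cauchy (a_ : nat -> R) (l q : R) : a_ n @[n --> \oo] --> l -> 0 < q ->
    exists N, forall n k, (N <= n)%N -> (N <= k)%N -> `|a_ n - a_ k| <= q.
  move=> /cvgrPdist_le/(_ (q / 2)) + q0; rewrite divr_gt0// => /(_ isT)[N _ HN].
  exists N => n k Nn Nk; have := HN n Nn; have := HN k Nk.
  by rewrite !ler_norml => /andP[? ?] /andP[? ?]; lra.
have [N1 H1] := near_cauchy _ _ r ca r0.
have [N2 H2] := near_cauchy _ _ (r / 2 / (F0 + 1)) cm ltac:(by rewrite !divr_gt0).
have [N3 H3] := near_cauchy _ _ (r / 2) cc ltac:(by rewrite divr_gt0).
exists (maxn N1 (maxn N2 N3)) => n k.
rewrite !geq_max => /and3P[n1 n2 n3] /and3P[k1 k2 k3] x xe.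
have hd j z : 0 <= z <= L - eta -> d <= 1 + w j z.
  move=> /andP[z0 ze]; apply: le_trans (lim_lower j (_ : 0 <= z <= L)); last first.
    by rewrite z0 /=; lra.
  rewrite /d ler_pM2l ?kap_gt0// lerXn2r ?nnegrE//; lra.
have fF j z : 0 <= z <= L - eta -> `|nonlin (w j z)| <= F0.
  move=> /(hd j) h; rewrite /F0 ler0_norm ?nonlin_le0 ?(prof_gt (pw j))//.
  rewrite ler0_norm; last by apply: nonlin_le0; lra.
  by rewrite lerN2; apply: nonlin_le; lra.
have := @gronwall2 _ (fun z => w n z - w k z) (fun z => w1 n z - w1 k z)
  (fun z => rhs g (m n) (c n) (w n z) - rhs g (m k) (c k) (w k z))
  (r ^+ 2) B r 0 (L - eta) _ (sqr_ge0 _) (ltW B0) (ltW r0).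
have -> : (r ^+ 2 + r ^+ 2) * expR ((2 + B) * (L - eta - 0)) = e ^+ 2.
  by rewrite -/E rr; field; rewrite gt_eqF.
move=> G; have {}G : (w n x - w k x) ^+ 2 + (w1 n x - w1 k x) ^+ 2 <= e ^+ 2.
  apply: G xe.
  - lra.
  - by move=> z _; have ? := prof_d1 (pw n) z; have ? := prof_d1 (pw k) z; exact: is_deriveB.
  - by move=> z _; have ? := prof_d2 (pw n) z; have ? := prof_d2 (pw k) z; exact: is_deriveB.
  - move=> z ze.
    have -> : rhs g (m n) (c n) (w n z) - rhs g (m k) (c k) (w k z) =
      (g * (w n z - w k z) - m n * (nonlin (w n z) - nonlin (w k z))) +
      ((c n - c k) - (m n - m k) * nonlin (w k z)) by rewrite /rhs; ring.
    apply: (le_trans (ler_normD _ _)); apply: lerD.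
      apply: (le_trans (ler_normB _ _)); rewrite /B mulrDl; apply: lerD.
        by rewrite normrM gtr0_norm.
      rewrite normrM (gtr0_norm (m0 n)) -mulrA; apply: ler_pM => //; first exact: ltW.
      by apply: nonlin_lip => //; exact: hd.
    apply: (le_trans (ler_normB _ _)); rewrite [leRHS]splitr; apply: lerD.
      exact: H3.
    rewrite normrM; apply: (@le_trans _ _ (r / 2 / (F0 + 1) * (F0 + 1))).
      apply: ler_pM => //; first exact: H2.
      by apply: (le_trans (fF k z ze)); rewrite lerDl.
    by rewrite divfK// gt_eqF.
  - rewrite (prof_1_0 (pw n)) (prof_1_0 (pw k)) subrr expr0n/= addr0.
    by rewrite -(real_normK (num_real (w n 0 - w k 0))) lerXn2r ?nnegrE ?(ltW r0)//; exact: H1.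
split.
  rewrite -(@ler_pXn2r _ 2)// ?nnegrE ?(ltW e0)// real_normK ?num_real//.
  by apply: le_trans G; rewrite lerDl sqr_ge0.
rewrite -(@ler_pXn2r _ 2)// ?nnegrE ?(ltW e0)// real_normK ?num_real//.
by apply: le_trans G; rewrite lerDr sqr_ge0.
Qed.

Lemma lim_cauchy (e : R) : 0 < e -> exists N, forall n k, (N <= n)%N -> (N <= k)%N ->
  forall x, `|w n x - w k x| <= e /\ `|w1 n x - w1 k x| <= e.
Proof.
move=> e0; have L0' := L0.
have [eta [N1 [eta0 etaL H1]]] := near_end e0.
have [N2 H2] := cauchy_mid e0 eta0 etaL.
exists (maxn N1 N2) => n k; rewrite !geq_max => /andP[n1 n2] /andP[k1 k2].
have half y : 0 <= y <= L -> `|w n y - w k y| <= e /\ `|w1 n y - w1 k y| <= e.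
  move=> /andP[y0 yL]; have [h|h] := leP y (L - eta).
    by apply: H2 => //; rewrite y0.
  have yy : L - eta <= y <= L by rewrite (ltW h).
  have [a1 a2] := H1 n n1 y yy; have [b1 b2] := H1 k k1 y yy.
  have := prof_gt (pw n) y; have := prof_gt (pw k) y => p1 p2.
  split; first by rewrite ler_norml; apply/andP; split; lra.
  by apply: (le_trans (ler_normB _ _)); lra.
move=> x; have [y [sg [j [yL sgE ->]]]] := fold_half x L0.
rewrite !(per_int _ _ (prof_per (pw _))) !(per_int _ _ (prof_per1 (pw _))).
have [h1 h2] := half y yL.
case: sgE => ->; rewrite ?mul1r ?mulN1r//.
rewrite !(prof_even (pw _)) !(prof_odd (pw _)); split => //.
by rewrite opprK addrC distrC.
Qed.

End limit_profile.

(** * An integrable majorant *)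

Section singular_majorant.
Context {R : realType}.
Notation mu := (@lebesgue_measure R).
Implicit Types (a x y e : R).

(* [|x - a| ^ (-1/2)], with the junk value 0 at [a] *)
Definition sing a x : R := ((x - a) ^+ 2) `^ (- 4^-1).

Lemma sing_ge0 a x : 0 <= sing a x.
Proof. exact: powR_ge0. Qed.

Lemma measurable_sing a (A : set R) : measurable_fun A (sing a).
Proof.
apply: measurable_funTS; apply: (@measurableT_comp _ _ _ _ _ _ (fun y : R => y `^ (- 4^-1))).
  exact: measurable_powR.
apply: measurable_funX; apply: measurable_funB => //.
Qed.

(** Smooth approximations that increase to [sing a] away from a as e decreases to 0. *)
Let reg a e x : R := ((x - a) ^+ 2 + e) `^ (- 4^-1).

Let reg_pos a e x : 0 < e -> 0 < (x - a) ^+ 2 + e.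
Proof. by move=> e0; rewrite ltr_wpDl// sqr_ge0. Qed.

Let is_derive_base a e x : is_derive x 1 (fun z => (z - a) ^+ 2 + e) (2 * (x - a)).
Proof.
have h : is_derive x 1 (fun z => (z - a) ^+ 2) (2 * (x - a)).
  apply: (is_derive_eq (@is_derive1_comp _ (fun z : R => z ^+ 2) (fun z => z - a) x _ _ _ _)).
  by rewrite /= /GRing.scale/=; ring.
by apply: (is_derive_eq (is_deriveD h (is_derive_cst e x (1 : R)))); rewrite addr0.
Qed.

Let is_derive_reg a e x : 0 < e -> is_derive x 1 (reg a e)
  (- 4^-1 * ((x - a) ^+ 2 + e) `^ (- 4^-1 - 1) * (2 * (x - a))).
Proof.
move=> e0; have h := is_derive_base a e x.
exact: (@is_derive1_comp _ (fun y : R => y `^ (- 4^-1)) (fun z => (z - a) ^+ 2 + e)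
  x _ _ (is_derive1_powR (- 4^-1) (reg_pos a x e0)) h).
Qed.

Let reg_cont a e : 0 < e -> continuous (reg a e).
Proof. by move=> e0; apply: der_continuous => x; exact: is_derive_reg. Qed.

(* the derivative of [(x - a) reg a e x] is at least [reg a e x / 2] *)
Let reg_prim a e x : 0 < e -> exists2 r : R, reg a e x / 2 <= r &
  is_derive x 1 (fun z => (z - a) * reg a e z) r.
Proof.
move=> e0; have h := is_derive_reg a x e0.
have h1 : is_derive x 1 (fun z : R => z - a) 1 by apply: is_derive_eq; rewrite subr0.
eexists; last exact: (is_deriveM h1 h).
rewrite /GRing.scale/= mulr1.
set P := _ `^ (_ - 1); set z := x - a.
have P0 : 0 <= P by exact: powR_ge0.
have -> : reg a e x = (z ^+ 2 + e) * P.
  rewrite /P -{1}[(_ + e)](@powRr1 _ (z ^+ 2 + e)); last exact: ltW (reg_pos _ _ e0).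
  rewrite -powRD; first by rewrite [1 + _]addrC subrK.
  by apply/implyP => _; rewrite gt_eqF// reg_pos.
have : 0 <= e * P by rewrite mulr_ge0// ltW.
lra.
Qed.

Let reg_le_sing a e x : 0 < e -> x != a -> reg a e x <= sing a x.
Proof.
move=> e0 xa; have z0 : 0 < (x - a) ^+ 2 by rewrite exprn_even_gt0//= subr_eq0.
rewrite /reg /sing !powRN lef_pV2 ?posrE ?powR_gt0 ?reg_pos//.
by apply: ge0_ler_powR; rewrite ?nnegrE ?invr_ge0 ?lerDl ?(ltW e0) ?(ltW (reg_pos _ _ e0))// ltW.
Qed.

Let reg_mono a e e' x : 0 < e -> e <= e' -> reg a e' x <= reg a e x.
Proof.
move=> e0 ee; have e'0 := lt_le_trans e0 ee.
rewrite /reg !powRN lef_pV2 ?posrE ?powR_gt0 ?reg_pos//.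
apply: ge0_ler_powR; rewrite ?nnegrE ?invr_ge0 ?(ltW (reg_pos _ _ _))//.
by rewrite lerD2l.
Qed.

(** With F a primitive of reg, 2 (z - a) reg - F is nondecreasing by [reg_prim]; its values at both
    ends bound the integral independently of e. *)
Let reg_int a e (B : R) : 0 < e -> 0 < B ->
  (\int[mu]_(x in `[(a - B)%R, (a + B)%R]) (reg a e x)%:E <= (4 * (B * sing 0 B))%:E)%E.
Proof.
move=> e0 B0; have ab : a - B < a + B by lra.
have [F [dF F0]] := der_primitive (`|a| + B) (reg_cont e0 : continuous (reg a e)).
have dF' (x : R) : a - B <= x <= a + B -> is_derive x 1 F (reg a e x).
  move=> /andP[h1 h2]; apply: dF; rewrite ler_norml.
  have := ler_norm a; have := ler_norm (- a); rewrite normrN => ? ?.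
  by apply/andP; split; lra.
rewrite (der_FTC ab (reg_cont e0 : continuous (reg a e)) dF') lee_fin.
pose G z := 2 * ((z - a) * reg a e z) - F z.
have [dG dGE] : exists dG : R -> R, forall x, a - B <= x <= a + B -> is_derive x 1 G (dG x) /\ 0 <= dG x.
  have H x : exists r : R, a - B <= x <= a + B -> is_derive x 1 G r /\ 0 <= r.
    have [xB|xB] := boolP (a - B <= x <= a + B); last by exists 0.
    have [r h1 h2] := reg_prim a x e0; have h3 := dF' x xB.
    exists (2 * r - reg a e x) => _; split; last lra.
    exact: (is_deriveB (is_deriveZ 2 h2) h3).
  by have [dG ?] := choice H; exists dG.
have := @der_le _ G dG (a - B) (a + B) (ltW ab) (fun x xB => (dGE x xB).1).
move=> /(_ (fun x h => (dGE x ltac:(by case/andP: h => /ltW -> /ltW ->)).2)).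
rewrite /G /reg.
rewrite (_ : a - B - a = - B); last by ring.
rewrite (_ : a + B - a = B); last by ring.
rewrite sqrrN => H.
have h : (B ^+ 2 + e) `^ (- 4^-1) <= sing 0 B.
  by have := @reg_le_sing 0 e B e0; rewrite /reg subr0; apply; rewrite gt_eqF.
have : B * (B ^+ 2 + e) `^ (- 4^-1) <= B * sing 0 B by rewrite ler_pM2l.
lra.
Qed.

Lemma sing_integrable a (B : R) : 0 < B ->
  mu.-integrable `[a - B, a + B] (EFin \o sing a).
Proof.
move=> B0; apply/integrableP; split.
  by apply/measurable_EFinP; exact: measurable_sing.
apply: le_lt_trans (ltry (4 * (B * sing 0 B))).
pose g_ n x := (reg a (n.+1%:R^-1) x)%:E.
have n0 n : 0 < (n.+1%:R^-1 : R) by rewrite invr_gt0.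
have mg n : measurable_fun `[a - B, a + B] (g_ n).
  apply/measurable_EFinP; apply: measurable_funTS; apply: continuous_measurable_fun.
  exact: reg_cont.
have gmono x : nondecreasing_seq (g_ ^~ x).
  move=> n k nk; rewrite lee_fin; apply: reg_mono => //.
  by rewrite lef_pV2 ?posrE ?ltr0n// ler_nat ltnS.
have H := @cvg_monotone_convergence _ _ R mu `[a - B, a + B] (measurable_itv _) g_ mg.
have {}H := H (fun n x _ => ltac:(by rewrite lee_fin powR_ge0)) (fun x _ => gmono x).
apply: (@le_trans _ _ (\int[mu]_(x in `[(a - B)%R, (a + B)%R]) limn (g_ ^~ x))%E).
  apply: ge0_le_integral => //.
  - by apply/measurable_EFinP; apply: measurableT_comp => //; exact: measurable_sing.
  - by apply: (emeasurable_fun_cvg g_) => // x _; exact: ereal_nondecreasing_is_cvgn.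
  - move=> x _; rewrite /= ger0_norm ?sing_ge0//.
    (* At a itself [sing] has the default value 0, so nonnegativity of the limit is enough. *)
    have [->|xa] := eqVneq x a.
      rewrite /sing subrr expr0n/= powR0; last by rewrite oppr_eq0 invr_eq0.
      by apply: lime_ge; [exact: ereal_nondecreasing_is_cvgn|apply: nearW => n; rewrite lee_fin powR_ge0].
    have z0 : 0 < (x - a) ^+ 2 by rewrite exprn_even_gt0//= subr_eq0.
    rewrite le_eqVlt; apply/orP; left; apply/eqP/esym/cvg_lim => //.
    apply/cvg_EFin; first exact: nearW.
    rewrite /g_/= /reg /sing.
    have c1 : {for (x - a) ^+ 2, continuous (fun z : R => z `^ (- 4^-1))}.
      apply/differentiable_continuous/derivable1_diffP.
      exact: (@ex_derive _ _ _ _ _ _ _ (is_derive1_powR _ z0)).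
    apply: (@cvg_comp _ _ _ (fun n : nat => (x - a) ^+ 2 + n.+1%:R^-1) (fun z : R => z `^ (- 4^-1))); last exact: c1.
    have := @cvgD _ _ _ _ _ (fun=> (x - a) ^+ 2) _ _ _ (cvg_cst ((x - a) ^+ 2)) (@cvg_harmonic R).
    by rewrite addr0; apply.
rewrite -(cvg_lim _ H)//; apply: lime_le; first exact: cvgP H.
by apply: nearW => n; exact: reg_int.
Qed.

End singular_majorant.

(** * Powers of the right-hand side under an integrable majorant *)

Section majorant.
Context {R : realType}.
Notation mu := (@lebesgue_measure R).

(** A logarithm lies below any positive power: ln X = ln (X^b) / b <= X^b / b. *)
Lemma nonlin_le_powR (y b : R) : -1 < y -> 0 < b ->
  `|nonlin y| <= b^-1 * (1 + (1 + y)^-1) `^ b.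
Proof.
move=> y1 b0; rewrite ler0_norm ?nonlin_le0//.
have z0 : 0 < 1 + y by lra.
have X0 : 0 < 1 + (1 + y)^-1 by rewrite addr_gt0// invr_gt0.
apply: (@le_trans _ _ (ln (1 + (1 + y)^-1))).
  by rewrite lerNl; exact: nonlin_ge_ln.
have -> : ln (1 + (1 + y)^-1) = b^-1 * ln ((1 + (1 + y)^-1) `^ b).
  by rewrite ln_powR mulrA mulVf ?mul1r// gt_eqF.
by rewrite ler_pM2l ?invr_gt0// ltW// ln_sublinear// powR_gt0.
Qed.

Lemma rhs_powR_bound (g A mm kp L p : R) : 0 <= A -> 0 <= mm -> 0 < kp ->
  0 < L -> 0 < p -> exists2 C : R, 0 <= C & forall m c y d,
    0 <= m <= mm -> `|c| <= A -> `|g * y| <= A -> -1 < y -> 0 < d <= L ->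
    kp * d ^+ 2 <= 1 + y ->
    `|rhs g m c y| `^ p <= C * (d ^+ 2) `^ (- 4^-1).
Proof.
move=> A0 mm0 k0 L0 p0.
(* b p = 1 / 4, so the p-th power of X^b is C2^(1/4) (d^2)^(-1/4), the singularity of [sing]. By the
   quadratic lower bound and d <= L, X dominates 1 + 1 / (1 + y). *)
pose b : R := (4 * p)^-1; pose C2 : R := L ^+ 2 + kp^-1.
have b0 : 0 < b by rewrite invr_gt0 mulr_gt0.
have C20 : 0 < C2 by rewrite addr_gt0 ?exprn_gt0 ?invr_gt0.
pose B : R := 2 * A + mm * b^-1.
have B0 : 0 <= B by apply: addr_ge0; apply: mulr_ge0 => //; rewrite invr_ge0 ltW.
exists (B `^ p * C2 `^ (4^-1)); first by rewrite mulr_ge0 ?powR_ge0.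
move=> m c y d /andP[m0 mm'] cA gA y1 /andP[d0 dL] kd.
have d2 : 0 < d ^+ 2 by rewrite exprn_gt0.
pose X : R := C2 / d ^+ 2.
have X0 : 0 < X by rewrite divr_gt0.
have y0 : 0 < 1 + y by lra.
have Xb : 1 + (1 + y)^-1 <= X.
  rewrite /X mulrDl; apply: lerD.
    by rewrite ler_pdivlMr// mul1r lerXn2r ?nnegrE// ltW.
  by rewrite -invfM lef_pV2 ?posrE// mulr_gt0.
have X1 : 1 <= X by apply: le_trans Xb; rewrite lerDl invr_ge0 ltW.
have Xb1 : 1 <= X `^ b by rewrite -(powRr0 X) ler_powR// ltW.
have fb : `|nonlin y| <= b^-1 * X `^ b.
  apply: (le_trans (nonlin_le_powR y1 b0)); rewrite ler_pM2l; last by rewrite invr_gt0.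
  apply: ge0_ler_powR => //; rewrite ?nnegrE ?(ltW b0) ?(ltW X0)//.
  by rewrite addr_ge0// invr_ge0 ltW.
have rb : `|rhs g m c y| <= B * X `^ b.
  have h1 : m * `|nonlin y| <= mm * (b^-1 * X `^ b) by apply: ler_pM.
  have h2 : 2 * A <= 2 * A * X `^ b by rewrite ler_peMr// mulr_ge0.
  apply: (le_trans (ler_normD _ _)); apply: (@le_trans _ _ (A + mm * (b^-1 * X `^ b) + A)).
    apply: lerD => //; apply: (le_trans (ler_normB _ _)); apply: lerD => //.
    by rewrite normrM ger0_norm.
  by rewrite /B mulrDl -mulrA; lra.
have := ge0_ler_powR (ltW p0) (_ : `|rhs g m c y| \is Num.nneg) (_ : B * X `^ b \is Num.nneg) rb.
rewrite !nnegrE => /(_ (normr_ge0 _)) H; apply: le_trans.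
  by apply: H; rewrite mulr_ge0 ?powR_ge0.
rewrite powRM ?powR_ge0// -mulrA ler_wpM2l ?powR_ge0//.
rewrite -powRrM (_ : b * p = 4^-1); last by rewrite /b; field; rewrite gt_eqF.
rewrite /X powRM ?invr_ge0 ?(ltW C20) ?(ltW d2)//.
rewrite -[(d ^+ 2)^-1](powR_inv1 (ltW d2)) -powRrM.
by rewrite mulN1r.
Qed.

(** The positive odd multiples of L; together with their negatives they are the rupture points of
    the limit. *)
Definition sing_pt (L : R) (i : nat) : R := L + 2 * L * i%:R.

(** a is the image sg L + 2 L j of the end L under the folding of x; the cases on sg and j only
    rewrite it as plus or minus a [sing_pt]. *)
Lemma fold_sing (L x : R) : 0 < L -> exists y sg (j : int) a,
  [/\ 0 <= y <= L, sg = 1 \/ sg = - 1, x = sg * y + 2 * L * j%:~R,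
      exists i, a = sing_pt L i \/ a = - sing_pt L i & `|x - a| = L - y].
Proof.
move=> L0; have [y [sg [j [yL sgE xE]]]] := fold_half x L0.
exists y, sg, j, (sg * L + 2 * L * j%:~R); split => //; last first.
  rewrite xE opprD addrACA subrr addr0 -mulrBr normrM (_ : `|sg| = 1) ?mul1r.
    by rewrite distrC ger0_norm//; case/andP: yL; lra.
  by case: sgE => ->; rewrite ?normrN normr1.
rewrite /sing_pt; case: sgE => ->; case: j {xE} => n.
- by exists n; left; rewrite mul1r.
- by exists n; right; rewrite NegzE mulrNz mul1r -natr1; ring.
- case: n => [|n]; first by exists 0%N; right; rewrite mulN1r; ring.
  by exists n; left; rewrite -pmulrn -natr1; ring.
- by exists n.+1; right; rewrite NegzE mulrNz; ring.
Qed.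

Definition nonsing (L x : R) := forall i, x != sing_pt L i /\ x != - sing_pt L i.

Lemma ae_nonsing L : {ae mu, forall x, nonsing L x}.
Proof.
pose S := range (fun k : bool * nat => if k.1 then sing_pt L k.2 else - sing_pt L k.2).
have cS : countable S by apply: sub_countable (card_image_le _ _) (countableP _).
exists S; split.
- exact: countable_measurable.
- exact: countable_lebesgue_measure0.
- move=> x /= nx; apply: contrapT => nS; apply: nx => i.
  by split; apply/eqP => xE; apply: nS; [exists (true, i)|exists (false, i)].
Qed.

Definition sing_sum L N (x : R) : R :=
  \sum_(i < N) (sing (sing_pt L i) x + sing (- sing_pt L i) x).

Lemma sing_sum_integrable L N (b : R) :
  mu.-integrable `[- b, b] (EFin \o sing_sum L N).
Proof.
have H (a : R) : mu.-integrable `[- b, b] (EFin \o sing a).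
  have B0 : 0 < `|b| + `|a| + 1 by rewrite ltr_wpDl// addr_ge0.
  apply: integrableS (sing_integrable a B0) => //.
  move=> x /=; rewrite !in_itv/= => /andP[h1 h2].
  have := ler_norm a; have := ler_norm (- a); have := ler_norm b.
  rewrite normrN => *; apply/andP; split; lra.
rewrite (_ : EFin \o sing_sum L N = fun x => (\sum_(i < N)
    ((sing (sing_pt L i) x)%:E + (sing (- sing_pt L i) x)%:E))%E).
  apply: integrable_sum => // i _.
  by apply: integrableD => //; exact: H.
by apply/funext => x; rewrite /sing_sum /= -sumEFin.
Qed.

(** For |x| <= b the rupture point assigned to x has modulus at most |b| + L, so finitely many terms
    suffice; the others are nonnegative. *)
Lemma sing_sum_ge (L b : R) : 0 < L -> exists N, forall x, `|x| <= b ->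
  nonsing L x -> exists y sg (j : int),
  [/\ 0 <= y < L, sg = 1 \/ sg = - 1, x = sg * y + 2 * L * j%:~R &
      ((L - y) ^+ 2) `^ (- 4^-1) <= sing_sum L N x].
Proof.
move=> L0; pose q := `|b| / (2 * L).
have q0 : 0 <= q by rewrite divr_ge0// mulr_ge0// ltW.
exists (Num.Def.archi_bound q) => x xb nx.
have [y [sg [j [a [/andP[y0 yL] sgE xE [i aE] xa]]]]] := fold_sing x L0.
exists y, sg, j; split => //.
  rewrite y0 lt_neqAle yL andbT; apply/eqP => yE.
  move: xa; rewrite yE subrr => /eqP; rewrite normr_eq0 subr_eq0 => /eqP xaE.
  by have [/eqP h1 /eqP h2] := nx i; case: aE => aE; rewrite xaE aE in h1 h2.
have iN : (i < Num.Def.archi_bound q)%N.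
  rewrite -(ltr_nat R); apply: le_lt_trans (archi_boundP q0).
  rewrite /q ler_pdivlMr ?mulr_gt0//.
  have : `|a| <= `|b| + L.
    have := ler_normB x (x - a); rewrite opprB addrC subrK xa => h.
    by have := ler_norm b; lra.
  have -> : `|a| = L + 2 * L * i%:R.
    have : 0 <= L + 2 * L * i%:R by rewrite addr_ge0 ?mulr_ge0// ?ltW ?mulr_gt0.
    by move=> h; case: aE => ->; rewrite ?normrN ger0_norm.
  by lra.
rewrite /sing_sum (bigD1 (Ordinal iN))//=.
have h (k : nat) : 0 <= sing (sing_pt L k) x + sing (- sing_pt L k) x.
  by rewrite addr_ge0 ?sing_ge0.
have s0 : 0 <= \sum_(k < Num.Def.archi_bound q | k != Ordinal iN)
    (sing (sing_pt L k) x + sing (- sing_pt L k) x).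
  by apply: sumr_ge0 => k _; exact: h.
rewrite -xa real_normK ?num_real// -/(sing a x).
by case: aE => ->; have := sing_ge0 (sing_pt L i) x; have := sing_ge0 (- sing_pt L i) x; lra.
Qed.

End majorant.

(** * The limit profile *)

Section limit_functions.
Context {R : realType}.
Notation mu := (@lebesgue_measure R).
Variables (g k0 L : R).
Hypotheses (g0 : 0 < g) (k00 : 0 < k0) (kL : k0 * L = pi).
Variables (w w1 : nat -> R -> R) (m c : nat -> R) (mi ci : R) (wi wi1 : R -> R).
Hypothesis pw : forall n, profile g L (m n) (c n) (w n) (w1 n).
Hypothesis bw : forall n, onebump L (w1 n).
Hypothesis wL : forall n, w n L <= - 1 / 2.
Hypothesis cL : w n L @[n --> \oo] --> (- 1 : R).
Hypothesis cm : m n @[n --> \oo] --> mi.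
Hypothesis cc : c n @[n --> \oo] --> ci.
Hypothesis uw : ucvg w wi.
Hypothesis uw1 : ucvg w1 wi1.

Let L0 : 0 < L := half_period_gt0 k00 kL.
Let kp := kap g k0 L.
Let kp0 : 0 < kp := kap_gt0 g k00 kL.
Let sl := slmax g k0.
Let sl0 : 0 < sl := slmax_gt0 g0 k00 kL pw bw.
Let mm := mmax g k0.
Let m0 n : 0 < m n := bump_m_gt0 g0 k00 kL (pw n) (@bw n).
Let m_ge n : g / 8 <= m n := bump_m_ge g0 k00 kL (pw n) (@bw n) (wL n).
Let m_le n : m n <= mm := bump_m_le g0 k00 kL (pw n) (@bw n).
Let mm0 : 0 < mm := lt_le_trans (m0 0) (m_le 0).

Lemma lim_cvg x : w n x @[n --> \oo] --> wi x.
Proof. exact: unif_pointwise. Qed.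

Lemma lim_cvg1 x : w1 n x @[n --> \oo] --> wi1 x.
Proof. exact: unif_pointwise. Qed.

Arguments lim_cvg : clear implicits.
Arguments lim_cvg1 : clear implicits.

Lemma lim_der (x : R) : is_derive x 1 wi (wi1 x).
Proof.
move: x; apply: (@unif_limit_der _ w w1) => [|||//].
- by move=> n x; exact: prof_d1 (pw n) x.
- by move=> n; exact: prof_cont1 (pw n).
- by move=> x e e0; have [N HN] := uw e0; exists N => n Nn; exact: HN.
Qed.

Lemma lim_cont : continuous wi.
Proof. exact: der_continuous lim_der. Qed.

Lemma lim_cont1 : continuous wi1.
Proof.
apply: (@unif_limit_continuous _ w1) => [n|e e0]; first exact: prof_cont1 (pw n).
by have [N HN] := uw1 e0; exists N => x; exact: HN.
Qed.

Let cvg_uniq (u u' : nat -> R) (a b : R) : u n @[n --> \oo] --> a ->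
  u' n @[n --> \oo] --> b -> (forall n, u n = u' n) -> a = b.
Proof.
move=> h1 h2 /funext uE; rewrite uE in h1.
by rewrite -(cvg_lim _ h1)// -(cvg_lim _ h2).
Qed.

Let cvg_ge (u : nat -> R) (a b : R) : u n @[n --> \oo] --> a -> (forall n, b <= u n) -> b <= a.
Proof.
move=> h1 h2; rewrite -(cvg_lim _ h1)//; apply: limr_ge; first exact: cvgP h1.
exact: nearW.
Qed.

Let cvg_le (u : nat -> R) (a b : R) : u n @[n --> \oo] --> a -> (forall n, u n <= b) -> a <= b.
Proof.
move=> h1 h2; rewrite -(cvg_lim _ h1)//; apply: limr_le; first exact: cvgP h1.
exact: nearW.
Qed.

Lemma lim_even x : wi (- x) = wi x.
Proof.
by apply: (cvg_uniq (lim_cvg (- x)) (lim_cvg x)) => n; exact: prof_even (pw n) x.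
Qed.

Lemma lim_per x : wi (x + 2 * L) = wi x.
Proof.
by apply: (cvg_uniq (lim_cvg (x + 2 * L)) (lim_cvg x)) => n; exact: prof_per (pw n) x.
Qed.

Lemma lim_decr x y : 0 <= x -> x <= y -> y <= L -> wi y <= wi x.
Proof.
move=> x0 xy yL; rewrite -subr_ge0.
apply: (cvg_ge (cvgB (lim_cvg x) (lim_cvg y))) => n.
by rewrite subr_ge0; exact: bump_decr (pw n) (@bw n) _ _ x0 xy yL.
Qed.

Lemma lim_ge x : -1 <= wi x.
Proof. by apply: (cvg_ge (lim_cvg x)) => n; rewrite ltW// (prof_gt (pw n)). Qed.

Lemma lim_at_L : wi L = -1.
Proof. exact: (cvg_uniq (lim_cvg L) cL). Qed.

Lemma lim_height x : 0 <= x <= L -> kp * (L - x) ^+ 2 <= 1 + wi x.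
Proof.
move=> xL; rewrite -lerBlDl; apply: (cvg_ge (lim_cvg x)) => n.
by rewrite lerBlDl; exact: (lim_lower g0 k00 kL pw bw wL n xL).
Qed.

Lemma lim_m_ge : g / 8 <= mi.
Proof. exact: cvg_ge cm m_ge. Qed.

Lemma lim_m_le : mi <= mm.
Proof. exact: cvg_le cm m_le. Qed.

Lemma seq_le n x : w n x <= wmax g k0.
Proof.
have [y [sg [j [yL sgE ->]]]] := fold_half x L0.
rewrite (even_per_fold _ _ (prof_even (pw n)) (prof_per (pw n)) sgE).
exact: (lim_w_le g0 k00 kL pw bw wL n yL).
Qed.

Lemma seq_slope n x : `|w1 n x| <= sl.
Proof.
have [y [sg [j [yL sgE ->]]]] := fold_half x L0.
rewrite (per_int _ _ (prof_per1 (pw n))).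
case: sgE => ->; rewrite ?mul1r ?mulN1r ?(prof_odd (pw n)) ?normrN;
exact: (lim_slope_bound g0 k00 kL pw bw wL n yL).
Qed.

Lemma lim_le x : wi x <= wmax g k0.
Proof. by apply: (cvg_le (lim_cvg x)) => n; exact: seq_le. Qed.

Lemma lim_slope_le x : `|wi1 x| <= sl.
Proof. by apply: (cvg_le (cvg_norm (lim_cvg1 x))) => n; exact: seq_slope. Qed.

(** The quadratic lower bound survives the limit and forces y = L after folding. *)
Lemma lim_eq_min x : wi x = -1 <-> exists j : int, x = L + 2 * j%:~R * L \/
  x = - L + 2 * j%:~R * L.
Proof.
split => [xE|[j [] ->]].
- have [y [sg [j [yL sgE xE']]]] := fold_half x L0.
  move: xE; rewrite xE' (even_per_fold _ _ lim_even lim_per sgE) => yE.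
  have := lim_height yL; rewrite yE subrr pmulr_rle0// => h.
  have {}h : y = L.
    apply/esym/eqP; rewrite -subr_eq0 -sqrf_eq0; apply/eqP/le_anti.
    by rewrite h sqr_ge0.
  by exists j; case: sgE => ->; [left|right]; rewrite h; ring.
- rewrite -lim_at_L (_ : 2 * j%:~R * L = 2 * L * j%:~R); last by ring.
  exact: (per_int _ _ lim_per).
- rewrite -lim_at_L (_ : 2 * j%:~R * L = 2 * L * j%:~R); last by ring.
  by rewrite (per_int _ _ lim_per) lim_even.
Qed.

Lemma lim_pos x : nonsing L x -> 0 < 1 + wi x.
Proof.
move=> nx; rewrite -ltrBlDl sub0r lt_neqAle lim_ge andbT eq_sym; apply/eqP.
have [y [sg [j [a [yL sgE xE [i aE] xa]]]]] := fold_sing x L0.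
rewrite xE (even_per_fold _ _ lim_even lim_per sgE) => yE.
have := lim_height yL; rewrite yE subrr pmulr_rle0// => h.
have {}h : y = L.
  apply/esym/eqP; rewrite -subr_eq0 -sqrf_eq0; apply/eqP/le_anti.
  by rewrite h sqr_ge0.
move: xa; rewrite h subrr => /eqP; rewrite normr_eq0 subr_eq0 => /eqP xaE.
by have [/eqP h1 /eqP h2] := nx i; case: aE => aE; rewrite xaE aE in h1 h2.
Qed.

Lemma lim_incr x y : - L <= x -> x <= y -> y <= 0 -> wi x <= wi y.
Proof.
move=> Lx xy y0; rewrite -(lim_even x) -(lim_even y).
by apply: lim_decr; lra.
Qed.

Definition lim_rhs x := rhs g mi ci (wi x).

Lemma seq_rhs_cvg x : nonsing L x ->
  rhs g (m n) (c n) (w n x) @[n --> \oo] --> lim_rhs x.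
Proof.
move=> /lim_pos px; have p1 : -1 < wi x by lra.
have cf : {for wi x, continuous (@nonlin R)}.
  apply/differentiable_continuous/derivable1_diffP.
  exact: (@ex_derive _ _ _ _ _ _ _ (is_derive_nonlin p1)).
rewrite /lim_rhs /rhs; apply: cvgD => //; apply: cvgB.
  by apply: cvgM; [exact: cvg_cst|exact: lim_cvg].
apply: cvgM => //; apply: (cvg_comp _ _ (lim_cvg x)); exact: cf.
Qed.

(* [1 + w n x >= kap (L - x) ^ 2] makes the singularity of [rhs] logarithmic. *)
Lemma rhs_dominated (p b : R) : 0 < p -> exists G : R -> R,
  mu.-integrable `[- b, b] (EFin \o G) /\
  forall x : R, - b <= x <= b -> nonsing L x ->
    `|lim_rhs x| `^ p <= G x /\ forall n, `|rhs g (m n) (c n) (w n x)| `^ p <= G x.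
Proof.
move=> p0; pose A : R := 2 * mm + g * (wmax g k0 + 1).
have wm0 : 0 < wmax g k0 by rewrite divr_gt0// mulr_gt0.
have gA0 : 0 < g * (wmax g k0 + 1) by apply: mulr_gt0 => //; have := wm0; lra.
have A0 : 0 <= A by apply: addr_ge0; [apply: mulr_ge0 => //; exact: ltW|exact: ltW].
have [C C0 HC] := @rhs_powR_bound _ g A mm kp L p A0 (ltW mm0) kp0 L0 p0.
have [N HN] := @sing_sum_ge _ L b L0.
exists (fun x => C * sing_sum L N x); split.
  by apply: integrable_scale => //; exact: sing_sum_integrable.
have gy (y : R) : -1 <= y -> y <= wmax g k0 -> `|g * y| <= A.
  move=> y1 y2; rewrite normrM gtr0_norm// /A.
  have : g * `|y| <= g * (wmax g k0 + 1).
    by rewrite ler_pM2l// ler_norml; apply/andP; split; have := wm0; lra.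
  by have := mm0; lra.
move=> x xb nx; have := HN x; rewrite ler_norml => /(_ xb nx).
move=> [y [sg [j [/andP[y0 yL] sgE xE le]]]].
have yL' : 0 <= y <= L by rewrite y0 ltW.
have yd : 0 < L - y <= L by apply/andP; split; lra.
split => [|n]; apply: (le_trans _ (ler_wpM2l C0 le)); apply: HC => //.
- by rewrite lim_m_le (le_trans _ lim_m_ge)// divr_ge0// ltW.
- apply: (cvg_le (cvg_norm cc)) => n; apply: (le_trans (lim_c_bound g0 k00 kL pw bw wL n)).
  by rewrite /A -/mm lerDl ltW.
- by apply: gy; [exact: lim_ge|exact: lim_le].
- by have := lim_pos nx; lra.
- by rewrite xE (even_per_fold _ _ lim_even lim_per sgE); exact: lim_height.
- by rewrite (ltW (m0 n)) m_le.
- apply: (le_trans (lim_c_bound g0 k00 kL pw bw wL n)).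
  by rewrite /A -/mm lerDl ltW.
- by apply: gy; [rewrite ltW// (prof_gt (pw n))|exact: seq_le].
- exact: prof_gt (pw n) x.
- rewrite xE (even_per_fold _ _ (prof_even (pw n)) (prof_per (pw n)) sgE).
  exact: (lim_lower g0 k00 kL pw bw wL n yL').
Qed.

End limit_functions.

(** * Strong convergence *)

Section strong_to_weak.
Context {R : realType}.
Notation mu := (@lebesgue_measure R).

Lemma measurable_inv (A : set R) : measurable_fun A (fun x : R => x^-1).
Proof.
apply: measurable_funTS; rewrite -(setUv [set (0 : R)]).
have m1 : measurable (~` [set (0 : R)]) by exact: measurableC.
apply/measurable_funU => //; split; first exact: measurable_fun_set1.
apply: open_continuous_measurable_fun.
  by apply: closed_openC; exact: (accessible_closed_set1 (hausdorff_accessible (@Rhausdorff R))).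
by move=> x; rewrite inE /= => /eqP x0; exact: inv_continuous.
Qed.

Lemma measurable_nonlin (A : set R) : measurable_fun A (@nonlin R).
Proof.
apply: measurable_funTS.
have m2 : measurable_fun setT (fun y : R => (2 + y)^-1).
  apply: (@measurableT_comp _ _ _ _ _ _ (fun z : R => z^-1)); first exact: measurable_inv.
  exact: measurable_funD.
apply: measurable_funD => //.
apply: (@measurableT_comp _ _ _ _ _ _ (@ln R)); first exact: measurable_ln.
by apply: measurable_funM => //; exact: measurable_funD.
Qed.

Lemma measurable_rhs (A : set R) (g m c : R) (u : R -> R) : measurable_fun setT u ->
  measurable_fun A (fun x => rhs g m c (u x)).
Proof.
move=> mu; apply: measurable_funTS; apply: measurable_funD => //.
apply: measurable_funB; first by apply: measurable_funM.
by apply: measurable_funM => //; apply: (@measurableT_comp _ _ _ _ _ _ (@nonlin R)) => //; exact: measurable_nonlin.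
Qed.

Lemma cvg_sup_uniform (u_ : nat -> R -> R) (u : R -> R) :
  ucvg u_ u -> {uniform setT, u_ @ \oo --> u}.
Proof.
move=> H P /uniform_nbhs [E [entE EP]].
have [e /= e0 eE] : exists2 e : R, 0 < e & forall a b : R, `|a - b| < e -> E (a, b).
  move: entE; rewrite -entourage_ballE => -[e /= e0 eE]; exists e => // a b ab.
  exact: eE.
have [N HN] := H (e / 2) ltac:(by rewrite divr_gt0).
exists N => // n /= Nn; apply: EP => x _ /=; apply: eE.
rewrite distrC; apply: (le_lt_trans (HN n Nn x)).
by rewrite ltr_pdivrMr// ltr_pMr// ltr1n.
Qed.

(** The difference is written [- 1 * u x + u_ n x] to match the linearity clause of
    [bounded_functional]; the bound on l then turns norm convergence into convergence of its
    values. *)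
Lemma weak_of_strong (V : set (R -> R)) (N : (R -> R) -> \bar R)
    (u_ : nat -> R -> R) u :
  (forall n, V (u_ n)) -> V u -> (forall n, V (fun x => - 1 * u x + u_ n x)) ->
  (forall v, 0 <= N v)%E ->
  N (fun x => - 1 * u x + u_ n x)%R @[n --> \oo] --> 0%E ->
  weak_cvg V N u_ u.
Proof.
move=> Vn Vu Vd N0 Nd; split => // l [lin [C HC]].
apply/cvgrPdist_le => e e0.
have C1 : 0 < `|C| + 1 by rewrite ltr_wpDl.
apply: filterS (ereal_cvg0_le _ Nd (divr_gt0 e0 C1)) => n Hn.
have -> : l u - l (u_ n) = - l (fun x => - 1 * u x + u_ n x).
  by rewrite lin//; ring.
rewrite normrN -lee_fin; apply: (le_trans (HC _ (Vd n))).
apply: (@le_trans _ _ ((`|C| + 1)%:E * N (fun x => - 1 * u x + u_ n x)%R)%E).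
  by rewrite lee_wpmul2r// lee_fin; have := ler_norm C; lra.
apply: (@le_trans _ _ ((`|C| + 1)%:E * (e / (`|C| + 1))%:E)%E).
  by rewrite lee_wpmul2l// lee_fin ltW.
by rewrite -EFinM lee_fin mulrC divfK// gt_eqF.
Qed.

Lemma powRD_le (p G a b : R) : 0 < p -> `|a| `^ p <= G -> `|b| `^ p <= G ->
  `|- 1 * a + b| `^ p <= 2 `^ p * G.
Proof.
move=> p0 aG bG.
apply: (@le_trans _ _ ((2 * Num.max `|a| `|b|) `^ p)).
  apply: (ge0_ler_powR (ltW p0)); rewrite ?nnegrE//.
  apply: (le_trans (ler_normD _ _)); rewrite mulN1r normrN.
  by rewrite mulr_natl mulr2n lerD// le_max lexx ?orbT.
rewrite powRM//.
rewrite ler_wpM2l ?powR_ge0//.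
by case: (leP `|a| `|b|).
Qed.

Lemma Lp_norm_diff_cvg0 (A : set R) (p : R) (u_ : nat -> R -> R) (u G : R -> R) :
  0 < p -> measurable A -> (forall n, measurable_fun A (u_ n)) ->
  measurable_fun A u -> {ae mu, forall x, A x -> u_ n x @[n --> \oo] --> u x} ->
  mu.-integrable A (EFin \o G) ->
  {ae mu, forall x, A x -> `|u x| `^ p <= G x /\ forall n, `|u_ n x| `^ p <= G x} ->
  Lp_norm A p (fun x => - 1 * u x + u_ n x) @[n --> \oo] --> 0%E.
Proof.
move=> p0 mA mu_ mu' cu iG HG.
apply: (@Lp_norm_cvg0 _ A p (fun n x => - 1 * u x + u_ n x) (fun x => 2 `^ p * G x)) => //.
- by move=> n; apply: measurable_funD => //; exact: measurable_funM.
- apply: ae_mono cu => x H Ax; have h := H Ax.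
  have := @cvgD _ _ _ _ _ _ _ _ _ (cvg_cst (- 1 * u x)) h.
  by rewrite (_ : - 1 * u x + u x = 0) ?mulN1r ?addNr//; apply.
- exact: integrable_scale.
- apply: ae_mono HG => x H Ax n; have [h1 h2] := H Ax.
  exact: powRD_le.
Qed.

Lemma Lp_diff (A : set R) (p : R) (v u : R -> R) (G : R -> R) :
  0 < p -> measurable A -> measurable_fun A v ->
  measurable_fun A u -> mu.-integrable A (EFin \o G) ->
  {ae mu, forall x, A x -> `|u x| `^ p <= G x /\ `|v x| `^ p <= G x} ->
  Lp A p (fun x => - 1 * u x + v x).
Proof.
move=> p0 mA mv mu' iG HG.
apply: (@dominated_Lp _ A p _ (fun x => 2 `^ p * G x)) => //.
- by apply: measurable_funD => //; exact: measurable_funM.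
- exact: integrable_scale.
- by apply: ae_mono HG => x H Ax; have [h1 h2] := H Ax; exact: powRD_le.
Qed.

Lemma integrable_cst_compact (B : R) (K : set R) : compact K ->
  mu.-integrable K (EFin \o (fun=> B)).
Proof.
move=> cK; apply: continuous_compact_integrable; first exact: cK.
by apply: continuous_subspaceT => x; exact: cvg_cst.
Qed.

End strong_to_weak.

(** * Regularity of the limit and the modes of convergence *)

Section limit_spaces.
Context {R : realType}.
Notation mu := (@lebesgue_measure R).
Variables (g k0 : R).
Hypotheses (g0 : 0 < g) (k00 : 0 < k0).
Let L := pi / k0.
Variables (w : nat -> R -> R) (m c : nat -> R) (mi ci : R) (wi wi1 : R -> R).
Hypothesis sw : forall n, smooth (w n).
Hypothesis pw : forall n, profile g L (m n) (c n) (w n) (derive1 (w n)).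
Hypothesis bw : forall n, onebump L (derive1 (w n)).
Hypothesis wL : forall n, w n L <= - 1 / 2.
Hypothesis cL : w n L @[n --> \oo] --> (- 1 : R).
Hypothesis cm : m n @[n --> \oo] --> mi.
Hypothesis cc : c n @[n --> \oo] --> ci.
Hypothesis uw : ucvg w wi.
Hypothesis uw1 : ucvg (fun n => derive1 (w n)) wi1.

Let kL : k0 * L = pi.
Proof. by rewrite /L mulrC divfK// gt_eqF. Qed.

Let L0 : 0 < L := half_period_gt0 k00 kL.

(** The derivatives of the limit up to order 2, the second read off from the equation; at rupture
    points, a null set, it takes a default value. *)
Let lw j := if j is 0%N then wi else if j is 1%N then wi1 else lim_rhs g mi ci wi.

Let d2 n : derive1n 2 (w n) = fun x => rhs g (m n) (c n) (w n x).
Proof.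
apply/funext => x; rewrite derive1nS derive1n1.
exact: derive1_is_derive (prof_d2 (pw n) x).
Qed.

Let d3 n x : derive1n 3 (w n) x = (g - m n * dnonlin (w n x)) * derive1 (w n) x.
Proof. by rewrite derive1nS d2; exact: derive1_is_derive (prof_d3 (pw n) x). Qed.

Let wi_cont : continuous wi := lim_cont pw uw uw1.

Let mw j : measurable_fun setT (lw j).
Proof.
have h0 : measurable_fun setT wi by apply: continuous_measurable_fun; exact: lim_cont pw uw uw1.
case: j => [//|[|j]]; first by apply: continuous_measurable_fun; exact: lim_cont1 pw uw1.
exact: measurable_rhs.
Qed.

Let mwn j n : measurable_fun setT (derive1n j (w n)).
Proof.
have h : continuous (derive1n j (w n)) := smooth_continuous (@sw n).
exact: continuous_measurable_fun h.
Qed.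

Let conv j : (j <= 2)%N ->
  {ae mu, forall x, derive1n j (w n) x @[n --> \oo] --> lw j x}.
Proof.
case: j => [_|[_|[_|//]]].
- by apply: aeW => x; exact: (lim_cvg uw).
- by apply: aeW => x; under eq_fun do rewrite derive1n1; exact: (lim_cvg1 uw1).
- apply: ae_mono (ae_nonsing L) => x nx; under eq_fun do rewrite d2.
  exact: (seq_rhs_cvg g0 k00 kL pw bw wL cm cc uw nx).
Qed.

Let dom j (p b : R) : 0 < p -> (j <= 2)%N -> exists G : R -> R,
  mu.-integrable `[- b, b] (EFin \o G) /\
  {ae mu, forall x, - b <= x <= b ->
    `|lw j x| `^ p <= G x /\ forall n, `|derive1n j (w n) x| `^ p <= G x}.
Proof.
move=> p0; have bounded (u : R -> R) (u_ : nat -> R -> R) (B : R) :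
    (forall x, `|u x| <= B) -> (forall n x, `|u_ n x| <= B) -> exists G : R -> R,
  mu.-integrable `[- b, b] (EFin \o G) /\
  {ae mu, forall x, - b <= x <= b ->
    `|u x| `^ p <= G x /\ forall n, `|u_ n x| `^ p <= G x}.
  move=> uB unB; exists (fun=> B `^ p); split; first by apply: integrable_cst_compact; exact: segment_compact.
  have B0 : 0 <= B by apply: le_trans (uB 0); exact: normr_ge0.
  have H (a : R) : `|a| <= B -> `|a| `^ p <= B `^ p.
    by move=> aB; apply: (ge0_ler_powR (ltW p0)); rewrite ?nnegrE.
  by apply: aeW => x _; split => [|n]; apply: H.
have wm0 : 0 < wmax g k0.
  apply: lt_le_trans (seq_le g0 k00 kL pw bw wL 0 0).
  exact: bump_max k00 kL (pw 0) (@bw 0).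
case: j => [_|[_|[_|//]]].
- apply: (@bounded wi w (wmax g k0 + 1)) => [x|n x]; rewrite ler_norml; apply/andP.
    have := lim_ge pw uw x; have := lim_le g0 k00 kL pw bw wL uw x.
    by move=> h1 h2; split; lra.
  have := prof_gt (pw n) x; have := seq_le g0 k00 kL pw bw wL n x.
  by move=> h1 h2; split; lra.
- apply: (@bounded wi1 (fun n => derive1 (w n)) (slmax g k0)).
    exact: (lim_slope_le g0 k00 kL pw bw wL uw1).
  exact: (seq_slope g0 k00 kL pw bw wL).
- have [G [iG HG]] := rhs_dominated g0 k00 kL pw bw wL cm cc uw b p0.
  exists G; split => //; apply: ae_mono (ae_nonsing L) => x nx xb.
  have [h1 h2] := HG x xb nx; split => // n; rewrite d2; exact: h2.
Qed.

Let sub_itv (K : set R) : compact K -> exists b : R, K `<=` `[- b, b].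
Proof.
move=> /compact_itv[b b0 Kb]; exists b => x /Kb /andP[h1 h2].
by rewrite /= in_itv/= !ltW.
Qed.

Let domK j (p : R) (K : set R) : 0 < p -> (j <= 2)%N -> compact K -> exists G : R -> R,
  mu.-integrable K (EFin \o G) /\
  {ae mu, forall x, K x ->
    `|lw j x| `^ p <= G x /\ forall n, `|derive1n j (w n) x| `^ p <= G x}.
Proof.
move=> p0 j2 cK; have [b Kb] := sub_itv cK; have [G [iG HG]] := dom b p0 j2.
exists G; split.
  by apply: integrableS iG => //; exact: compact_measurable.
apply: ae_mono HG => x H Kx; apply: H.
by have := Kb x Kx; rewrite /= in_itv.
Qed.

Lemma lim_wderiv j : (j <= 2)%N -> is_wderiv setT j wi (lw j).
Proof.
move=> j2; apply: (@is_wderiv_limit _ _ j w (fun n => derive1n j (w n))).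
- exact: openT.
- by move=> n; apply: smooth_wderiv => //; exact: openT.
- exact: (mw 0).
- exact: mw.
- by apply: ae_mono (conv (leq0n 2)) => x h _; exact: h.
- by apply: ae_mono (conv j2) => x h _; exact: h.
- move=> K cK _; have [G0 [iG0 HG0]] := domK ltr01 (leq0n 2) cK.
  have [G [iG HG]] := domK ltr01 j2 cK.
  exists (fun x => 1 * G0 x + G x); split.
    by apply: integrable_lin => //; exact: compact_measurable.
  apply: ae_mono (ae_and HG0 HG) => x [h0 h] Kx n.
  have [] := h0 Kx; have [] := h Kx; rewrite !powRr1// => a1 a2 b1 b2.
  have := a2 n; have := b2 n; rewrite !powRr1// => a3 b3.
  have G0_ge0 := le_trans (normr_ge0 _) b1; have G_ge0 := le_trans (normr_ge0 _) a1.
  rewrite derive1n0 in a3; by rewrite mul1r; split; lra.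
Qed.

Let diff n x := - 1 * wi x + w n x.
Let ldiff j n x := - 1 * lw j x + derive1n j (w n) x.

Let diff_wderiv j n : (j <= 2)%N -> is_wderiv setT j (diff n) (ldiff j n).
Proof.
move=> j2; apply: is_wderiv_lin; first exact: lim_wderiv.
by apply: smooth_wderiv => //; exact: openT.
Qed.

Lemma lim_W_per p : 1 <= p -> W_per k0 2 p wi.
Proof.
move=> p1; have p0 : 0 < p by exact: lt_le_trans p1.
split; first by move=> x; rewrite -mulrA; exact: (lim_per pw uw x).
move=> j j2; exists (lw j); first exact: lim_wderiv.
move=> K cK _; have [G [iG HG]] := domK p0 j2 cK.
apply: (dominated_Lp p0 _ _ iG).
- exact: compact_measurable.
- exact: measurable_funTS.
- by apply: ae_mono HG => x H Kx; have [] := H Kx.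
Qed.

Lemma seq_W_per p n : 1 <= p -> W_per k0 2 p (w n).
Proof.
move=> p1; have p0 : 0 < p by exact: lt_le_trans p1.
split; first by move=> x; rewrite -mulrA; exact: (prof_per (pw n) x).
move=> j j2; exists (derive1n j (w n)); first by apply: smooth_wderiv => //; exact: openT.
move=> K cK _; have [G [iG HG]] := domK p0 j2 cK.
apply: (dominated_Lp p0 _ _ iG).
- exact: compact_measurable.
- exact: measurable_funTS.
- by apply: ae_mono HG => x H Kx; have [] := H Kx.
Qed.

Let diff_W_per p n : 1 <= p -> W_per k0 2 p (diff n).
Proof.
move=> p1; have p0 : 0 < p by exact: lt_le_trans p1.
split.
  move=> x; have [h1 _] := lim_W_per p1; have [h2 _] := seq_W_per n p1.
  by rewrite /diff h1 h2.
move=> j j2; exists (ldiff j n); first exact: diff_wderiv.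
move=> K cK _; have [G [iG HG]] := domK p0 j2 cK.
apply: (Lp_diff p0 _ _ _ iG).
- exact: compact_measurable.
- exact: measurable_funTS.
- exact: measurable_funTS.
- by apply: ae_mono HG => x H Kx; have [] := H Kx.
Qed.

Let diff_norm p : 1 <= p -> W_norm k0 2 p (diff n) @[n --> \oo] --> 0%E.
Proof.
move=> p1; have p0 : 0 < p by exact: lt_le_trans p1.
have mcell : measurable (cell k0) by exact: measurable_cell.
have H j : (j <= 2)%N ->
    Lp_norm (cell k0) p (wderiv setT j (diff n)) @[n --> \oo] --> 0%E.
  move=> j2; have E n : Lp_norm (cell k0) p (wderiv setT j (diff n)) =
      Lp_norm (cell k0) p (ldiff j n).
    have dw := diff_wderiv n j2.
    apply: Lp_norm_ae => //.
    - have [_ [mm _ _] _] := is_wderiv_wderiv dw; exact: measurable_funS mm.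
    - have [_ [mm _ _] _] := dw; exact: measurable_funS mm.
    - by apply: ae_mono (wderiv_ae dw) => x h _; exact: h.
  under eq_fun do rewrite E.
  have [G [iG HG]] := dom L p0 j2.
  apply: (@Lp_norm_diff_cvg0 _ _ p (fun n => derive1n j (w n)) (lw j) G) => //.
  - by move=> n; exact: measurable_funTS.
  - exact: measurable_funTS.
  - by apply: ae_mono (conv j2) => x h _; exact: h.
  - apply: integrableS iG => // x.
    by rewrite cellE// -/L /= !in_itv/= => /andP[/ltW -> /ltW ->].
  - apply: ae_mono HG => x h xc; apply: h.
    by move: xc; rewrite cellE// -/L /= !in_itv/= => /andP[/ltW -> /ltW ->].
rewrite /W_norm; under eq_fun do rewrite !big_ord_recl big_ord0 adde0.
have := cvgeD _ (H 0%N isT) (cvgeD _ (H 1%N isT) (H 2%N isT)).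
by rewrite !adde0; apply.
Qed.

Lemma seq_weak_cvg p : 1 <= p ->
  weak_cvg (W_per k0 2 p) (W_norm k0 2 p) w wi.
Proof.
move=> p1; apply: weak_of_strong.
- by move=> n; exact: seq_W_per.
- exact: lim_W_per.
- by move=> n; exact: diff_W_per.
- by move=> v; apply: sume_ge0 => j _; exact: Lnorm_ge0.
- exact: diff_norm.
Qed.

Let D := [set x | 0 < 1 + wi x].
Let l3 x := (g - mi * dnonlin (wi x)) * wi1 x.

Let wi1_cont : continuous wi1 := lim_cont1 pw uw1.

Let oD : open D.
Proof.
have -> : D = wi @^-1` [set y | -1 < y] by apply/seteqP; split => x /=; rewrite /D /=; lra.
by apply: open_comp => [x _|]; [exact: wi_cont|exact: open_gt].
Qed.

Let l3_cont x : D x -> {for x, continuous l3}.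
Proof.
move=> Dx; have p1 : -1 < wi x by move: Dx; rewrite /D /=; lra.
rewrite /continuous_at /l3; apply: cvgM; last exact: wi1_cont.
apply: cvgB; first exact: cvg_cst.
apply: cvgM; first exact: cvg_cst.
exact: (cvg_comp _ _ (@wi_cont x) (dnonlin_cont p1)).
Qed.

Let ml3 : measurable_fun D l3.
Proof.
apply: open_continuous_measurable_fun => // x; rewrite inE; exact: l3_cont.
Qed.

Let conv3 x : D x -> derive1n 3 (w n) x @[n --> \oo] --> l3 x.
Proof.
move=> Dx; have p1 : -1 < wi x by move: Dx; rewrite /D /=; lra.
under eq_fun do rewrite d3.
apply: cvgM; last exact: (lim_cvg1 uw1).
apply: cvgB; first exact: cvg_cst.
by apply: cvgM => //; exact: (@cvg_comp _ _ _ (fun n => w n x) (@dnonlin R) _ _ _ (lim_cvg uw (x := x)) (dnonlin_cont p1)).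
Qed.

(** The limit is Lipschitz with value -1 at L, so 1 + wi >= d keeps the folded point at distance d /
    slmax from L; [lim_lower] then bounds every profile from below, for all n and not only for large
    n. *)
Let lowerK (K : set R) : compact K -> K `<=` D -> exists2 d : R, 0 < d &
  forall x, K x -> d <= 1 + wi x /\ forall n, d <= 1 + w n x.
Proof.
move=> cK KD; have [->|K0] := eqVneq K set0; first by exists 1.
move: K0 => /set0P K0.
have [x0 x0K minx] := compact_EVT_min K0 cK (continuous_subspaceT wi_cont).
have d0 : 0 < 1 + wi x0 by apply: KD; move: x0K; rewrite inE.
set d := 1 + wi x0 in d0.
have sl0 := slmax_gt0 g0 k00 kL pw bw; have kp0 := kap_gt0 g k00 kL.
have e0 : 0 < kap g k0 L * (d / slmax g k0) ^+ 2.
  by rewrite mulr_gt0// exprn_gt0// divr_gt0.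
exists (Num.min d (kap g k0 L * (d / slmax g k0) ^+ 2)); first by rewrite lt_min d0.
move=> x Kx; have dx : d <= 1 + wi x by rewrite /d lerD2l; apply: minx; rewrite inE.
split => [|n]; first by rewrite ge_min dx.
rewrite ge_min; apply/orP; right.
have [y [sg [j [yL sgE xE]]]] := fold_half x L0; have /andP[y0 yL'] := yL.
rewrite xE (even_per_fold _ _ (prof_even (pw n)) (prof_per (pw n)) sgE).
rewrite xE (even_per_fold _ _ (lim_even pw uw) (lim_per pw uw) sgE) in dx.
apply: le_trans (lim_lower g0 k00 kL pw bw wL n yL).
rewrite ler_pM2l// lerXn2r ?nnegrE ?divr_ge0 ?(ltW d0) ?(ltW sl0) ?subr_ge0//.
rewrite ler_pdivrMr//.
have := @der_lip _ wi wi1 y L (slmax g k0) yL' (fun z _ => lim_der pw uw uw1 z)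
  (fun z _ => lim_slope_le g0 k00 kL pw bw wL uw1 z).
rewrite (lim_at_L cL uw) ler_norml => /andP[h1 _].
by rewrite mulrC; lra.
Qed.

Let dom3 (K : set R) : compact K -> K `<=` D -> exists2 B : R, 0 <= B &
  forall x, K x -> `|l3 x| <= B /\ forall n, `|derive1n 3 (w n) x| <= B.
Proof.
move=> cK KD; have [d d0 dK] := lowerK cK KD.
have sl0 := slmax_gt0 g0 k00 kL pw bw.
have m0 n : 0 <= m n by rewrite ltW// (bump_m_gt0 g0 k00 kL (pw n) (@bw n)).
have dm : 0 < dnonlin (-1 + d) by apply: dnonlin_gt0; lra.
have mm0 : 0 <= mmax g k0 := le_trans (m0 0) (bump_m_le g0 k00 kL (pw 0) (@bw 0)).
have B0 : 0 <= g + mmax g k0 * dnonlin (-1 + d).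
  by apply: addr_ge0; [exact: ltW|apply: mulr_ge0 => //; exact: ltW].
exists ((g + mmax g k0 * dnonlin (-1 + d)) * slmax g k0).
  by apply: mulr_ge0 => //; exact: ltW.
have H (mu y z : R) : 0 <= mu -> mu <= mmax g k0 -> d <= 1 + y -> `|z| <= slmax g k0 ->
    `|(g - mu * dnonlin y) * z| <= (g + mmax g k0 * dnonlin (-1 + d)) * slmax g k0.
  move=> mu0 mu1 dy zs; rewrite normrM; apply: ler_pM => //.
  have dn0 : 0 < dnonlin y by apply: dnonlin_gt0; lra.
  apply: (le_trans (ler_normB _ _)); rewrite (gtr0_norm g0) lerD2l.
  rewrite normrM (ger0_norm mu0) (gtr0_norm dn0); apply: ler_pM => //; first exact: ltW.
  by apply: dnonlin_le; lra.
move=> x Kx; have [h1 h2] := dK x Kx; split => [|n].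
  apply: H => //; last exact: (lim_slope_le g0 k00 kL pw bw wL uw1).
    apply: le_trans (lim_m_ge g0 k00 kL pw bw wL cm); rewrite divr_ge0//; exact: ltW.
  exact: (lim_m_le g0 k00 kL pw bw cm).
rewrite d3; apply: H => //; first exact: (bump_m_le g0 k00 kL (pw n) (@bw n)).
exact: (seq_slope g0 k00 kL pw bw wL).
Qed.

Lemma lim_wderiv3 : is_wderiv D 3 wi l3.
Proof.
apply: (@is_wderiv_limit _ _ 3 w (fun n => derive1n 3 (w n))) => //.
- by move=> n; apply: smooth_wderiv => //; exact: sw.
- by apply: measurable_funTS; exact: continuous_measurable_fun.
- by apply: aeW => x _; exact: (lim_cvg uw).
- by apply: aeW => x; exact: conv3.
- move=> K cK KD; have [B B0 HB] := dom3 cK KD.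
  exists (fun=> B + wmax g k0 + 1); split; first exact: integrable_cst_compact.
  have wm0 : 0 < wmax g k0.
    apply: lt_le_trans (seq_le g0 k00 kL pw bw wL 0 0).
    exact: bump_max k00 kL (pw 0) (@bw 0).
  apply: aeW => x Kx n; have [_ h2] := HB x Kx; split.
    rewrite ler_norml; have := prof_gt (pw n) x.
    by have := seq_le g0 k00 kL pw bw wL n x => ? ?; apply/andP; split; lra.
  by apply: (le_trans (h2 n)); lra.
Qed.

Lemma lim_Lp_loc3 : Lp_loc D 2 l3.
Proof.
move=> K cK KD; have [B B0 HB] := dom3 cK KD.
apply: (@dominated_Lp _ K 2 l3 (fun=> B `^ 2)) => //.
- exact: compact_measurable.
- by apply: measurable_funS ml3 => //; exact: open_measurable.
- exact: integrable_cst_compact.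
- apply: aeW => x /HB[h _]; apply: ge0_ler_powR; rewrite ?nnegrE//.
Qed.

(** On K the third derivatives are uniformly bounded and converge pointwise, hence strongly. The
    chosen representative [wderiv D 3 wi] is known to be l3 almost everywhere, and the bounds are
    transferred in that sense. *)
Lemma lim_weak3 : weak_cvg_Lp_loc D 2 (fun n => derive1n 3 (w n)) (wderiv D 3 wi).
Proof.
move=> K cK KD; have [B B0 HB] := dom3 cK KD.
have mK : measurable K by exact: compact_measurable.
have aeE := wderiv_ae lim_wderiv3.
have mwd : measurable_fun K (wderiv D 3 wi).
  have [_ [mm _ _] _] := is_wderiv_wderiv lim_wderiv3.
  by apply: measurable_funS mm => //; exact: open_measurable.
have mdK n : measurable_fun K (derive1n 3 (w n)) by exact: measurable_funTS.
have pB (a : R) : `|a| <= B -> `|a| `^ 2 <= B `^ 2.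
  by move=> aB; apply: ge0_ler_powR; rewrite ?nnegrE.
have iB := integrable_cst_compact (B `^ 2) cK.
have weak_dom : {ae mu, forall x, K x -> `|wderiv D 3 wi x| `^ 2 <= B `^ 2 /\
    forall n, `|derive1n 3 (w n) x| `^ 2 <= B `^ 2}.
  apply: ae_mono aeE => x xE Kx; have [h1 h2] := HB x Kx.
  by rewrite (xE (KD _ Kx)); split => [|n]; apply: pB.
have p2 : (0 : R) < 2 by [].
apply: weak_of_strong.
- move=> n; apply: (dominated_Lp p2 mK (mdK n) iB).
  by apply: ae_mono weak_dom => x h /h[].
- apply: (dominated_Lp p2 mK mwd iB).
  by apply: ae_mono weak_dom => x h /h[].
- move=> n; apply: (Lp_diff p2 mK (mdK n) mwd iB).
  by apply: ae_mono weak_dom => x h Kx; have [] := h Kx.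
- by move=> v; exact: Lnorm_ge0.
- apply: (Lp_norm_diff_cvg0 p2 mK mdK mwd _ iB weak_dom).
  by apply: ae_mono aeE => x xE Kx; rewrite (xE (KD _ Kx)); apply: conv3; exact: KD.
Qed.

Let H x := 1 + wi x.
Let Q x := g * H x ^+ 3 * derive1 H x
  - mi * (H x ^+ 2 / (1 + H x) ^+ 2) * derive1 H x.

Let dH (x : R) : is_derive x 1 H (wi1 x).
Proof.
have h := lim_der pw uw uw1 x; have := is_deriveD (is_derive_cst (1 : R) x 1) h.
by rewrite add0r.
Qed.

Let dHE : derive1 H = wi1.
Proof. by apply/funext => x; exact: derive1_is_derive. Qed.

Lemma lim_C1 : cvg_C1 w wi.
Proof.
have dE : derive1 wi = wi1.
  by apply/funext => x; apply: derive1_is_derive; exact: (lim_der pw uw uw1).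
split.
- move=> n; split; first by move=> x; exact: (@sw n 0%N).
  exact: (prof_cont1 (pw n)).
- split; last by rewrite dE.
  by move=> x; exact: (@ex_derive _ _ _ _ _ _ _ (lim_der pw uw uw1 x)).
- exact: cvg_sup_uniform.
- by rewrite dE; exact: cvg_sup_uniform.
Qed.

(** h^3 h''' without its singularity: sums and products of h = 1 + y, h / (1 + h), a and z, all
    bounded and uniformly convergent along the sequence, so that [ucvgM] applies up to rupture. *)
Let q (a y z : R) := (g * ((1 + y) * ((1 + y) * (1 + y))) -
  a * ((1 + y) / (2 + y) * ((1 + y) / (2 + y)))) * z.

Let QE x : Q x = q mi (wi x) (wi1 x).
Proof.
have h := lim_ge pw uw x.
by rewrite /Q /q dHE /H; field; lra.
Qed.

Let seqE n x : (1 + w n x) ^+ 3 * derive1n 3 (fun y => 1 + w n y) x =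
  q (m n) (w n x) (derive1 (w n) x).
Proof.
have h := prof_gt (pw n) x.
have d1 : derive1 (fun y => 1 + w n y) = derive1 (w n).
  apply/funext => y; apply: derive1_is_derive.
  have := is_deriveD (is_derive_cst (1 : R) y 1) (prof_d1 (pw n) y).
  by rewrite add0r.
rewrite derive1Sn d1 -derive1Sn d3.
rewrite mulrA mulrBr mulrCA (cube_dnonlin h) /q; congr (_ * _).
by ring.
Qed.

Let ucvg_q : ucvg (fun n x => q (m n) (w n x) (derive1 (w n) x)) Q.
Proof.
have -> : Q = fun x => q mi (wi x) (wi1 x) by apply/funext => x; exact: QE.
have wge n x : 0 <= 1 + w n x by have := prof_gt (pw n) x; lra.
have ige x : 0 <= 1 + wi x by have := lim_ge pw uw x; lra.
pose A := 1 + wmax g k0.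
have wA n x : `|1 + w n x| <= A by rewrite ger0_norm ?lerD2l ?(seq_le g0 k00 kL pw bw wL).
have iA x : `|1 + wi x| <= A by rewrite ger0_norm ?lerD2l ?(lim_le g0 k00 kL pw bw wL uw).
have A0 : 0 <= A by apply: le_trans (wA 0%N 0); exact: normr_ge0.
have cH : ucvg (fun n x => 1 + w n x) (fun x => 1 + wi x).
  move=> e e0; have [N HN] := uw e0; exists N => n Nn x.
  by rewrite opprD addrACA subrr add0r; exact: HN.
have fr (h : R) : 0 <= h -> `|h / (1 + h)| <= 1.
  move=> h0; rewrite ger0_norm ?divr_ge0//; last lra.
  by rewrite ler_pdivrMr; lra.
have f2 (y : R) : (1 + y) / (2 + y) = (1 + y) / (1 + (1 + y)) by congr (_ / _); ring.
(* h / (1 + h) is 1-Lipschitz on h >= 0, so nothing is lost where h vanishes. *)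
have cF : ucvg (fun n x => (1 + w n x) / (2 + w n x)) (fun x => (1 + wi x) / (2 + wi x)).
  move=> e e0; have [N HN] := cH e e0; exists N => n Nn x.
  apply: le_trans (HN n Nn x); have h1 := wge n x; have h2 := ige x.
  have -> : (1 + w n x) / (2 + w n x) - (1 + wi x) / (2 + wi x) =
    ((1 + w n x) - (1 + wi x)) / ((2 + w n x) * (2 + wi x)).
    by field; apply/andP; split; lra.
  have p : 1 <= (2 + w n x) * (2 + wi x) by nra.
  rewrite normrM ler_piMr// ger0_norm ?invr_ge0; last lra.
  by rewrite invf_le1//; lra.
have fA n x : `|(1 + w n x) / (2 + w n x)| <= 1 by rewrite f2; exact: fr.
have fi x : `|(1 + wi x) / (2 + wi x)| <= 1 by rewrite f2; exact: fr.
have prod_le (a b B1 B2 : R) : `|a| <= B1 -> `|b| <= B2 -> `|a * b| <= B1 * B2.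
  by move=> h1 h2; rewrite normrM ler_pM.
have mm n : `|m n| <= mmax g k0.
  rewrite gtr0_norm ?(bump_m_gt0 g0 k00 kL (pw n) (@bw n))//.
  exact: (bump_m_le g0 k00 kL (pw n) (@bw n)).
apply: (@ucvgM _ (fun n x => _) (fun n x => _) (fun x => _) (fun x => _)
    (g * (A * (A * A)) + mmax g k0 * (1 * 1)) (slmax g k0)) => //.
- move=> n x; apply: (le_trans (ler_normB _ _)); apply: lerD; apply: (prod_le) => //.
  + by rewrite gtr0_norm.
  + by apply: (prod_le) => //; exact: prod_le.
  + exact: prod_le.
- exact: (lim_slope_le g0 k00 kL pw bw wL uw1).
- apply: ucvgB.
  + apply: (@ucvgM _ (fun _ _ => g) (fun n x => (1 + w n x) * ((1 + w n x) * (1 + w n x)))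
      (fun=> g) (fun x => (1 + wi x) * ((1 + wi x) * (1 + wi x))) `|g| (A * (A * A))) => //.
    * by move=> x; apply: (prod_le) => //; exact: prod_le.
    * by apply: ucvg_cst; exact: cvg_cst.
    * apply: (@ucvgM _ _ _ _ _ A (A * A)) => //.
        by move=> x; exact: prod_le.
      exact: (@ucvgM _ _ _ _ _ A A).
  + apply: (@ucvgM _ (fun n _ => m n) _ (fun=> mi) _ (mmax g k0) (1 * 1)) => //.
    * by move=> x; exact: prod_le.
    * exact: ucvg_cst.
    * exact: (@ucvgM _ _ _ _ _ 1 1).
Qed.

Let Q_cont : continuous Q.
Proof.
have -> : Q = fun x => g * H x ^+ 3 * wi1 x - mi * (H x ^+ 2 / (1 + H x) ^+ 2) * wi1 x.
  by apply/funext => x; rewrite /Q dHE.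
have cH : continuous H := der_continuous dH.
have cX (u : R -> R) k : continuous u -> continuous (fun x => u x ^+ k).
  by move=> cu x; exact: (cvg_comp _ _ (cu x) (@exprn_continuous _ k (u x))).
have cc' (a : R) : continuous (fun _ : R => a) by move=> y; exact: cvg_cst.
have cD : continuous (fun x => 1 + H x) by move=> x; apply: cvgD; [exact: cc'|exact: cH].
have h1 x : 0 < 1 + H x by have := lim_ge pw uw x; rewrite /H; lra.
move=> x; apply: cvgB.
  apply: cvgM; last exact: (lim_cont1 pw uw1).
  by apply: cvgM; [exact: cc'|exact: cX].
apply: cvgM; last exact: (lim_cont1 pw uw1).
apply: cvgM; first exact: cc'.
apply: cvgM; first exact: cX.
apply: cvgV; first by rewrite gt_eqF// exprn_gt0.
exact: (cX _ 2 cD x).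
Qed.

Let Q_on_D : {ae mu, forall x, 0 < H x -> Q x = H x ^+ 3 * wderiv D 3 wi x}.
Proof.
apply: ae_mono (wderiv_ae lim_wderiv3) => x h Hx.
rewrite h// QE; have p1 : -1 < wi x by move: Hx; rewrite /H; lra.
rewrite mulrA mulrBr mulrCA (cube_dnonlin p1) /q; congr (_ * _).
by rewrite /H; ring.
Qed.

Lemma lim_flux : exists Q : R -> R,
  [/\ continuous Q,
      {ae mu, forall x, 0 < H x -> Q x = H x ^+ 3 * wderiv D 3 wi x},
      (forall x, H x = 0 -> Q x = 0),
      (forall x, Q x = g * H x ^+ 3 * derive1 H x
         - mi * (H x ^+ 2 / (1 + H x) ^+ 2) * derive1 H x) &
      {uniform setT, (fun n x => (1 + w n x) ^+ 3
        * derive1n 3 (fun y => 1 + w n y) x) @ \oo --> Q}].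
Proof.
exists Q; split => //.
- by move=> x Hx; rewrite /Q Hx !expr0n/= !(mul0r, mulr0) subrr.
- apply: cvg_sup_uniform => e e0; have [N HN] := ucvg_q e0; exists N => n Nn x.
  by rewrite seqE; exact: HN.
Qed.

Let flux_vanishes (y z : R) : -1 < y ->
  (1 + y) ^+ 3 * ((g - mi * dnonlin y) * z - g * z) +
    mi * ((1 + y) ^+ 2 / (1 + (1 + y)) ^+ 2) * z = 0.
Proof. by move=> y1; rewrite /dnonlin; field; lra. Qed.

(** The flux is not merely constant but zero almost everywhere: on {h > 0} this is the
    differentiated equation h''' = (g - M f'(v)) h', f = [nonlin], multiplied by h^3. The integrand
    thus vanishes for every phi. *)
Lemma lim_weak_stationary : weak_stationary g mi H.
Proof.
have wd j u : (j <= 2)%N -> is_wderiv setT j wi u ->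
    is_wderiv setT j H (fun x => 1 * u x + derive1n j (fun=> 1 : R) x).
  move=> j2 hu; have -> : H = fun x => 1 * wi x + 1.
    by apply/funext => x; rewrite /H mul1r addrC.
  by apply: is_wderiv_lin => //; apply: smooth_wderiv; [exact: openT|exact: smooth_cst].
have d1c : derive1 (fun=> 1 : R) = fun=> 0.
  by apply/funext => x; apply: derive1_is_derive; exact: is_derive_cst.
have d3c : derive1n 3 (fun=> 1 : R) = fun=> 0.
  have d0c : derive1 (fun=> 0 : R) = fun=> 0.
    by apply/funext => x; apply: derive1_is_derive; exact: is_derive_cst.
  by rewrite !derive1nS derive1n0 d1c !d0c.
have wd3 : is_wderiv D 3 H (fun x => (g - mi * dnonlin (wi x)) * wi1 x).
  have h3 := lim_wderiv3.
  have -> : H = fun x => 1 * wi x + 1.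
    by apply/funext => x; rewrite /H mul1r addrC.
  have := is_wderiv_lin 1 h3 (smooth_wderiv 3 oD (@smooth_cst R 1)).
  congr is_wderiv; apply/funext => x.
  by rewrite d3c addr0 mul1r.
have wd1 : is_wderiv setT 1 H wi1.
  have := wd 1%N _ isT (lim_wderiv (isT : (1 <= 2)%N)).
  congr is_wderiv; apply/funext => x.
  by rewrite derive1n1 d1c addr0 mul1r.
have mD := open_measurable oD.
have mflux : measurable_fun setT (flux g mi H).
  have mH : measurable_fun setT H.
    by apply: continuous_measurable_fun; exact: der_continuous dH.
  rewrite /flux -/D; apply/(measurable_restrictT _ mD).
  have [_ [m3 _ _] _] := is_wderiv_wderiv wd3.
  have [_ [m1 _ _] _] := is_wderiv_wderiv wd1.
  have mH' := measurable_funTS mH : measurable_fun D H.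
  have m1' := measurable_funTS m1 : measurable_fun D (wderiv setT 1 H).
  apply: measurable_funD.
    apply: measurable_funM; first exact: measurable_funX.
    by apply: measurable_funB => //; exact: measurable_funM.
  apply: measurable_funM => //; apply: measurable_funM => //.
  apply: measurable_funM; first exact: measurable_funX.
  apply: (@measurableT_comp _ _ _ _ _ _ (fun z : R => z^-1)); first exact: measurable_inv.
  by apply: measurable_funX; exact: measurable_funD.
have flux0 : {ae mu, forall x, flux g mi H x = 0}.
  have := ae_and (wderiv_ae wd3) (wderiv_ae wd1); apply: ae_mono => x [h3 h1].
  rewrite /flux -/D patchE; case: ifPn => //; rewrite inE => Dx.
  rewrite (h3 Dx) (h1 I) /H.
  by apply: flux_vanishes; rewrite -subr_gt0 opprK addrC.
have cont_Lp (u : R -> R) : continuous u -> Lp_loc setT 2 u.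
  move=> cu K cK _; have [b b0 Kb] := compact_itv cK.
  have bb : - b <= b by lra.
  have [B HB] := cont_bound bb cu.
  apply: (@dominated_Lp _ K 2 u (fun=> B `^ 2)) => //.
  - exact: compact_measurable.
  - by apply: measurable_funTS; exact: continuous_measurable_fun.
  - apply: integrableS (integrable_cst_compact (B `^ 2) (@segment_compact R (- b) b)) => //; first exact: compact_measurable.
    by move=> x /Kb /andP[h1 h2]; rewrite /= in_itv/= !ltW.
  - apply: aeW => x /Kb /andP[h1 h2]; apply: ge0_ler_powR; rewrite ?nnegrE//.
      by apply: le_trans (HB x _); rewrite ?normr_ge0// !ltW.
    by apply: HB; rewrite !ltW.
split.
- split; first exact: der_continuous dH.
  case=> [_|[_|//]].
    exists H; last by apply: cont_Lp; exact: der_continuous dH.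
    have := wd 0%N _ isT (lim_wderiv (isT : (0 <= 2)%N)).
    by congr is_wderiv; apply/funext => x; rewrite derive1n0 mul1r addrC.
  by exists wi1 => //; apply: cont_Lp; exact: (lim_cont1 pw uw1).
- exists (fun x => (g - mi * dnonlin (wi x)) * wi1 x) => //.
  exact: lim_Lp_loc3.
- move=> K cK _; apply: (@dominated_Lp _ K 2 _ (fun=> 0)) => //.
  + exact: compact_measurable.
  + exact: measurable_funTS.
  + exact: integrable0.
  + by apply: ae_mono flux0 => x -> _; rewrite normr0 powR0.
- move=> phi Wphi _; rewrite /Rintegral.
  have [u hu _] := Wphi 1%N isT.
  have [_ [mphi _ _] _] := is_wderiv_wderiv hu.
  rewrite (@ae_eq_integral _ _ _ mu D (fun=> 0%E)) ?integral0//.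
    apply/measurable_EFinP; apply: measurable_funM; exact: measurable_funTS.
  by apply: ae_mono flux0 => x -> _; rewrite mul0r.
Qed.

End limit_spaces.

(** * The limit along the branch *)

Section subsequences.
Context {R : realType}.

Lemma near_harmonic (e : R) : 0 < e -> \forall n \near \oo, (n.+1%:R^-1 : R) < e.
Proof.
move=> e0; have /cvgrPdist_lt/(_ e e0) h := @cvg_harmonic R.
by apply: filterS h => n; rewrite sub0r normrN ger0_norm// harmonic_ge0.
Qed.

(** The condition n <= f n is weaker than strict monotonicity of f but suffices to inherit limits
    through [cvg_subseq]. *)
Lemma bolzano_weierstrass (u : nat -> R) (B : R) : (forall n, `|u n| <= B) ->
  exists (f : nat -> nat) (l : R), (forall n, (n <= f n)%N) /\
    u (f n) @[n --> \oo] --> l.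
Proof.
move=> uB.
have [l [_ cl]] : exists l : R, `[- B, B]%classic l /\ cluster (u @ \oo) l.
  have := @segment_compact R (- B) B (u @ \oo) _.
  case; last by move=> l [h1 h2]; exists l.
  by exists 0%N => // n _; rewrite /= in_itv/= -ler_norml.
have H n : exists k, (n <= k)%N /\ `|l - u k| < n.+1%:R^-1.
  have b0 : 0 < (n.+1%:R^-1 : R) by rewrite invr_gt0.
  have A : (u @ \oo) [set y | exists2 k, (n <= k)%N & y = u k].
    by exists n => // k /= nk; exists k.
  have [y [[k nk ->]]] := cl _ _ A (nbhsx_ballx l _ b0).
  by rewrite /ball/= => h; exists k.
have [f Hf] := choice H; exists f, l; split => [n|]; first by have [] := Hf n.
apply/cvgrPdist_le => e e0.
apply: filterS (near_harmonic e0) => n hn; have [_ h] := Hf n.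
by rewrite ltW// (lt_trans h).
Qed.

Lemma cvg_subseq (u : nat -> R) (l : R) (f : nat -> nat) :
  (forall n, (n <= f n)%N) -> u n @[n --> \oo] --> l -> u (f n) @[n --> \oo] --> l.
Proof.
move=> fn /cvgrPdist_le H; apply/cvgrPdist_le => e e0.
by have [N _ HN] := H e e0; exists N => // n /= Nn; apply: HN; exact: leq_trans (fn n).
Qed.

End subsequences.

Section branch_limit.
Context {R : realType}.
Notation mu := (@lebesgue_measure R).
Variables (g k0 : R).
Hypotheses (g0 : 0 < g) (k00 : 0 < k0).
Variables (v : R -> R -> R) (M : R -> R).
Hypothesis br : global_branch g k0 v M.
Let L := pi / k0.

Let kL : k0 * L = pi.
Proof. by rewrite /L mulrC divfK// gt_eqF. Qed.

Let L0 : 0 < L := half_period_gt0 k00 kL.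

Lemma branch_subsequence : exists (s : nat -> R) (mi ci ai : R),
  [/\ forall n, n%:R < s n, forall n, v (s n) L <= - 1 / 2,
      v (s n) L @[n --> \oo] --> (- 1 : R) &
      [/\ M (s n) @[n --> \oo] --> mi,
          branch_c k0 v M (s n) @[n --> \oo] --> ci &
          v (s n) 0 @[n --> \oo] --> ai]].
Proof.
(* The tolerance 1 / (n + 2) is at most 1 / 2, so v L <= -1 / 2 holds from the first term on.
   Folding and monotonicity move the low point to L. *)
have H n : exists t : R, n%:R < t /\ v t L < -1 + n.+2%:R^-1.
  have e0 : 0 < (n.+2%:R^-1 : R) by rewrite invr_gt0.
  have [t [nt [x xt]]] := branch_boundary g0 k00 br (n.+1%:R) e0.
  have t0 : 0 < t by apply: lt_le_trans nt.
  exists t; split; first by apply: lt_le_trans nt; rewrite ltr_nat.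
  apply: le_lt_trans xt.
  have pt := branch_profile k00 br t; have bt := branch_bump g0 k00 br t0.
  have [y [sg [j [/andP[y0 yL] sgE ->]]]] := fold_half x L0.
  rewrite (even_per_fold _ _ (prof_even pt) (prof_per pt) sgE).
  exact: bump_decr pt bt _ _ y0 yL (lexx L).
have [t Ht] := choice H.
have t0 n : 0 < t n by have [h _] := Ht n; apply: le_lt_trans h.
have pt n := branch_profile k00 br (t n).
have bt n := branch_bump g0 k00 br (t0 n).
have half n : (n.+2%:R^-1 : R) <= 1 / 2.
  by rewrite div1r lef_pV2 ?posrE// ler_nat.
have tL n : v (t n) L <= - 1 / 2 by
  have [_ h] := Ht n; move: h (half n); move: (n.+2%:R^-1 : R) => q; lra.
have cL : v (t n) L @[n --> \oo] --> (-1 : R).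
  apply/cvgrPdist_le => e e0.
  apply: filterS (near_harmonic e0) => n hn; have [_ h] := Ht n; have h2 := prof_gt (pt n) L.
  have h3 : (n.+2%:R^-1 : R) <= n.+1%:R^-1 by rewrite lef_pV2 ?posrE// ler_nat.
  move: h h2 h3 hn; move: (n.+2%:R^-1 : R) (n.+1%:R^-1 : R) => q q' *.
  by rewrite ler_norml; apply/andP; split; lra.
have mB n : `|M (t n)| <= mmax g k0.
  rewrite gtr0_norm ?(bump_m_gt0 g0 k00 kL (pt n) (bt n))//.
  exact: (bump_m_le g0 k00 kL (pt n) (bt n)).
(* Three successive extractions, for M, the multiplier and the height at 0: the data from which
   Gronwall's inequality recovers the profile. *)
have [f1 [mi [f1n cm]]] := bolzano_weierstrass mB.
have cB n : `|branch_c k0 v M (t (f1 n))| <= 2 * mmax g k0.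
  exact: (lim_c_bound g0 k00 kL (fun n => pt (f1 n)) (fun n => bt (f1 n)) (fun n => tL (f1 n))).
have [f2 [ci [f2n cc]]] := bolzano_weierstrass cB.
have aB n : `|v (t (f1 (f2 n))) 0| <= wmax g k0.
  rewrite gtr0_norm; last exact: (bump_max k00 kL (pt _) (bt _)).
  apply: (lim_w_le g0 k00 kL pt bt tL); rewrite lexx; exact: ltW.
have [f3 [ai [f3n ca]]] := bolzano_weierstrass aB.
pose f n := f1 (f2 (f3 n)).
have fn n : (n <= f n)%N by apply: leq_trans (f3n n) (leq_trans (f2n _) (f1n _)).
exists (fun n => t (f n)), mi, ci, ai; split => [n|n||].
- by have [h _] := Ht (f n); apply: le_lt_trans h; rewrite ler_nat.
- exact: tL.
- exact: (cvg_subseq fn cL).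
- split => //.
  + apply: (@cvg_subseq _ (fun n => M (t (f1 n))) _ (fun n => f2 (f3 n))) cm.
    by move=> n; exact: leq_trans (f3n n) (f2n _).
  + exact: (@cvg_subseq _ (fun n => branch_c k0 v M (t (f1 (f2 n)))) _ f3).
Qed.

End branch_limit.

Lemma mean_zero_limit (R : realType) (k0 : R) (u_ : nat -> R -> R) (u : R -> R) :
  0 < k0 -> (forall n, continuous (u_ n)) -> continuous u -> ucvg u_ u ->
  (forall n, mean_zero k0 (u_ n)) -> mean_zero k0 u.
Proof.
move=> k00 cu_ cu uu m0; pose L := pi / k0.
have L0 : 0 < L by rewrite divr_gt0// pi_gt0.
(* Starting the sequence at N makes B + 1 a majorant for every index. *)
have [N HN] := uu 1 ltr01.
have LL : - L <= L by lra.
have [B HB] := cont_bound LL cu.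
have uC n : continuous (u_ (n + N)%N) by exact: cu_.
have := @Rint_dominated _ (cell k0) (fun n => u_ (n + N)%N) u (fun=> B + 1) _ _ _ _ _ _.
move=> H; have {}H : (\int[lebesgue_measure]_(x in cell k0) u_ (n + N)%N x)%R @[n --> \oo] -->
    (\int[lebesgue_measure]_(x in cell k0) u x)%R.
  apply: H.
  - exact: measurable_cell.
  - by move=> n; apply: measurable_funTS; exact: continuous_measurable_fun (uC n).
  - by apply: measurable_funTS; exact: continuous_measurable_fun.
  - apply: aeW => x _; have h := unif_pointwise uu (x := x).
    exact: (@cvg_subseq _ (fun n => u_ n x) _ (fun n => n + N)%N (leq_addr N) h).
  - apply: integrableS (integrable_cst_compact (B + 1) (@segment_compact R (- L) L)) => //; first exact: measurable_cell.
    by move=> x; rewrite cellE// /= !in_itv/= => /andP[/ltW -> /ltW ->].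
  - apply: aeW => x n; rewrite cellE// /= in_itv/= => /andP[/ltW h1 /ltW h2].
    have := HN (n + N)%N (leq_addl _ _) x; have := HB x; rewrite h1 h2 => /(_ isT).
    by rewrite !ler_norml => /andP[? ?] /andP[? ?]; apply/andP; split; lra.
rewrite /mean_zero -(cvg_lim _ H)//; under eq_fun do rewrite (m0 (_ + N)%N : _ = 0).
exact: lim_cst.
Qed.

Theorem theorem5p5 (R : realType) (g k0 : R) (hg : 0 < g) (hk0 : 0 < k0)
    (v : R -> R -> R) (M : R -> R) (hbranch : global_branch g k0 v M) :
  exists (Minf : R) (vinf : R -> R),
    let hinf := fun x => 1 + vinf x in
    let D := [set x | 0 < hinf x] in
    let d3 := wderiv D 3 vinf in
    [/\ 0 < Minf,
        (forall p : R, 1 <= p -> W_per k0 2 p vinf),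
        (exists2 w, is_wderiv D 3 vinf w & Lp_loc D 2 w),
        (X k0 vinf /\ Kcone k0 vinf) /\
        {in `[-(pi / k0), 0[ &, {homo vinf : x y / x <= y}} &
        (forall x, -1 <= vinf x) /\
        (forall x, vinf x = -1 <->
           exists j : int, x = pi / k0 + 2 * j%:~R * (pi / k0) \/
                           x = - (pi / k0) + 2 * j%:~R * (pi / k0))] /\
    (exists s : nat -> R,
      [/\ s n @[n --> \oo] --> +oo,
          (forall p : R, 1 <= p ->
             weak_cvg (W_per k0 2 p) (W_norm k0 2 p) (fun n => v (s n)) vinf),
          cvg_C1 (fun n => v (s n)) vinf,
          weak_cvg_Lp_loc D 2 (fun n => derive1n 3 (v (s n))) d3 &
          exists Q : R -> R,
            [/\ continuous Q,
                {ae lebesgue_measure, forall x, 0 < hinf x ->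
                   Q x = hinf x ^+ 3 * d3 x},
                (forall x, hinf x = 0 -> Q x = 0),
                (forall x, Q x = g * hinf x ^+ 3 * derive1 hinf x
                   - Minf * (hinf x ^+ 2 / (1 + hinf x) ^+ 2) * derive1 hinf x) &
                {uniform setT, (fun n x => (1 + v (s n) x) ^+ 3
                  * derive1n 3 (fun y => 1 + v (s n) y) x) @ \oo --> Q}]]) /\
    weak_stationary g Minf hinf.
Proof.
have kL : k0 * (pi / k0) = pi by rewrite mulrC divfK// gt_eqF.
have [s [mi [ci [ai [ns wL cL [cm cc ca]]]]]] := branch_subsequence hg hk0 hbranch.
have s0 n : 0 < s n by apply: le_lt_trans (ns n).
have sw n : smooth (v (s n)) by apply: (global_smooth hbranch).
have pw n := branch_profile hk0 hbranch (s n).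
have bw n := branch_bump hg hk0 hbranch (s0 n).
(* Convergence of M, c and the height makes profiles and slopes uniformly Cauchy, so no further
   extraction is needed. *)
have cauchy := lim_cauchy hg hk0 kL pw bw wL cL cm cc ca.
have [wi uw] : exists wi, ucvg (fun n => v (s n)) wi.
  apply: unif_cauchy_limit => e e0; have [N HN] := cauchy e e0.
  by exists N => n k Nn Nk x; have [] := HN n k Nn Nk x.
have [wi1 uw1] : exists wi1, ucvg (fun n => derive1 (v (s n))) wi1.
  apply: unif_cauchy_limit => e e0; have [N HN] := cauchy e e0.
  by exists N => n k Nn Nk x; have [] := HN n k Nn Nk x.
have cwi := lim_cont pw uw uw1.
have Wp (p : R) : 1 <= p -> W_per k0 2 p wi.
  by move=> p1; exact: (lim_W_per hg hk0 sw pw bw wL cm cc uw uw1).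
have incr x y : - (pi / k0) <= x -> x <= y -> y <= 0 -> wi x <= wi y.
  exact: (lim_incr pw bw uw).
have Xwi : X k0 wi.
  split => //; first by apply: Wp; rewrite ler1n.
    exact: (lim_even pw uw).
  apply: (mean_zero_limit hk0 _ _ uw) => // n; first exact: (prof_cont (pw n)).
  by have [[[]]] := global_solution hbranch (s n).
exists mi, wi; split; [split => //|split].
- by apply: lt_le_trans (lim_m_ge hg hk0 kL pw bw wL cm); rewrite divr_gt0.
- exists (fun x => (g - mi * dnonlin (wi x)) * wi1 x).
    exact: (lim_wderiv3 hg hk0 sw pw bw wL cL cm uw uw1).
  exact: (lim_Lp_loc3 hg hk0 pw bw wL cL cm uw uw1).
- split; first split => //.
    split => // x y; rewrite !inE/= !in_itv/= => /andP[x1 x2] /andP[y1 y2] xy.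
    by apply: incr => //; exact: ltW.
  move=> x y; rewrite !inE/= !in_itv/= => /andP[x1 x2] /andP[y1 y2] xy.
  by apply: incr => //; exact: ltW.
- split; first exact: (lim_ge pw uw).
  exact: (lim_eq_min hg hk0 kL pw bw wL cL uw).
- exists s; split.
  + apply/cvgryPge => A; exists (Num.Def.archi_bound `|A|) => // n /= An.
    apply: le_trans (ltW (ns n)); apply: (le_trans (ler_norm A)).
    by apply: (le_trans (ltW (archi_boundP (normr_ge0 A)))); rewrite ler_nat.
  + move=> p p1; exact: (seq_weak_cvg hg hk0 sw pw bw wL cm cc uw uw1).
  + exact: (lim_C1 sw pw uw uw1).
  + exact: (lim_weak3 hg hk0 sw pw bw wL cL cm uw uw1).
  + exact: (lim_flux hg hk0 sw pw bw wL cL cm uw uw1).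
- exact: (lim_weak_stationary hg hk0 sw pw bw wL cL cm cc uw uw1).
Qed.
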